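(* Let $d\ge2$, $n\ge d+2$, $D=\binom{d+2}{2}$, and let $\mathbf N$ be one of the two $D\times D$ matrices $\mathbf N^d_1$, $\mathbf N^d_2$ (defined in the context). Let $\mathbf w=(w_1,\dots,w_D)$ have rational rank $D$ and describe a point in $\mathbb C^D$ that is a point of $\mathbf N(L_{d,d+2})$. Suppose there is a configuration $\mathbf p$ of $n$ points in $\mathbb R^d$ that is generic (or simply such that $l(\mathbf p)$ is generic in $L_{d,n}$) and $D$ non-negative rational functionals $\gamma_1,\dots,\gamma_D$ such that $w_i=\langle\gamma_i,\mathbf p\rangle$ for all $i$. Then there must be a $(d+2)$-point subconfiguration $\mathbf p_T$ of $\mathbf p$ such that $\mathbf w=s\cdot\mathbf N(l(\mathbf p_T))$, where $s$ is an unknown positive scale factor. The data $\mathbf w$ determines this $\mathbf p_T$ up to a similarity transform.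
   Context: For a positive integer $n$ let $N=\binom n2$ and index the coordinates of $\mathbb C^N$ by pairs $ij$ ($1\le i<j\le n$) in a fixed order. For a complex configuration $\mathbf p=(\mathbf p_1,\dots,\mathbf p_n)$ of points in $\mathbb C^d$ put $m_{ij}(\mathbf p)=\sum_{k=1}^d(\mathbf p_i^k-\mathbf p_j^k)^2$ (no conjugation). $M_{d,n}\subset\mathbb C^N$ is the set of all vectors $(m_{ij}(\mathbf p))_{ij}$ and $L_{d,n}$ is its preimage under coordinate-wise squaring. For $d\ge2$, $n\ge d+2$, $L_{d,n}$ is an irreducible variety defined over $\mathbb Q$; a point of it is generic if its coordinates satisfy no polynomial equation with rational coefficients other than those satisfied on all of $L_{d,n}$. A configuration in $\mathbb R^d$ is generic if its $dn$ coordinates satisfy no non-trivial polynomial equation with rational coefficients. For a real configuration, $l(\mathbf p)=(|\mathbf p_i-\mathbf p_j|)_{ij}$ is the vector of Euclidean edge lengths. A functional $\gamma=(\gamma^{ij})$ acts by $\langle\gamma,\mathbf p\rangle=\sum_{i<j}\gamma^{ij}|\mathbf p_i-\mathbf p_j|$; it is a non-negative rational functional if all $\gamma^{ij}$ are non-negative rationals. A $(d+2)$-point subconfiguration is $\mathbf p_T=(\mathbf p_{i_1},\dots,\mathbf p_{i_{d+2}})$ for an ordered sequence $T=(i_1,\dots,i_{d+2})$ of distinct indices; $l(\mathbf p_T)\in\mathbb R^D$ is its edge length vector, using the order of $T$. The rational rank of a finite sequence of complex numbers is the size of a maximal subset that is linearly independent over $\mathbb Q$. The canonical matrices have columns indexed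 by the edges $ij$ of $K_{d+2}$ on $\{1,\dots,d+2\}$. Let $\mathbf e_{ij}$ be the corresponding coordinate row vector; the ping $[i,j,i]$ is the row $2\mathbf e_{ij}$ and the triangle $[i,j,k,i]$ is the row $\mathbf e_{ij}+\mathbf e_{jk}+\mathbf e_{ik}$. Let $C=\binom{d+1}{2}$. $\mathbf N^d_1$: its $D$ rows are the $d+1$ pings $[1,j,1]$, $2\le j\le d+2$, and the triangles $[1,j_1,j_2,1]$, $2\le j_1<j_2\le d+2$, ordered so that each of the first $C$ rows is supported on edges among the vertices $1,\dots,d+1$. $\mathbf N^d_2$: its first $C$ rows are the unit rows $\mathbf e_{ij}$ for the edges among the vertices $1,\dots,d+1$; its remaining $d+1$ rows are the ping $[1,d+2,1]$ and the triangles $[1,k,d+2,1]$, $2\le k\le d+1$. *)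

(* Defs.v *)
From HB Require Import structures.
From mathcomp Require Import all_boot all_order all_algebra.
From mathcomp Require Import boolp classical_sets reals complex mpoly.

Set Implicit Arguments.
Unset Strict Implicit.
Unset Printing Implicit Defensive.

Import Order.TTheory GRing.Theory Num.Theory.
Local Open Scope classical_set_scope.
Local Open Scope ring_scope.

(* Vertices are numbered from 0: vertex i of {1, ..., n} is the ordinal       *)
(* i - 1.                                                                     *)

Definition edges n : {set 'I_n * 'I_n} :=
  [set e : 'I_n * 'I_n | (e.1 < e.2)%N]%SET.

Lemma card_edges n : #|edges n| = 'C(n, 2).
Proof.
rewrite -bin2_sum big_mkord -sum1dep_card.
rewrite -(pair_big_dep xpredT (fun i j : 'I_n => (i < j)%N)
                       (fun _ _ => 1%N)) /=.
rewrite (exchange_big_dep xpredT) //=; apply: eq_bigr => j _.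
rewrite -(big_ord_widen _ (fun _ => 1%N) (ltnW (ltn_ord j))).
by rewrite sum1_card card_ord.
Qed.

(* The fixed order of the edges is the enumeration order of [edges n].        *)
Definition edge n (k : 'I_('C(n, 2))) : 'I_n * 'I_n :=
  enum_val (cast_ord (esym (card_edges n)) k).

(* A configuration of n points in F^d is an n x d matrix whose rows are the   *)
(* points.                                                                    *)
Definition sqdist (F : comNzRingType) (d n : nat) (p : 'M[F]_(n, d)) :
    'cV[F]_('C(n, 2)) :=
  \col_k \sum_(a < d) (p (edge k).1 a - p (edge k).2 a) ^+ 2.

Definition M_set (R : realType) (d n : nat) : set 'cV[R[i]]_('C(n, 2)) :=
  [set sqdist p | p in [set: 'M[R[i]]_(n, d)]].

Definition L_set (R : realType) (d n : nat) : set 'cV[R[i]]_('C(n, 2)) :=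
  [set x | @M_set R d n (map_mx (fun z => z ^+ 2) x)].

Definition generic_in_L (R : realType) (d n : nat)
    (x : 'cV[R[i]]_('C(n, 2))) : Prop :=
  @L_set R d n x /\
  forall f : {mpoly rat['C(n, 2)]},
    (map_mpoly ratr f).@[fun k => x k 0] = 0 ->
    forall y, @L_set R d n y -> (map_mpoly ratr f).@[fun k => y k 0] = 0.

Definition generic_config (R : realType) (d n : nat) (p : 'M[R]_(n, d)) :
    Prop :=
  forall f : {mpoly rat[n * d]},
    (map_mpoly ratr f).@[fun k => mxvec p 0 k] = 0 -> f = 0.

Definition edge_lengths (R : realType) (d n : nat) (p : 'M[R]_(n, d)) :
    'cV[R]_('C(n, 2)) :=
  map_mx Num.sqrt (sqdist p).

Definition mx_to_complex (R : realType) (m n : nat) (A : 'M[R]_(m, n)) :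
    'M[R[i]]_(m, n) :=
  map_mx (real_complex R) A.

Definition nonneg_functional n (g : 'rV[rat]_('C(n, 2))) : Prop :=
  forall k, 0 <= g 0 k.

Definition measure_config (R : realType) (d n : nat) (g : 'rV[rat]_('C(n, 2)))
    (p : 'M[R]_(n, d)) : R :=
  \sum_k ratr (g 0 k) * edge_lengths p k 0.

Definition lin_indep_rat (F : numFieldType) (m : nat) (v : 'I_m -> F)
    (A : {set 'I_m}) : Prop :=
  forall c : 'I_m -> rat,
    \sum_(i in A) ratr (c i) * v i = 0 -> forall i, i \in A -> c i = 0.

Definition rational_rank (F : numFieldType) (m : nat) (v : 'I_m -> F) : nat :=
  \max_(A : {set 'I_m} | `[< lin_indep_rat v A >]) #|A|.

Definition unit_row n (i j : 'I_n) : 'rV[rat]_('C(n, 2)) :=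
  \row_k ((edge k == (i, j)) || (edge k == (j, i)))%:R.

Definition ping n (i j : 'I_n) : 'rV[rat]_('C(n, 2)) := 2 *: unit_row i j.

Definition triangle n (i j k : 'I_n) : 'rV[rat]_('C(n, 2)) :=
  unit_row i j + unit_row j k + unit_row i k.

Definition rows m n (A : 'M[rat]_(m, n)) : seq 'rV[rat]_n :=
  [seq row i A | i <- enum 'I_m].

(* The order of the rows of the two canonical matrices is fixed only up to    *)
(* permutations respecting the first C(d+1, 2) rows, so each matrix is        *)
(* described by the predicate of being an admissible ordering of its rows.    *)
Definition is_N1 d (A : 'M[rat]_('C(d.+2, 2))) : Prop :=
  perm_eq (rows A)
    ([seq ping ord0 j | j : 'I_d.+2 <- enum 'I_d.+2 & (0 < j)%N] ++
     [seq triangle ord0 e.1 e.2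
        | e : 'I_d.+2 * 'I_d.+2 <- enum (edges d.+2) & (0 < e.1)%N]) /\
  forall r k : 'I_('C(d.+2, 2)), (r < 'C(d.+1, 2))%N -> A r k != 0 ->
    ((edge k).1 < d.+1)%N /\ ((edge k).2 < d.+1)%N.

Definition is_N2 d (A : 'M[rat]_('C(d.+2, 2))) : Prop :=
  perm_eq (take 'C(d.+1, 2) (rows A))
    [seq unit_row e.1 e.2
       | e : 'I_d.+2 * 'I_d.+2 <- enum (edges d.+2) & (e.2 < d.+1)%N] /\
  perm_eq (drop 'C(d.+1, 2) (rows A))
    (ping ord0 ord_max ::
     [seq triangle ord0 k ord_max
        | k : 'I_d.+2 <- enum 'I_d.+2 & (0 < k < d.+1)%N]).

Definition similar_configs (R : realType) (d n : nat) (p q : 'M[R]_(n, d)) :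
    Prop :=
  exists (c : R) (U : 'M[R]_d) (t : 'rV[R]_d),
    [/\ 0 < c, U *m U^T = 1%:M & forall i, row i q = c *: (row i p *m U) + t].

(* Main.v *)
Require Import Defs.
From HB Require Import structures.
From mathcomp Require Import boolp classical_sets reals complex mpoly.
From mathcomp Require Import all_boot all_order fingroup perm all_algebra.
From mathcomp Require Import ring lra zify.

(* Write [E] for the rational matrix [N^-1 Gamma], so that [x = E l(p)] lies  *)
(* in [L] for [d + 2] points in dimension [d].  Let [f] be the polynomial     *)
(* obtained by composing the Cayley-Menger determinant of the edge lengths of *)
(* [d + 2] points with [E]; it has degree [2 (d + 1)] and vanishes at [l(p)], *)
(* hence, by genericity, at every point of [L] for [n] points (for a generic  *)
(* [p], the field generated by the edge lengths is a tower of quadratic       *)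
(* extensions, so that all changes of sign of [l(p)] are zeros of [f]).       *)
(* Group the monomials of [f] by the set [S] of variables of odd degree:      *)
(* [f = sum_S (prod_(i in S) y_i) g_S(y^2)], where every [g_S] vanishes on    *)
(* the squared distances, that is, on all sums of [d] squared distance        *)
(* vectors of collinear configurations.  A polynomial of degree at most [d]   *)
(* with this property is zero, since successive differences vanish on shorter *)
(* sums and the collinear vectors span; for [S] nonempty [g_S] has such a     *)
(* degree, so that [f] is even in every edge.  The remaining [g_0] has degree *)
(* [d + 1], so that along a collinear direction it is only quadratic; hence   *)
(* [f] is quadratic in [t] when the edges at one vertex are lengthened by     *)
(* [+-t].  For the determinant itself, the only directions in which it is     *)
(* quadratic are supported on the edges at one vertex, with entries equal up  *)
(* to sign.  So [E] sends signed vertex stars to signed vertex stars, and the *)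
(* signs of the rows of [Gamma] force it to be a positive multiple of a       *)
(* relabelling of the edges by an injection [T] of the vertices.              *)

Set Implicit Arguments.
Unset Strict Implicit.
Unset Printing Implicit Defensive.

Import Order.TTheory GRing.Theory Num.Theory.
Local Open Scope ring_scope.

(** * Finite differences *)

(** Since the entries of [w] are rationally independent, [N] and the matrix [Gam] of the functionals
    have full row rank. So [E = N^-1 Gam] exists and has a right inverse, and everything reduces to
    showing that [E] is a positive multiple of a relabelling of edges. Two facts are known about
    [E]: the composite of the Cayley-Menger determinant with it, [pullback], vanishes at one generic
    length vector, and [N E] has nonnegative entries.

    Genericity spreads the vanishing: by [parity_coef0] every parity coefficient of [pullback]
    vanishes at the squared distances of all complex configurations. The principle [deg_lt_vanish]
    turns this, by a count of degrees, into two symmetries: [pullback_flip] (changing the sign of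
    any length preserves the value) and [pullback_star] (the value is quadratic along a signed
    vertex star).

    On the side of the determinant, [deg2_star] classifies the quadratic directions. Any two edges
    in the support of such a direction meet, so the support is a star or a triangle; a triangle
    would produce degree six, and a star with unequal squares degree four. As [E] is onto, it
    therefore sends signed stars to scaled signed stars, possibly zero.

    The rest is combinatorial and culminates in [embedding]. Evenness makes the nonzero columns of
    [E] independent ([Z_ker]) and puts columns supported on a star onto single coordinate axes
    ([star_reflection]). The pings and triangles of [N] supply just enough nonnegativity to locate
    the centres of the stars and to fix the signs. For uniqueness up to similarity, [N] is
    invertible, so the edge lengths are determined up to scale, and [gram_congruent] applies. *)

Definition fdiff (V W : zmodType) (a : V) (f : V -> W) (v : V) : W :=
  f (v + a) - f v.

(* [deg_lt k f]: all [k]-fold finite differences of [f] vanish, the form in   *)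
(* which "polynomial of degree less than [k]" is used here.                   *)
Fixpoint deg_lt (V W : zmodType) (k : nat) (f : V -> W) : Prop :=
  if k is k'.+1 then forall a, deg_lt k' (fdiff a f) else forall v, f v = 0.

Section DegLt.
Variables (V W : zmodType).
Implicit Types f g : V -> W.

Lemma deg_lt_ext k f g : f =1 g -> deg_lt k f -> deg_lt k g.
Proof.
elim: k f g => [|k IH] f g fg /= H; first by move=> v; rewrite -fg.
by move=> a; apply: IH (H a) => v; rewrite /fdiff !fg.
Qed.

Lemma deg_ltD k f g : deg_lt k f -> deg_lt k g -> deg_lt k (fun v => f v + g v).
Proof.
elim: k f g => [|k IH] f g /= Hf Hg; first by move=> v; rewrite Hf Hg addr0.
move=> a; apply: deg_lt_ext (IH _ _ (Hf a) (Hg a)) => v.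
by rewrite /fdiff opprD addrACA.
Qed.

Lemma deg_ltN k f : deg_lt k f -> deg_lt k (fun v => - f v).
Proof.
elim: k f => [|k IH] f /= Hf; first by move=> v; rewrite Hf oppr0.
by move=> a; apply: deg_lt_ext (IH _ (Hf a)) => v; rewrite /fdiff opprB opprK addrC.
Qed.

Lemma deg_lt0 k : deg_lt k (fun _ : V => 0 : W).
Proof.
elim: k => [|k IH] //= a.
by apply: deg_lt_ext IH => v; rewrite /fdiff subrr.
Qed.

Lemma deg_ltMn k f m : deg_lt k f -> deg_lt k (fun v => f v *+ m).
Proof.
move=> Hf; elim: m => [|m IH]; first exact: deg_lt0.
by apply: deg_lt_ext (deg_ltD Hf IH) => v; rewrite mulrS.
Qed.

Lemma deg_lt_shift k f b : deg_lt k f -> deg_lt k (fun v => f (v + b)).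
Proof.
elim: k f => [|k IH] f /= Hf; first by move=> v; rewrite Hf.
by move=> a; apply: deg_lt_ext (IH _ (Hf a)) => v; rewrite /fdiff addrAC.
Qed.

Lemma deg_ltS k f : deg_lt k f -> deg_lt k.+1 f.
Proof.
by elim: k f => [|k IH] f Hf a /=; [move=> v; rewrite /fdiff !Hf subrr | apply: IH].
Qed.

Lemma deg_lt_leq k l f : (k <= l)%N -> deg_lt k f -> deg_lt l f.
Proof.
move=> /subnK <-; elim: (l - k)%N => [|j IH] // Hf.
by rewrite addSn; apply: deg_ltS; apply: IH.
Qed.

End DegLt.

Lemma deg_lt_sum (V W : zmodType) k (I : Type) (r : seq I) (P : pred I)
    (F : I -> V -> W) :
  (forall i, P i -> deg_lt k (F i)) ->
  deg_lt k (fun v => \sum_(i <- r | P i) F i v).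
Proof.
move=> HF; elim: r => [|i r IH].
  by apply: deg_lt_ext (deg_lt0 V W k) => v; rewrite big_nil.
have [Pi|nPi] := boolP (P i).
  by apply: deg_lt_ext (deg_ltD (HF i Pi) IH) => v; rewrite big_cons Pi.
by apply: deg_lt_ext IH => v; rewrite big_cons (negbTE nPi).
Qed.

Section DegLtRing.
Variables (V : zmodType) (A : comPzRingType).
Implicit Types f g : V -> A.

(** Induction on the sum of the degrees, using the product rule for differences: the difference of
    [f g] is [fdiff c f v * g (v + c) + f v * fdiff c g v]. *)
Lemma deg_ltM a b f g :
  deg_lt a.+1 f -> deg_lt b.+1 g -> deg_lt (a + b).+1 (fun v => f v * g v).
Proof.
have [k] := ubnP (a + b)%N; elim: k a b f g => // k IH a b f g ltk Hf Hg c.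
have E : (fun v => fdiff c f v * g (v + c) + f v * fdiff c g v) =1
         fdiff c (fun v => f v * g v).
  by move=> v; rewrite /fdiff mulrBl mulrBr addrA subrK.
apply: deg_lt_ext E _; apply: deg_ltD.
  case: a ltk Hf => [|a] ltk Hf.
    by apply: deg_lt_ext (deg_lt0 _ _ _) => v; rewrite (Hf c) mul0r.
  by apply: (IH a b) (Hf c) (deg_lt_shift c Hg); move: ltk; lia.
case: b ltk Hg => [|b] ltk Hg.
  by apply: deg_lt_ext (deg_lt0 _ _ _) => v; rewrite (Hg c) mulr0.
by rewrite plusE addnS; apply: (IH a b) Hf (Hg c); move: ltk; lia.
Qed.

Lemma deg_lt_cst k (c : A) : deg_lt k.+1 (fun _ : V => c).
Proof.
by move=> a; apply: deg_lt_ext (deg_lt0 _ _ _) => v; rewrite /fdiff subrr.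
Qed.

Lemma deg_ltX f m : deg_lt 2 f -> deg_lt m.+1 (fun v => f v ^+ m).
Proof.
move=> Hf; elim: m => [|m IH].
  by apply: deg_lt_ext (deg_lt_cst 0 1) => v; rewrite expr0.
by apply: deg_lt_ext (deg_ltM Hf IH) => v; rewrite exprS.
Qed.

Lemma deg_lt_prod (I : Type) (r : seq I) (F : I -> V -> A) (e : I -> nat) :
  (forall i, deg_lt (e i).+1 (F i)) ->
  deg_lt (\sum_(i <- r) e i).+1 (fun v => \prod_(i <- r) F i v).
Proof.
move=> HF; elim: r => [|i r IH].
  by rewrite big_nil; apply: deg_lt_ext (deg_lt_cst 0 1) => v; rewrite big_nil.
by rewrite big_cons; apply: deg_lt_ext (deg_ltM (HF i) IH) => v; rewrite big_cons.
Qed.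

End DegLtRing.

(** * Functions of low degree vanishing on sums of generators *)

Section Generated.
Variables (V : zmodType) (W : comNzRingType) (G : V -> Prop).

Definition sum_of k (v : V) : Prop :=
  exists x : 'I_k -> V, (forall i, G (x i)) /\ v = \sum_i x i.

Lemma sum_ofS k v x : sum_of k v -> G x -> sum_of k.+1 (v + x).
Proof.
move=> [y [Gy ->]] Gx.
exists (fun i => oapp y x (unlift ord_max i)); split.
  by move=> i; case: unlift.
rewrite big_ord_recr /= unlift_none; congr (_ + _); apply: eq_bigr => i _.
have -> : widen_ord (leqnSn k) i = lift ord_max i.
  by apply: val_inj; rewrite /= /bump leqNgt ltn_ord.
by rewrite liftK.
Qed.

Hypothesis G0 : G 0.

Lemma sum_of_pad k v : sum_of k v -> sum_of k.+1 v.
Proof. by move=> H; rewrite -[v]addr0; apply: sum_ofS. Qed.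

Hypothesis genG : forall f : V -> W,
  (forall v x, G x -> f (v + x) = f v) -> forall v, f v = f 0.

(** For [x] in [G], the difference of [f] along [x] has smaller degree and vanishes on sums of one
    generator fewer, so it is zero by induction. Hence [f] is invariant under [G], and [genG] makes
    it constant. *)
Lemma deg_lt_vanish k (f : V -> W) :
  deg_lt k.+1 f -> (forall v, sum_of k v -> f v = 0) -> forall v, f v = 0.
Proof.
elim: k f => [|k IH] f Hf f0 v.
  rewrite (genG _ v) => [|u x _].
    by apply: f0; exists (fun _ => 0); split=> //; rewrite big_ord0.
  by apply/eqP; rewrite -subr_eq0; apply/eqP; apply: (Hf x).
rewrite (genG _ v) => [|u x Gx].
  apply: f0; exists (fun _ => 0); split=> //; rewrite big1 //.
apply/eqP; rewrite -subr_eq0; apply/eqP.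
apply: (IH (fdiff x f)) (Hf x) _ u => {}u Hu.
by rewrite /fdiff !f0 ?subrr //; [apply: sum_of_pad | apply: sum_ofS].
Qed.

(** The defect of additivity is the second difference of [f] along [a] and [b]. *)
Lemma deg_lt_fdiffD k (f : V -> W) a b : deg_lt k.+2 f ->
  deg_lt k (fun v => fdiff (a + b) f v - (fdiff a f v + fdiff b f v)).
Proof.
move=> Hf; apply: deg_lt_ext (Hf b a) => v; rewrite /fdiff.
by rewrite addrA; ring.
Qed.

Lemma deg_lt_fdiffMn k (f : V -> W) a m : deg_lt k.+2 f ->
  deg_lt k (fun v => fdiff (a *+ m) f v - fdiff a f v *+ m).
Proof.
move=> Hf; elim: m => [|m IH].
  by apply: deg_lt_ext (deg_lt0 _ _ _) => v; rewrite !mulr0n /fdiff addr0 !subrr.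
apply: deg_lt_ext (deg_ltD (deg_lt_fdiffD a (a *+ m) Hf) IH) => v.
by rewrite !mulrS; ring.
Qed.

(** The degree of [f] exceeds the number of generators at whose sums it vanishes by one, so
    [deg_lt_vanish] does not apply to [f]. It applies to [phi], the defect of additivity of first
    differences: this has degree at most [k], and vanishes on sums of [k] generators because the
    whole curve lies in [G]. *)
Lemma quadratic_along k (f : V -> W) (a0 c e : V) :
  deg_lt k.+3 f -> (forall v, sum_of k.+1 v -> f v = 0) ->
  (forall m, G (a0 + c *+ m + e *+ (m * m.-1))) -> G e ->
  forall v m, f (v + a0 + c *+ m + e *+ (m * m.-1)) =
    f (v + a0) + (f (v + a0 + c) - f (v + a0)) *+ m +
    (f (v + e) - f v) *+ (m * m.-1).
Proof.
move=> Hf f0 Ga Ge v m; set m2 := (m * m.-1)%N.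
pose D x := fdiff x f.
pose phi u := (D (a0 + c *+ m + e *+ m2) u - D a0 u)
  - ((D (a0 + c) u - D a0 u) *+ m + D e u *+ m2).
have phi0 : forall u, phi u = 0.
  apply: (@deg_lt_vanish k) => [|u Hu]; last first.
    have Z x : G x -> f (u + x) = 0 by move=> Gx; apply/f0/sum_ofS.
    have Ga0 : G a0 by have := Ga 0; rewrite mulr0n mul0n mulr0n !addr0.
    have Ga1 : G (a0 + c) by have := Ga 1; rewrite mulr1n mul1n mulr0n !addr0.
    rewrite /phi /D /fdiff !Z // (f0 u) ?subrr ?mul0rn ?addr0 ?subrr //.
    exact: sum_of_pad.
  have H1 := deg_lt_fdiffD (a0 + c *+ m) (e *+ m2) Hf.
  have H2 := deg_lt_fdiffD a0 (c *+ m) Hf.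
  have H3 := deg_lt_fdiffMn c m Hf.
  have H4 := deg_lt_fdiffMn e m2 Hf.
  have H5 := deg_ltN (deg_ltMn m (deg_lt_fdiffD a0 c Hf)).
  apply: deg_lt_ext (deg_ltD (deg_ltD (deg_ltD H1 H2) (deg_ltD H3 H4)) H5) => u.
  by rewrite /phi /D; ring.
move: (phi0 v); rewrite /phi /D /fdiff !addrA => /eqP; rewrite subr_eq0 => /eqP E.
have -> : f (v + a0 + c *+ m + e *+ m2) =
    (f (v + a0 + c *+ m + e *+ m2) - f v - (f (v + a0) - f v)) + f (v + a0).
  by ring.
by rewrite E; ring.
Qed.

End Generated.

(** * Cayley-Menger determinants *)

Section Determinants.
Variable A : comNzRingType.

Lemma det_mx22 (M : 'M[A]_2) : \det M = M 0 0 * M 1 1 - M 0 1 * M 1 0.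
Proof.
pose f (i j : nat) := M (inord i) (inord j).
have E : M = \matrix_(i, j) f i j by apply/matrixP => i j; rewrite mxE /f !inord_val.
rewrite E (expand_det_row _ 0) !big_ord_recl big_ord0 /cofactor !det_mx11 !mxE /=.
by rewrite /bump /=; ring.
Qed.

Lemma det_mx33 (M : 'M[A]_3) : let: (e0, e1, e2) := (0, 1, inord 2) in
  \det M =
    M e0 e0 * (M e1 e1 * M e2 e2 - M e1 e2 * M e2 e1)
  - M e0 e1 * (M e1 e0 * M e2 e2 - M e1 e2 * M e2 e0)
  + M e0 e2 * (M e1 e0 * M e2 e1 - M e1 e1 * M e2 e0).
Proof.
pose f (i j : nat) := M (inord i) (inord j).
have E : M = \matrix_(i, j) f i j by apply/matrixP => i j; rewrite mxE /f !inord_val.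
rewrite E (expand_det_row _ 0) !big_ord_recl big_ord0 /cofactor.
pose g (j : nat) i k := f i.+1 (bump j k).
have R (j : 'I_3) : row' 0 (col' j (\matrix_(i < 3, j < 3) f i j)) =
    \matrix_(i < 2, k < 2) g j i k.
  by apply/matrixP => i k; rewrite !mxE /g /= /bump /=.
by rewrite !R !det_mx22 !mxE /g /= /bump /= !inordK //; ring.
Qed.

Lemma det_relabel n (M : 'M[A]_n) (s : {perm 'I_n}) :
  \det (\matrix_(i, j) M (s i) (s j)) = \det M.
Proof.
have -> : \matrix_(i, j) M (s i) (s j) = perm_mx s *m M *m perm_mx s^-1.
  rewrite -row_permE -col_permE.
  by apply/matrixP => i j; rewrite !mxE.
by rewrite !det_mulmx !det_perm odd_permV mulrAC -signr_addb addbb mul1r.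
Qed.

Definition with_rows k (M : 'M[A]_(2 + k)) (r0 r1 : 'I_(2 + k) -> A) :=
  \matrix_(i < 2 + k, j < 2 + k)
    (if (i : nat) == 0 then r0 j else if (i : nat) == 1 then r1 j else M i j).

Lemma det_with_row0 k (M : 'M[A]_(2 + k)) u r0 r0' r1 :
  \det (with_rows M (fun j => r0 j + u * r0' j) r1) =
  \det (with_rows M r0 r1) + u * \det (with_rows M r0' r1).
Proof.
rewrite -[X in X + _]mul1r.
apply: (@determinant_multilinear _ _ _ _ _ (lshift k ord0)).
- by apply/rowP => j; rewrite !mxE /= mul1r.
- by apply/matrixP => i j; rewrite !mxE /=.
- by apply/matrixP => i j; rewrite !mxE /=.
Qed.

Lemma det_with_row1 k (M : 'M[A]_(2 + k)) u r0 r1 r1' :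
  \det (with_rows M r0 (fun j => r1 j + u * r1' j)) =
  \det (with_rows M r0 r1) + u * \det (with_rows M r0 r1').
Proof.
rewrite -[X in X + _]mul1r.
apply: (@determinant_multilinear _ _ _ _ _ (lshift k (inord 1))).
- by apply/rowP => j; rewrite !mxE /= inordK //= mul1r.
- apply/matrixP => i j; rewrite !mxE /= inordK //.
  by case: eqP => // _; rewrite /bump; case: i => [[|i] Hi].
- apply/matrixP => i j; rewrite !mxE /= inordK //.
  by case: eqP => // _; rewrite /bump; case: i => [[|i] Hi].
Qed.

(** Each of the first two rows is a constant row plus [u] times a unit row. In the bilinear
    expansion the term with both unit rows is block triangular and gives the coefficient of
    [u ^+ 2]. *)
Lemma det_two_entries k (M : 'M[A]_(2 + k)) : exists b c : A, forall u,
  \det (\matrix_(i, j) if ((i == 0 :> nat) && (j == 1 :> nat)) ||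
                          ((i == 1 :> nat) && (j == 0 :> nat)) then u else M i j) =
  - u ^+ 2 * \det (drsubmx M) + u * b + c.
Proof.
pose i0 : 'I_(2 + k) := lshift k ord0; pose i1 : 'I_(2 + k) := lshift k (inord 1).
pose e0 (j : 'I_(2 + k)) : A := (j == 0 :> nat)%:R.
pose e1 (j : 'I_(2 + k)) : A := (j == 1 :> nat)%:R.
pose r0 (j : 'I_(2 + k)) := if j == 1 :> nat then 0 else M i0 j.
pose r1 (j : 'I_(2 + k)) := if j == 0 :> nat then 0 else M i1 j.
exists (\det (with_rows M r0 e0) + \det (with_rows M e1 r1)).
exists (\det (with_rows M r0 r1)) => u.
have -> : \matrix_(i, j) (if ((i == 0 :> nat) && (j == 1 :> nat)) ||
   ((i == 1 :> nat) && (j == 0 :> nat)) then u else M i j) =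
   with_rows M (fun j => r0 j + u * e1 j) (fun j => r1 j + u * e0 j).
  apply/matrixP => i j; rewrite !mxE.
  have [i_0|] := eqVneq (i : nat) 0.
    rewrite /r0 /e1 i_0 /= orbF; have -> : i = i0 by apply: val_inj.
    by case: (_ == 1); rewrite /= ?mulr1 ?mulr0 ?add0r ?addr0.
  rewrite /=; have [i_1|] //= := eqVneq (i : nat) 1; move=> _.
  rewrite /r1 /e0; have -> : i = i1 by apply: val_inj; rewrite /= inordK.
  by case: (_ == 0); rewrite /= ?mulr1 ?mulr0 ?add0r ?addr0.
rewrite det_with_row0 !det_with_row1.
have -> : \det (with_rows M e1 e0) = - \det (drsubmx M).
  pose P : 'M[A]_2 := \matrix_(i, j) (i != j :> nat)%:R.
  have -> : with_rows M e1 e0 = block_mx P 0 (dlsubmx M) (drsubmx M).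
    apply/matrixP => i j; rewrite -(splitK i) -[j]splitK.
    case: (split i) => a; case: (split j) => b;
      rewrite /unsplit ?(block_mxEul, block_mxEur, block_mxEdl, block_mxEdr) !mxE /= //.
    - rewrite /e1 /e0; case: a => [[|[|a]] Ha] //=; by case: b => [[|[|b]] Hb].
    - by rewrite /e1 /e0 /=; case: a => [[|[|a]] Ha].
  by rewrite det_lblock det_mx22 !mxE /=; ring.
ring.
Qed.

End Determinants.

Lemma det_schur (F : comUnitRingType) a b (P : 'M[F]_a) Q Q' (R : 'M_b) :
  R \in unitmx ->
  \det (block_mx P Q Q' R) = \det R * \det (P - Q *m invmx R *m Q').
Proof.
move=> uR.
have : \det (block_mx P Q Q' R *m block_mx 1%:M 0 (- (invmx R *m Q')) 1%:M) =
  \det R * \det (P - Q *m invmx R *m Q').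
  rewrite mulmx_block !mulmx1 !mulmx0 !add0r !mulmxN !mulmxA mulmxV // mul1mx subrr.
  by rewrite det_ublock mulrC.
by rewrite det_mulmx det_lblock !det1 !mulr1.
Qed.

Section CompleteInjection.

(** Used to move chosen vertices to the front, where block decompositions of the determinant are
    available; [r] lists the other vertices. *)
Lemma complete_inj a k (u : 'I_a -> 'I_(a + k)) : injective u ->
  exists (r : 'I_k -> 'I_(a + k)) (s : {perm 'I_(a + k)}),
    [/\ injective r, forall i j, r i != u j,
        forall z, (forall j, z != u j) -> exists i, z = r i,
        forall i, s (lshift k i) = u i & forall i, s (rshift a i) = r i].
Proof.
move=> inju; pose B := ~: [set u i | i : 'I_a]%SET.
have cB : #|B| = k.
  apply/eqP; rewrite -(eqn_add2l #|[set u i | i : 'I_a]%SET|) cardsC card_ord.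
  by rewrite card_imset // card_ord.
pose r i := enum_val (cast_ord (esym cB) i).
have injr : injective r by move=> i j /enum_val_inj /cast_ord_inj.
have ru i j : r i != u j.
  apply/eqP => E; have := enum_valP (cast_ord (esym cB) i).
  by rewrite -/(r i) E inE imset_f.
pose f i := match split i with inl x => u x | inr y => r y end.
have injf : injective f.
  move=> i j; rewrite /f -(splitK i) -[j]splitK !unsplitK.
  case: (split i) => x; case: (split j) => y.
  - by move=> /inju ->.
  - by move=> E; case/eqP: (ru y x).
  - by move=> E; case/eqP: (ru x y).
  - by move=> /injr ->.
have sl i : perm injf (lshift k i) = u i by rewrite permE /f (unsplitK (inl i)).
have sr i : perm injf (rshift a i) = r i by rewrite permE /f (unsplitK (inr i)).
exists r, (perm injf); split=> // z zu.
rewrite -(permKV (perm injf) z); set z' := (perm injf)^-1%g z.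
have := permKV (perm injf) z; rewrite -/z' -[z']splitK; case: (split z') => b /=.
  by rewrite sl => E; move: (zu b); rewrite E eqxx.
by rewrite sr => _; exists b.
Qed.

End CompleteInjection.

Definition bordered (A : comNzRingType) k (m : 'I_k -> 'I_k -> A) : 'M[A]_(k + 1) :=
  block_mx (\matrix_(i, j) m i j) (const_mx 1) (const_mx 1) 0.

(* Cayley-Menger determinant of the squared distances [m].                    *)
Definition cm (A : comNzRingType) k (m : 'I_k -> 'I_k -> A) : A :=
  \det (bordered m).

Definition upd (A : Type) k (x y : 'I_k) (u : A) (m : 'I_k -> 'I_k -> A) :=
  fun i j => if ((i == x) && (j == y)) || ((i == y) && (j == x)) then u else m i j.

Section CM.
Variable A : comNzRingType.

Lemma cm_ext k (m m' : 'I_k -> 'I_k -> A) : m =2 m' -> cm m = cm m'.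
Proof.
move=> E; rewrite /cm; congr (\det _); rewrite /bordered; congr block_mx.
by apply/matrixP => i j; rewrite !mxE.
Qed.

Lemma cm_rmorph (B : comNzRingType) (f : {rmorphism A -> B}) k
    (m : 'I_k -> 'I_k -> A) : f (cm m) = cm (fun i j => f (m i j)).
Proof.
rewrite /cm /bordered -det_map_mx map_block_mx !map_const_mx rmorph1 rmorph0.
by congr (\det (block_mx _ _ _ _)); apply/matrixP => i j; rewrite !mxE.
Qed.

Lemma drsubmxE m1 m2 n1 n2 (M : 'M[A]_(m1 + m2, n1 + n2)) i j :
  drsubmx M i j = M (rshift m1 i) (rshift n1 j).
Proof. by rewrite !mxE. Qed.

Lemma dlsubmxE m1 m2 n1 n2 (M : 'M[A]_(m1 + m2, n1 + n2)) i j :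
  dlsubmx M i j = M (rshift m1 i) (lshift n2 j).
Proof. by rewrite !mxE. Qed.

Lemma ursubmxE m1 m2 n1 n2 (M : 'M[A]_(m1 + m2, n1 + n2)) i j :
  ursubmx M i j = M (lshift m2 i) (rshift n1 j).
Proof. by rewrite !mxE. Qed.

Lemma ulsubmxE m1 m2 n1 n2 (M : 'M[A]_(m1 + m2, n1 + n2)) i j :
  ulsubmx M i j = M (lshift m2 i) (lshift n2 j).
Proof. by rewrite !mxE. Qed.

Lemma borderedE k (m : 'I_k -> 'I_k -> A) i j :
  bordered m i j = match split i, split j with
                   | inl a, inl b => m a b
                   | inr _, inr _ => 0
                   | _, _ => 1
                   end.
Proof. by rewrite !mxE; case: split => a; rewrite !mxE; case: split => b; rewrite !mxE. Qed.

Lemma split_lshift m n (i : 'I_m) : split (lshift n i) = inl i.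
Proof. exact: (unsplitK (inl i)). Qed.

Lemma split_rshift m n (i : 'I_n) : split (rshift m i) = inr i.
Proof. exact: (unsplitK (inr i)). Qed.

Lemma bordered_rshift2 k (m : 'I_(2 + k) -> 'I_(2 + k) -> A) :
  drsubmx (bordered m : 'M_(2 + (k + 1))) =
  bordered (fun i j => m (rshift 2 i) (rshift 2 j)).
Proof.
have rr (i : 'I_k) : rshift 2 (lshift 1 i) = lshift 1 (rshift 2 i) :> 'I_(2 + k + 1).
  exact: val_inj.
have rs (i : 'I_1) : rshift 2 (rshift k i) = rshift (2 + k) i :> 'I_(2 + k + 1).
  exact: val_inj.
apply/matrixP => i j; rewrite -(splitK i) -[j]splitK drsubmxE.
by case: (split i) => a; case: (split j) => b; rewrite /unsplit ?rr ?rs;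
  apply: (etrans (borderedE m _ _)); rewrite borderedE !(split_lshift, split_rshift).
Qed.

Lemma bordered_rshift3 k (m : 'I_(3 + k) -> 'I_(3 + k) -> A) :
  drsubmx (bordered m : 'M_(3 + (k + 1))) =
  bordered (fun i j => m (rshift 3 i) (rshift 3 j)).
Proof.
have rr (i : 'I_k) : rshift 3 (lshift 1 i) = lshift 1 (rshift 3 i) :> 'I_(3 + k + 1).
  exact: val_inj.
have rs (i : 'I_1) : rshift 3 (rshift k i) = rshift (3 + k) i :> 'I_(3 + k + 1).
  exact: val_inj.
apply/matrixP => i j; rewrite -(splitK i) -[j]splitK drsubmxE.
by case: (split i) => a; case: (split j) => b; rewrite /unsplit ?rr ?rs;
  apply: (etrans (borderedE m _ _)); rewrite borderedE !(split_lshift, split_rshift).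
Qed.

Lemma cm_relabel k (m : 'I_k -> 'I_k -> A) (s : {perm 'I_k}) :
  cm (fun i j => m (s i) (s j)) = cm m.
Proof.
pose f (i : 'I_(k + 1)) := match split i with inl a => lshift 1 (s a) | inr b => rshift k b end.
have injf : injective f.
  move=> i j; rewrite /f -(splitK i) -[j]splitK !unsplitK.
  case: (split i) => x; case: (split j) => y.
  - by move=> /(@lshift_inj _ _) /perm_inj ->.
  - by move=> /eqP; rewrite eq_lrshift.
  - by move=> /eqP; rewrite eq_rlshift.
  - by move=> /(@rshift_inj _ _) ->.
rewrite /cm -(det_relabel (bordered m) (perm injf)); congr (\det _).
apply/matrixP => i j; rewrite [RHS]mxE !permE !borderedE /f.
by case: (split i) => a; case: (split j) => b; rewrite ?split_lshift ?split_rshift.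
Qed.

(** The squared distance of [x] and [y] occupies two symmetric entries of the bordered matrix.
    Deleting both rows and columns leaves the bordered matrix of the other vertices. *)
Lemma cm_edge k (x y : 'I_(2 + k)) : x != y -> exists r : 'I_k -> 'I_(2 + k),
  [/\ injective r, forall i, (r i != x) && (r i != y),
    forall z, z != x -> z != y -> exists i, z = r i &
    forall m : 'I_(2 + k) -> 'I_(2 + k) -> A, exists b c, forall u,
      cm (upd x y u m) = - u ^+ 2 * cm (fun i j => m (r i) (r j)) + u * b + c].
Proof.
move=> xy; pose p (i : 'I_2) := if i == 0 then x else y.
have injp : injective p.
  by move=> [[|[|//]] i1] [[|[|//]] j1] //=; rewrite /p /= => E;
    try exact: val_inj; move: xy; rewrite E eqxx.
have [r [s [injr rp rz sl sr]]] := complete_inj injp.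
exists r; split=> //; first by move=> i; rewrite (rp i 0) (rp i 1).
  by move=> z zx zy; apply: rz => j; rewrite /p; case: ifP.
move=> m; pose M := bordered (fun i j => m (s i) (s j)) : 'M_(2 + (k + 1)).
have [b [c E]] := det_two_entries M.
exists b, c => u.
rewrite -(cm_relabel _ s).
have -> : cm (fun i j => m (r i) (r j)) = \det (drsubmx M).
  by rewrite bordered_rshift2; apply: cm_ext => i j; rewrite !sr.
rewrite -E; congr (\det _); apply/matrixP => i j; rewrite [RHS]mxE.
have si (i' : 'I_(2 + k)) : ((s i' == x) = (i' == 0 :> nat)) * ((s i' == y) = (i' == 1 :> nat)).
  rewrite -[i']splitK; case: (split i') => a /=.
    by rewrite sl /p; case: a => [[|[|//]] Ha] /=;
       rewrite ?eqxx ?(negbTE xy) // eq_sym (negbTE xy).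
  rewrite sr; have := rp a 0; have := rp a 1; rewrite /p /=.
  by move=> /negbTE -> /negbTE ->; split.
rewrite [LHS](borderedE _ (i : 'I_(2 + k + 1))) [in RHS](borderedE _ (i : 'I_(2 + k + 1))).
case: splitP => a Ea; case: splitP => b' Eb; rewrite ?Ea ?Eb.
- by rewrite /upd !si.
- rewrite (_ : (2 + k + b' == 0)%N = false) // (_ : (2 + k + b' == 1)%N = false) //.
  by rewrite !andbF.
- by [].
- by [].
Qed.

End CM.

(** * Directions in which the Cayley-Menger determinant is quadratic *)

Section Target.
Variable F : numFieldType.

Definition sym0 k (z : 'I_k -> 'I_k -> F) :=
  (forall i j, z i j = z j i) /\ (forall i, z i i = 0).

Definition sqr2 (A : comNzRingType) k (z : 'I_k -> 'I_k -> A) i j := z i j ^+ 2.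

(** The determinant along the line [z + t h], where [z] and [h] hold lengths, of arbitrary sign,
    rather than squared lengths. *)
Definition cmt k (z h : 'I_k -> 'I_k -> F) : {poly F} :=
  cm (sqr2 (fun i j => (z i j)%:P + (h i j)%:P * 'X)).

Lemma cmt_horner k (z h : 'I_k -> 'I_k -> F) t :
  (cmt z h).[t] = cm (sqr2 (fun i j => z i j + t * h i j)).
Proof.
rewrite -/(horner_eval t _) /cmt cm_rmorph; apply: cm_ext => i j.
by rewrite /sqr2 rmorphXn /= /horner_eval !hornerE mulrC.
Qed.

Lemma cmt_ext k (z z' h h' : 'I_k -> 'I_k -> F) :
  z =2 z' -> h =2 h' -> cmt z h = cmt z' h'.
Proof. by move=> Ez Eh; apply: cm_ext => i j; rewrite /sqr2 Ez Eh. Qed.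

Lemma sym0_upd k (z : 'I_k -> 'I_k -> F) x y u :
  x != y -> sym0 z -> sym0 (upd x y u z).
Proof.
move=> xy [zs z0]; split=> [i j|i]; rewrite /upd.
  by rewrite zs orbC andbC [X in _ || X]andbC.
by rewrite [X in _ || X]andbC orbb; case: eqP => [->|_] //=; rewrite (negbTE xy).
Qed.

(** The default 0 puts the vertices outside the image of [r] at length zero from all others, which
    [deg2_triangle] exploits. *)
Definition extend a k (r : 'I_a -> 'I_k) (z : 'I_a -> 'I_a -> F) (i j : 'I_k) :=
  match [pick p | r p == i], [pick q | r q == j] with
  | Some p, Some q => z p q
  | _, _ => 0
  end.

Lemma extend_val a k (r : 'I_a -> 'I_k) z p q : injective r ->
  extend r z (r p) (r q) = z p q.
Proof.
move=> injr; rewrite /extend; case: pickP => [p' /eqP/injr ->|/(_ p)/eqP //].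
by case: pickP => [q' /eqP/injr ->|/(_ q)/eqP //].
Qed.

Lemma sym0_extend a k (r : 'I_a -> 'I_k) z : sym0 z -> sym0 (extend r z).
Proof.
move=> [zs z0]; split=> [i j|i]; rewrite /extend.
  by case: pickP => [p _|_]; case: pickP.
by case: pickP.
Qed.

Lemma extend_out a k (r : 'I_a -> 'I_k) z i j :
  (forall p, r p != i) -> extend r z i j = 0.
Proof. by move=> ri; rewrite /extend; case: pickP => // p; rewrite (negbTE (ri p)). Qed.

Lemma sym0_comp a k (r : 'I_a -> 'I_k) z : sym0 z ->
  sym0 (fun i j => z (r i) (r j) : F).
Proof. by case=> zs z0; split=> [i j|i]. Qed.

Lemma cm1 (m : 'I_1 -> 'I_1 -> F) : cm m = - 1.
Proof.
rewrite /cm; pose f (i j : nat) := if (i == 0)%N && (j == 0)%N then m 0 0 else (i != j)%:R.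
have -> : bordered m = \matrix_(i < 2, j < 2) f i j.
  apply/matrixP => i j; rewrite borderedE mxE /f.
  case: splitP => a Ea; case: splitP => b Eb; rewrite Ea Eb ?ord1 //=.
by rewrite det_mx22 !mxE /f /=; ring.
Qed.

Lemma cm2 (m : 'I_2 -> 'I_2 -> F) : cm m = m 0 1 + m 1 0 - m 0 0 - m 1 1.
Proof.
rewrite /cm; pose f (i j : nat) := 
  if (i < 2)%N && (j < 2)%N then m (inord i) (inord j) else (i != j)%:R.
have -> : bordered m = \matrix_(i < 3, j < 3) f i j.
  apply/matrixP => i j; rewrite borderedE mxE /f.
  case: splitP => a Ea; case: splitP => b Eb; rewrite Ea Eb ?ord1 ?ltn_ord /=.
  - by rewrite !inord_val.
  - by rewrite ?andbF; case: a {Ea} => [[|[|]]].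
  - by case: b {Eb} => [[|[|]]].
  - by [].
rewrite det_mx33 !mxE /f /= !inordK //=.
have -> : inord 0 = 0 :> 'I_2 by apply: val_inj; rewrite /= inordK.
have -> : inord 1 = 1 :> 'I_2 by apply: val_inj; rewrite /= inordK.
ring.
Qed.

Lemma sqr2_upd k x y u (z : 'I_k -> 'I_k -> F) :
  sqr2 (upd x y u z) =2 upd x y (u ^+ 2) (sqr2 z).
Proof. by move=> i j; rewrite /sqr2 /upd; case: ifP. Qed.

(** Induction by two vertices: as a polynomial in the length [u] of the new edge, the determinant
    has degree four, with leading coefficient minus that of the smaller configuration. It contains
    only the powers 4, 2 and 0 of [u], so it cannot vanish at 0, 1 and 2. *)
Lemma cm_neq0 k : exists2 z : 'I_k.+1 -> 'I_k.+1 -> F, sym0 z & cm (sqr2 z) != 0.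
Proof.
have [n] := ubnP k; elim: n k => // n IH [|[|k]] ltk.
- by exists (fun _ _ => 0); rewrite ?cm1 ?oppr_eq0 ?oner_eq0 //; split.
- exists (fun i j => (i != j)%:R); first by split=> [i j|i]; rewrite ?eqxx // eq_sym.
  by rewrite cm2 /sqr2 /= !expr1n expr0n /= !subr0 -mulr2n pnatr_eq0.
have [|z zs z0] := IH k; first lia.
have [r [injr rxy _ H]] := @cm_edge F k.+1 0 1 isT.
have [b [c E]] := H (sqr2 (extend r z)); pose G u := cm (sqr2 (upd 0 1 u (extend r z))).
have EG u : G u = - (u ^+ 4) * cm (sqr2 z) + u ^+ 2 * b + c.
  rewrite /G (cm_ext (@sqr2_upd _ _ _ _ _)) E -exprM; congr (_ * _ + _ + _).
  by apply: cm_ext => i j; rewrite /sqr2 extend_val.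
have [G0|] := eqVneq (G 0) 0; last first.
  by exists (upd 0 1 0 (extend r z)) => //; apply: sym0_upd => //; apply: sym0_extend.
have [G1|] := eqVneq (G 1) 0; last first.
  by exists (upd 0 1 1 (extend r z)) => //; apply: sym0_upd => //; apply: sym0_extend.
exists (upd 0 1 2 (extend r z)); first by apply: sym0_upd => //; apply: sym0_extend.
rewrite -/(G 2) EG; move: G0 G1; rewrite !EG => G0 G1.
(* The combination [G 2 - 4 G 1 + 3 G 0] eliminates [b] and [c]. *)
have -> : - 2 ^+ 4 * cm (sqr2 z) + 2 ^+ 2 * b + c = - 12 * cm (sqr2 z) +
   4 * (- 1 ^+ 4 * cm (sqr2 z) + 1 ^+ 2 * b + c) -
   3 * (- 0 ^+ 4 * cm (sqr2 z) + 0 ^+ 2 * b + c) by ring.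
by rewrite G0 G1 !mulr0 subr0 addr0 mulf_neq0 // oppr_eq0 pnatr_eq0.
Qed.

(** The length of [x y] enters only through [u + t h x y], while [b], [c] and the leading factor are
    independent of [u]. Varying [u] thus isolates the leading factor, which concerns the other
    vertices alone. *)
Lemma edge_expand k (x y : 'I_(2 + k)) : x != y -> exists r : 'I_k -> 'I_(2 + k),
  [/\ injective r, forall i, (r i != x) && (r i != y),
    forall z, z != x -> z != y -> exists i, z = r i &
    forall z h, sym0 h -> exists b c : {poly F}, forall u : F,
      cmt (upd x y u z) h =
      - (u%:P + (h x y)%:P * 'X) ^+ 4 * cmt (fun i j => z (r i) (r j)) (fun i j => h (r i) (r j))
      + (u%:P + (h x y)%:P * 'X) ^+ 2 * b + c].
Proof.
move=> xy; have [r [injr rxy rz H]] := @cm_edge {poly F} k x y xy.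
exists r; split=> // z h [hs _].
have [b [c E]] := H (sqr2 (fun i j => (z i j)%:P + (h i j)%:P * 'X)).
exists b, c => u; rewrite -[4%N]/(2 * 2)%N exprM -E /cmt; apply: cm_ext => i j.
rewrite /sqr2 /upd; case: ifP => // /orP[] /andP[/eqP -> /eqP ->] //.
by rewrite hs.
Qed.

Section Coefficients.
Variables (eta : F) (n : nat) (c b e : {poly F}).
Let P (u : F) := - (u%:P + eta%:P * 'X) ^+ 4 * c + (u%:P + eta%:P * 'X) ^+ 2 * b + e.
Hypothesis sP : forall u, (size (P u) <= n)%N.

Let szZ (a : F) (p q : {poly F}) : a != 0 -> a%:P * p = q ->
  (size q <= n)%N -> (size p <= n)%N.
Proof. by move=> a0 <-; rewrite mul_polyC size_scale. Qed.

Let szD (p q : {poly F}) : (size p <= n)%N -> (size q <= n)%N -> (size (p + q)%R <= n)%N.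
Proof. by move=> Hp Hq; rewrite (leq_trans (size_polyD _ _)) // geq_max Hp. Qed.

Let szC (a : F) (p : {poly F}) : (size p <= n)%N -> (size (a%:P * p)%R <= n)%N.
Proof. by move=> H; rewrite mul_polyC (leq_trans (size_scale_leq _ _)). Qed.

(* The three combinations extract the coefficients of u^3, u^2 and u of [P u] *)
(* from its values at -2, ..., 2.                                             *)
Lemma size_coef3 : (size (eta%:P * 'X * c)%R <= n)%N.
Proof.
apply: (@szZ (- 48) _ (P 2 + (- 2)%:P * P 1 + 2%:P * P (- 1) + (- 1)%:P * P (- 2))).
- by rewrite oppr_eq0 pnatr_eq0.
- by rewrite /P; ring.
by do ?[exact: sP | apply: szC | apply: szD].
Qed.

Lemma size_coef2 : (size (b - 6%:P * (eta%:P * 'X) ^+ 2 * c)%R <= n)%N.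
Proof.
apply: (@szZ 24 _ (16%:P * P 1 + 16%:P * P (- 1) + (- 1)%:P * P 2 +
                   (- 1)%:P * P (- 2) + (- 30)%:P * P 0)).
- by rewrite pnatr_eq0.
- by rewrite /P; ring.
by do ?[exact: sP | apply: szC | apply: szD].
Qed.

Lemma size_coef1 :
  (size ((eta%:P * 'X) * b - 2%:P * (eta%:P * 'X) ^+ 3 * c)%R <= n)%N.
Proof.
apply: (@szZ 24 _ (8%:P * P 1 + (- 8)%:P * P (- 1) + (- 1)%:P * P 2 + 1%:P * P (- 2))).
- by rewrite pnatr_eq0.
- by rewrite /P; ring.
by do ?[exact: sP | apply: szC | apply: szD].
Qed.

End Coefficients.

Lemma size_etaX (eta : F) (p : {poly F}) n : eta != 0 ->
  (size (eta%:P * 'X * p)%R <= n.+1)%N = (size p <= n)%N.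
Proof.
move=> eta0; rewrite -mulrA size_Cmul // mulrC.
have [->|p0] := eqVneq p 0; first by rewrite mul0r size_poly0.
by rewrite size_mulX.
Qed.

(** The bounds on the coefficients of [u ^+ 2] and [u] combine to eliminate [b], leaving
    [4 (eta X)^3 c] of degree at most three. *)
Lemma coef_deg2 (eta : F) (c b e : {poly F}) : eta != 0 ->
  (forall u, (size (- (u%:P + eta%:P * 'X) ^+ 4 * c
     + (u%:P + eta%:P * 'X) ^+ 2 * b + e)%R <= 3)%N) -> (size c <= 1)%N.
Proof.
move=> eta0 H; have H3 := size_coef3 H; have H2 := size_coef2 H; have H1 := size_coef1 H.
rewrite size_etaX // in H3.
set q := (b - _)%R in H2.
have H4 : (size (4%:P * (eta%:P * 'X) ^+ 3 * c)%R <= 4)%N.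
  have -> : 4%:P * (eta%:P * 'X) ^+ 3 * c =
    (eta%:P * 'X * b - 2%:P * (eta%:P * 'X) ^+ 3 * c) - eta%:P * 'X * q.
    by rewrite /q; ring.
  rewrite (leq_trans (size_polyD _ _)) // geq_max (leq_trans H1) // size_polyN.
  by rewrite size_etaX.
rewrite -mulrA size_Cmul ?pnatr_eq0 // !exprS expr0 mulr1 -!mulrA in H4.
by rewrite !mulrA -!(mulrA (eta%:P * 'X)) !size_etaX in H4.
Qed.

Lemma coef_deg0 (eta : F) (c b e : {poly F}) : eta != 0 ->
  (forall u, (size (- (u%:P + eta%:P * 'X) ^+ 4 * c
     + (u%:P + eta%:P * 'X) ^+ 2 * b + e)%R <= 1)%N) -> c = 0.
Proof.
move=> eta0 H; have H3 := size_coef3 H.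
by rewrite size_etaX // size_poly_leq0 in H3; apply/eqP.
Qed.

(** If [h x y] were nonzero, [coef_deg0] would make the determinant of the remaining vertices vanish
    for every [z], against [cm_neq0]. With two vertices the determinant is computed directly. *)
Lemma cmt_const k (h : 'I_k.+2 -> 'I_k.+2 -> F) : sym0 h ->
  (forall z, sym0 z -> (size (cmt z h) <= 1)%N) -> forall i j, h i j = 0.
Proof.
move=> hs H x y; have [->|xy] := eqVneq x y; first by case: hs.
apply/eqP; apply/negPn/negP => eta0.
case: k h hs H x y xy eta0 => [|k] h hs H x y xy eta0.
  have E t : (cmt (fun _ _ => 0) h).[t] = 2 * (t * h x y) ^+ 2.
    rewrite cmt_horner cm2 /sqr2 !add0r.
    case: hs => hs h0; rewrite !h0 !mulr0 [h 1 0]hs.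
    have -> : h 0 1 = h x y.
      by move: xy; case: x y {eta0} => [[|[|//]] ?] [[|[|//]] ?] //= _;
        [congr (h _ _) | rewrite hs; congr (h _ _)]; apply: val_inj.
    ring.
  have /size1_polyC Ec := H (fun _ _ => 0) (conj (fun _ _ => erefl) (fun _ => erefl)).
  have := E 0; have := E 1; rewrite Ec !hornerC => -> /eqP.
  by rewrite mul0r expr0n mulr0 mul1r mulf_eq0 pnatr_eq0 /= expf_eq0 /= (negbTE eta0).
have [r [injr rxy _ HE]] := edge_expand xy.
have [z zs z0] := cm_neq0 k.
have [b [c E]] := HE (extend r z) h hs.
have c0 : cmt (fun i j => extend r z (r i) (r j)) (fun i j => h (r i) (r j)) = 0.
  apply: (coef_deg0 eta0 (b := b) (e := c)) => u.
  by rewrite -E; apply/H/sym0_upd => //; apply: sym0_extend.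
move: z0; rewrite (_ : cm (sqr2 z) = 0) ?eqxx //.
rewrite -(horner0 (0 : F)) -c0 cmt_horner; apply: cm_ext => i j.
by rewrite /sqr2 mul0r addr0 extend_val.
Qed.

(** By [coef_deg2] the determinant of the vertices other than [x] and [y] is constant along [h], and
    [cmt_const] applies to them. Thus any two edges in the support of [h] meet. *)
Lemma deg2_disjoint k (h : 'I_k.+4 -> 'I_k.+4 -> F) : sym0 h ->
  (forall z, sym0 z -> (size (cmt z h) <= 3)%N) ->
  forall x y u v, h x y != 0 -> u != x -> u != y -> v != x -> v != y -> h u v = 0.
Proof.
move=> hs H x y u v eta0 ux uy vx vy.
have xy : x != y by apply: contraNneq eta0 => ->; case: hs => _ ->.
have [r [injr rxy rz HE]] := @edge_expand k.+2 x y xy.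
have [a ->] := rz u ux uy; have [b' ->] := rz v vx vy.
apply: (@cmt_const _ (fun i j => h (r i) (r j))) (sym0_comp r hs) _ a b' => z zs.
have [b [c E]] := HE (extend r z) h hs.
rewrite (@cmt_ext _ _ (fun i j => extend r z (r i) (r j)) _ (fun i j => h (r i) (r j))) //;
  last by move=> i j; rewrite extend_val.
apply: (coef_deg2 eta0 (b := b) (e := c)) => w.
by rewrite -E; apply/H/sym0_upd => //; apply: sym0_extend.
Qed.

(* In [z0] the vertices [y] and [y'] coincide; subtracting their rows and     *)
(* columns leaves a square.                                                   *)
Lemma cm_coincide k (x y y' : 'I_(2 + k.+1)) : uniq [:: x; y; y'] ->
  exists z0, sym0 z0 /\ exists2 c : F, c != 0 & forall z, sym0 z ->
    (forall i j, i != x -> j != x -> z i j = z0 i j) ->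
    cm (sqr2 z) = c * (z x y ^+ 2 - z x y' ^+ 2) ^+ 2.
Proof.
rewrite /= !inE negb_or andbT => /andP[/andP[xy xy'] yy'].
pose p (i : 'I_2) := if i == 0 then x else y.
have injp : injective p.
  by move=> [[|[|//]] i1] [[|[|//]] j1] //=; rewrite /p /= => E;
    try exact: val_inj; move: xy; rewrite E eqxx.
have [r [s [injr rp rz sl sr]]] := complete_inj injp.
have [t Et] : exists t, y' = r t.
  by apply: rz => j; rewrite /p; case: ifP => _; rewrite eq_sym.
have [z1 z1s z1n] := cm_neq0 k.
pose phi i := if i == y then Some t else [pick j | r j == i].
pose z0 i j := match phi i, phi j with Some a, Some b => z1 a b | _, _ => 0 end.
have phir j : phi (r j) = Some j.
  rewrite /phi; have /negbTE -> : r j != y by have := rp j 1; rewrite /p.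
  by case: pickP => [j' /eqP/injr ->|/(_ j)/eqP].
have phiy : phi y = Some t by rewrite /phi eqxx.
exists z0; split.
  case: z1s => z1s z10; split=> [i j|i]; rewrite /z0.
    by case: (phi i) => [a|]; case: (phi j) => [b|] //.
  by case: (phi i) => [a|] //.
exists (- cm (sqr2 z1)); first by rewrite oppr_eq0.
move=> z [zs zz] Ez; have rx j : r j != x by have := rp j 0; rewrite /p.
have yx : y != x by rewrite eq_sym.
have Ezr i j : z (r i) (r j) = z1 i j by rewrite Ez // /z0 !phir.
have Ezy j : z y (r j) = z1 t j by rewrite Ez // /z0 phir phiy.
rewrite -(cm_relabel _ s) /cm.
set M := bordered _; pose M' : 'M_(2 + (k.+1 + 1)) := M.
have EM (i j : 'I_(2 + k.+1 + 1)) : M' i j =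
    match split i, split j with
    | inl a, inl b => z (s a) (s b) ^+ 2
    | inr _, inr _ => 0
    | _, _ => 1
    end by exact: borderedE.
pose R := drsubmx M'; pose Q := ursubmx M'; pose Q' := dlsubmx M'.
have ER : R = bordered (sqr2 z1).
  rewrite /R /M' /M bordered_rshift2; congr block_mx; apply/matrixP => i j.
  by rewrite !mxE /sqr2 !sr Ezr.
have dR : \det R = cm (sqr2 z1) by rewrite ER.
have uR : R \in unitmx by rewrite unitmxE dR unitfE.
have -> : \det M = \det R * \det (ulsubmx M' - Q *m invmx R *m Q').
  by rewrite -det_schur // submxK.
rewrite dR mulNr -mulrN; congr (_ * _).
have s0 : s (lshift _ 0) = x by rewrite sl.
have s1 : s (lshift _ 1) = y by rewrite sl.
pose it : 'I_(k.+1 + 1) := lshift 1 t.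
pose l0 : 'I_(2 + k.+1 + 1) := lshift 1 (lshift k.+1 0).
pose l1 : 'I_(2 + k.+1 + 1) := lshift 1 (lshift k.+1 1).
have rr (j : 'I_k.+1) : rshift 2 (lshift 1 j) = lshift 1 (rshift 2 j) :> 'I_(2 + k.+1 + 1).
  exact: val_inj.
have rs (j : 'I_1) : rshift 2 (rshift k.+1 j) = rshift (2 + k.+1) j :> 'I_(2 + k.+1 + 1).
  exact: val_inj.
have ll (j : 'I_2) : lshift (k.+1 + 1) j = lshift 1 (lshift k.+1 j) :> 'I_(2 + k.+1 + 1).
  exact: val_inj.
(* Seen from the remaining vertices, [y] is indistinguishable from [y']. So the products with
   [invmx R] in the Schur complement collapse to unit vectors. *)
have Erow : row 1 Q = row it R.
  apply/rowP => j; rewrite [LHS]mxE [RHS]mxE ursubmxE ER [in RHS]borderedE ll.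
  rewrite -[j]splitK; case: (split j) => j'; rewrite !unsplitK /unsplit ?rr ?rs.
    by rewrite EM !split_lshift /sqr2 s1 sr Ezy.
  by rewrite EM !split_lshift !split_rshift.
have Ecol : col 1 Q' = col it R.
  apply/colP => j; rewrite [LHS]mxE [RHS]mxE dlsubmxE ER [in RHS]borderedE ll.
  rewrite -[j]splitK; case: (split j) => j'; rewrite !unsplitK /unsplit ?rr ?rs.
    by rewrite EM !split_lshift /sqr2 s1 sr zs Ezy; case: z1s => ->.
  by rewrite EM !split_lshift !split_rshift.
have Rd : row it R *m invmx R = delta_mx 0 it.
  by rewrite rowE -mulmxA mulmxV // mulmx1.
have dR' : invmx R *m col it R = delta_mx it 0.
  by rewrite colE mulmxA mulVmx // mul1mx.
set S := _ - _.
have SE i j : S i j = M' (lshift _ i) (lshift _ j) - (Q *m invmx R *m Q') i j.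
  by rewrite /S [LHS]mxE [X in _ + X]mxE ulsubmxE.
have S1 j : S 1 j = M' (lshift _ 1) (lshift _ j) - Q' it j.
  rewrite SE.
  have -> : (Q *m invmx R *m Q') 1 j = (row 1 Q *m invmx R *m Q') 0 j.
    by rewrite -!row_mul [RHS]mxE.
  by rewrite Erow Rd -rowE; congr (_ - _); rewrite [LHS]mxE.
have S0 : S 0 1 = M' (lshift _ 0) (lshift _ 1) - Q 0 it.
  rewrite SE.
  have -> : (Q *m invmx R *m Q') 0 1 = (Q *m (invmx R *m col 1 Q')) 0 0.
    by rewrite !colE !mulmxA -colE [RHS]mxE.
  by rewrite Ecol dR' -colE; congr (_ - _); rewrite [LHS]mxE.
rewrite det_mx22 !S1 S0 !(ll, EM) !split_lshift s0 s1.
rewrite /Q /Q' !ursubmxE !dlsubmxE !ll /it rr !EM !split_lshift s0 s1 !sr /sqr2.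
rewrite -Et zz [z y x]zs [z y' x]zs.
have -> : z y' y = 0 by rewrite zs Et Ezy; case: z1s.
ring.
Qed.

Lemma poly_nat_ext (p q : {poly F}) : (forall n : nat, p.[n%:R] = q.[n%:R]) -> p = q.
Proof.
move=> H; apply/eqP; rewrite -subr_eq0; apply/negPn/negP => nz.
have := max_poly_roots nz (rs := [seq (n%:R : F) | n <- iota 0 (size (p - q))]).
rewrite size_map size_iota ltnn map_inj_uniq ?iota_uniq; last first.
  by move=> a b /eqP; rewrite eqr_nat => /eqP.
have -> : all (root (p - q)) [seq n%:R | n <- iota 0 (size (p - q)%R)].
  by apply/allP => _ /mapP[n _ ->]; rewrite rootE hornerD hornerN H subrr.
by move=> /(_ isT isT).
Qed.

(** At a [z] that vanishes on all edges meeting the triangle, the Schur complement is the 3 by 3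
    matrix with entries [(t h i j)^2 - kap]. Its [t ^+ 6] coefficient is twice the square of the
    product of the three entries of [h]. *)
Lemma deg2_triangle k (h : 'I_(3 + k.+1) -> 'I_(3 + k.+1) -> F) x y w :
  sym0 h -> (forall z, sym0 z -> (size (cmt z h) <= 3)%N) -> uniq [:: x; y; w] ->
  (forall i j, i \notin [:: x; y; w] -> h i j = 0) ->
  h x y * h x w * h y w = 0.
Proof.
move=> [hs hz] H; rewrite /= !inE negb_or andbT => /andP[/andP[xy xw] yw] h0.
pose p (i : 'I_3) := nth x [:: x; y; w] i.
have injp : injective p.
  move=> i j /eqP; rewrite nth_uniq //=; first by move=> /eqP/val_inj.
  by rewrite !inE negb_or xy xw yw.
have [r [s [injr rp rz sl sr]]] := complete_inj injp.
have [z1 z1s z1n] := cm_neq0 k.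
pose z := extend r z1.
have hr i j : h (r i) j = 0.
  apply: h0; rewrite !inE !negb_or.
  by have := rp i 0; have := rp i 1; have := rp i (inord 2); rewrite /p /= inordK //=
    => -> -> ->.
have zr i j : z (r i) (r j) = z1 i j by rewrite /z extend_val.
have zp i j : z (p i) j = 0 by apply: extend_out.
have zs : sym0 z by apply: sym0_extend.
have pE : (p 0 = x) * (p 1 = y) * (p (inord 2) = w) by rewrite /p /= inordK.
pose R := bordered (sqr2 z1).
have uR : R \in unitmx by rewrite unitmxE unitfE.
pose q : 'rV[F]_(k.+1 + 1) := row_mx 0 1%:M.
pose kap := (q *m invmx R *m q^T) 0 0.
pose a := h x y ^+ 2; pose b := h x w ^+ 2; pose c := h y w ^+ 2.
have E t : (cmt z h).[t] = \det R * (2 * (a * b * c) * t ^+ 6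
   + kap * (a ^+ 2 + b ^+ 2 + c ^+ 2 - 2 * (a * b) - 2 * (a * c) - 2 * (b * c)) * t ^+ 4).
  rewrite cmt_horner -(cm_relabel _ s) /cm.
  set M := bordered _; pose M' : 'M_(3 + (k.+1 + 1)) := M.
  have EM (i j : 'I_(3 + k.+1 + 1)) : M' i j =
    match split i, split j with
    | inl a, inl b => (z (s a) (s b) + t * h (s a) (s b)) ^+ 2
    | inr _, inr _ => 0
    | _, _ => 1
    end by exact: borderedE.
  have rr (j : 'I_k.+1) : rshift 3 (lshift 1 j) = lshift 1 (rshift 3 j) :> 'I_(3 + k.+1 + 1).
    exact: val_inj.
  have rs (j : 'I_1) : rshift 3 (rshift k.+1 j) = rshift (3 + k.+1) j :> 'I_(3 + k.+1 + 1).
    exact: val_inj.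
  have ll (j : 'I_3) : lshift (k.+1 + 1) j = lshift 1 (lshift k.+1 j) :> 'I_(3 + k.+1 + 1).
    exact: val_inj.
  have ER : drsubmx M' = R.
    rewrite /M' /M bordered_rshift3; congr block_mx; apply/matrixP => i j.
    by rewrite !mxE /sqr2 !sr zr hr mulr0 addr0.
  pose o : 'cV[F]_3 := const_mx 1.
  have EQ : ursubmx M' = o *m q.
    apply/matrixP => i j; rewrite ursubmxE ll [RHS]mxE big_ord1 [o _ _]mxE mul1r.
    rewrite -[j]splitK; case: (split j) => j'; rewrite /unsplit ?rr ?rs.
      by rewrite EM !split_lshift sl sr zp [h (p i) _]hs hr mulr0 addr0 expr0n
         /q row_mxEl mxE.
    by rewrite EM !split_lshift split_rshift /q row_mxEr mxE [j']ord1.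
  have EQ' : dlsubmx M' = q^T *m o^T.
    apply/matrixP => j i; rewrite dlsubmxE ll [RHS]mxE big_ord1 ![_^T _ _]mxE [o _ _]mxE mulr1.
    rewrite -[j]splitK; case: (split j) => j'; rewrite /unsplit ?rr ?rs.
      by rewrite EM !split_lshift sl sr (proj1 zs) zp hr mulr0 addr0 expr0n
         /q row_mxEl mxE.
    by rewrite EM !split_lshift split_rshift /q row_mxEr mxE [j']ord1.
  have -> : \det M = \det R * \det (ulsubmx M' - o *m q *m invmx R *m (q^T *m o^T)).
    by rewrite -det_schur // -EQ -EQ' -ER submxK.
  congr (_ * _).
  have SE i j : (ulsubmx M' - o *m q *m invmx R *m (q^T *m o^T)) i j =
      (t * h (p i) (p j)) ^+ 2 - kap.
    rewrite [LHS]mxE ulsubmxE !ll EM !split_lshift !sl zp add0r; congr (_ + _).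
    rewrite mxE -!mulmxA [q *m _]mulmxA [q *m _ *m _]mulmxA -/kap.
    rewrite [q *m _ *m _]mx11_scalar -/kap.
    by rewrite !mxE big_ord1 !mxE !mul1r big_ord1 !mxE mulr1n mulr1.
  rewrite det_mx33 !SE !pE !hz [h y x]hs [h w x]hs [h w y]hs /a /b /c.
  ring.
pose P : {poly F} := (\det R)%:P * ((2 * (a * b * c))%:P * 'X^6
   + (kap * (a ^+ 2 + b ^+ 2 + c ^+ 2 - 2 * (a * b) - 2 * (a * c) - 2 * (b * c)))%:P * 'X^4).
have EP : cmt z h = P by apply: poly_nat_ext => n; rewrite E /P !hornerE.
have := H z zs; rewrite EP => /leq_sizeP/(_ 6 isT).
rewrite /P coefCM coefD !coefCM !coefXn /= mulr0 addr0 mulr1.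
move=> /eqP; rewrite mulf_eq0 (negbTE z1n) /= mulf_eq0 pnatr_eq0 /= /a /b /c.
by rewrite -!exprMn expf_eq0 /= => /eqP.
Qed.

(** The entries at the centre [x] agree up to sign. The value [mu = 0] is allowed; for symmetric [h]
    with zero diagonal it means that [h] is zero. *)
Definition star_like k (h : 'I_k -> 'I_k -> F) x mu :=
  (forall i j, i != x -> j != x -> h i j = 0) /\
  (forall j, j != x -> h x j ^+ 2 = mu).

(** Pairwise meeting edges form a star or a triangle, and [deg2_triangle] excludes the latter. For a
    star, [cm_coincide] at a [z] with zero lengths at the centre exhibits a [t ^+ 4] coefficient
    proportional to the square of the difference of two squared entries. *)
Lemma deg2_star k (h : 'I_k.+4 -> 'I_k.+4 -> F) : sym0 h ->
  (forall z, sym0 z -> (size (cmt z h) <= 3)%N) -> exists x mu, star_like h x mu.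
Proof.
move=> hs H; have D := deg2_disjoint hs H; have [hS hz] := hs.
suff [x Hx] : exists x, forall i j, i != x -> j != x -> h i j = 0.
  pose y : 'I_k.+4 := if x == 0 then 1 else 0.
  have yx : y != x by rewrite /y; case: (eqVneq x 0) => [->|]; rewrite // eq_sym.
  exists x, (h x y ^+ 2); split=> // y' y'x.
  have [->//|yy'] := eqVneq y y'.
  have [|z0 [z0s [c c0 E]]] := @cm_coincide k.+1 x y y'.
    by rewrite /= !inE negb_or yy' eq_sym yx eq_sym y'x.
  pose z i j := if (i == x) || (j == x) then 0 else z0 i j.
  have zs : sym0 z.
    case: z0s => z0s z00; split=> [i j|i]; rewrite /z; first by rewrite orbC z0s.
    by case: ifP.
  have Et t : (cmt z h).[t] = c * (h x y ^+ 2 - h x y' ^+ 2) ^+ 2 * t ^+ 4.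
    rewrite cmt_horner (E (fun i j => z i j + t * h i j)).
    - by rewrite /z eqxx /=; ring.
    - by split=> [i j|i]; [rewrite (proj1 zs) hS | rewrite (proj2 zs) hz mulr0 addr0].
    by move=> i j ix jx; rewrite /z (negbTE ix) (negbTE jx) Hx // mulr0 addr0.
  have EP : cmt z h = (c * (h x y ^+ 2 - h x y' ^+ 2) ^+ 2)%:P * 'X^4.
    by apply: poly_nat_ext => n; rewrite Et !hornerE.
  have := H z zs; rewrite EP => /leq_sizeP/(_ 4 isT).
  rewrite coefCM coefXn mulr1 => /eqP.
  by rewrite mulf_eq0 (negbTE c0) expf_eq0 /= subr_eq0 => /eqP.
have cover x : (forall i j, i != x -> j != x -> h i j = 0) \/
    exists i j, [/\ i != x, j != x & h i j != 0].
  have [/existsP[i /existsP[j /and3P[ix jx hij]]]|N] :=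
      boolP [exists i, exists j, [&& i != x, j != x & h i j != 0]].
    by right; exists i, j.
  left=> i j ix jx; apply/eqP/negPn/negP => hij.
  by case/negP: N; apply/existsP; exists i; apply/existsP; exists j; rewrite ix jx hij.
have neq i j : h i j != 0 -> i != j by apply: contraNneq => ->; rewrite hz.
have [|[a [b [_ _ hab]]]] := cover 0; first by exists 0.
have ab := neq _ _ hab.
have [|[u [v [ua va huv]]]] := cover a; first by exists a.
(* If no vertex covers the support, an edge avoiding [a] must meet [a b] in [b], and an edge
   avoiding [b] must meet both [a b] and [b c], so it is [a c]. *)
have [c [ca cb hbc]] : exists c, [/\ c != a, c != b & h b c != 0].
  have uv := neq _ _ huv.
  have [ub|ub] := eqVneq u b; first by exists v; rewrite -ub [v == u]eq_sym.
  have [vb|vb] := eqVneq v b; first by exists u; rewrite -vb [h v u]hS.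
  by move: huv; rewrite (D a b u v) // eqxx.
have [|[s [t [sb tb hst]]]] := cover b; first by exists b.
have hac : h a c != 0.
  have st := neq _ _ hst.
  have H1 : (s == a) || (t == a).
    by apply: contraNT hst; rewrite negb_or => /andP[sa ta]; rewrite (D a b s t) // eqxx.
  have H2 : (s == c) || (t == c).
    by apply: contraNT hst; rewrite negb_or => /andP[sc tc]; rewrite (D b c s t) // eqxx.
  case/orP: H1 => /eqP Ea; case/orP: H2 => /eqP Ec; subst.
  - by rewrite eqxx in ca.
  - by [].
  - by rewrite hS.
  - by rewrite eqxx in ca.
have := @deg2_triangle k h a b c hs H.
rewrite /= !inE negb_or ab ![_ == c]eq_sym ca cb /= => /(_ isT) T.
suff X : forall i j, ~~ [|| i == a, i == b | i == c] -> h i j = 0.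
  have /eqP : h a b * h a c * h b c = 0.
    by apply: T => i j; rewrite !inE => /X.
  by rewrite !mulf_eq0 (negbTE hab) (negbTE hac) (negbTE hbc).
move=> i j; rewrite !negb_or => /and3P[ia ib ic].
have [ja|ja] := eqVneq j a; last have [jb|jb] := eqVneq j b.
- by rewrite (D b c) // ja // eq_sym.
- by rewrite (D a c) // jb // eq_sym.
- by rewrite (D a b).
Qed.

End Target.

(** * Recovering an embedding of complete graphs *)

Section Edges.
Variable n : nat.

Definition inc (x : 'I_n) (e : 'I_('C(n, 2))) := (x == (edge e).1) || (x == (edge e).2).

Lemma edge_lt (e : 'I_('C(n, 2))) : ((edge e).1 < (edge e).2)%N.
Proof. by have := enum_valP (cast_ord (esym (card_edges n)) e); rewrite inE. Qed.

Lemma edge_inj : injective (@edge n).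
Proof. by move=> e e' /enum_val_inj /cast_ord_inj. Qed.

Lemma edge_ex (x y : 'I_n) : x != y -> exists e, inc x e && inc y e.
Proof.
move=> xy; wlog ltxy : x y xy / (x < y)%N.
  move=> W; case: (ltngtP x y) => [lt|lt|/val_inj E]; first exact: W.
    by rewrite eq_sym in xy; have [e He] := W _ _ xy lt; exists e; rewrite andbC.
  by rewrite E eqxx in xy.
have xyE : (x, y) \in edges n by rewrite inE.
exists (cast_ord (card_edges n) (enum_rank_in xyE (x, y))).
by rewrite /inc /edge cast_ordK enum_rankK_in // !eqxx orbT.
Qed.

Lemma edge_inc_inj x y e e' : x != y -> inc x e -> inc y e -> inc x e' -> inc y e' -> e = e'.
Proof.
move=> xy; rewrite /inc => xe ye xe' ye'; apply: edge_inj.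
have := edge_lt e; have := edge_lt e'.
case: (edge e) xe ye => a b /=; case: (edge e') xe' ye' => a' b' /=.
move=> /orP[]/eqP Ex /orP[]/eqP Ey /orP[]/eqP Ex' /orP[]/eqP Ey'; subst; rewrite ?eqxx // in xy *.
- by move=> lt lt'; move: (ltn_trans lt lt'); rewrite ltnn.
- by move=> lt lt'; move: (ltn_trans lt lt'); rewrite ltnn.
Qed.

Lemma inc_two x y z e : x != y -> inc x e -> inc y e -> inc z e -> (z == x) || (z == y).
Proof.
rewrite /inc => xy /orP[]/eqP Ex /orP[]/eqP Ey /orP[]/eqP Ez; subst;
  by rewrite ?eqxx ?orbT // in xy *.
Qed.

Lemma inc_ends e : exists x y, [/\ x != y, inc x e & inc y e].
Proof.
exists (edge e).1, (edge e).2; rewrite /inc !eqxx orbT; split=> //.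
by rewrite neq_ltn edge_lt.
Qed.

End Edges.

Lemma exists_notin (T : finType) (s : seq T) : (size s < #|T|)%N -> exists q, q \notin s.
Proof.
move=> lts; case: (pickP (fun q => q \notin s)) => [q qs|H]; first by exists q.
suff : (#|T| <= #|s|)%N by move/leq_trans/(_ (card_size s)); rewrite leqNgt lts.
by apply/subset_leq_card/subsetP => i _; apply/negbFE/H.
Qed.

Definition signed_star {F : pzRingType} n (x : 'I_n) (s : 'I_('C(n, 2)) -> bool)
    (e : 'I_('C(n, 2))) : F :=
  if inc x e then (-1) ^+ s e else 0.

Section Combinatorics.
Variables (F : realFieldType) (k n : nat).
Local Notation vert := 'I_k.+4.
Local Notation N := 'C(n, 2).
Variable V : 'I_N -> vert -> vert -> F.
Hypothesis Vs : forall e, sym0 (V e).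

(** [V e] is column [e] of the matrix [E], read as a symmetric matrix on the target vertices, and
    [Z] is the linear map [E]. Of the hypotheses below, [Vpos] will come from the rows of [N] at an
    edge of vertex 0, and [Vpos2] from its triangles through vertex 0 or its unit rows. *)
Definition Z (y : 'I_N -> F) (i j : vert) := \sum_e y e * V e i j.

Definition flip (s : 'I_N -> bool) (y : 'I_N -> F) e := (-1) ^+ s e * y e.

Hypothesis Zsurj : forall z, sym0 z -> exists y, forall i j, Z y i j = z i j.
Hypothesis Zeven : forall s y, cm (sqr2 (Z (flip s y))) = cm (sqr2 (Z y)).
Hypothesis Zdeg : forall x s y, (size (cmt (Z y) (Z (signed_star x s))) <= 3)%N.
Hypothesis Vpos : forall e j, 0 <= V e ord0 j.
Hypothesis Vpos2 : forall e i j, V e ord0 i = 0 -> V e ord0 j = 0 -> 0 <= V e i j.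

Lemma Zsym0 y : sym0 (Z y).
Proof.
split=> [i j|i]; rewrite /Z; first by apply: eq_bigr => e _; rewrite (proj1 (Vs e)).
by rewrite big1 // => e _; rewrite (proj2 (Vs e)) mulr0.
Qed.

Lemma ZD a y b y' i j : Z (fun e => a * y e + b * y' e) i j = a * Z y i j + b * Z y' i j.
Proof.
rewrite /Z !mulr_sumr -big_split /=; apply: eq_bigr => e _.
by rewrite mulrDl !mulrA.
Qed.

Lemma Zdelta e0 i j : Z (fun e => (e == e0)%:R) i j = V e0 i j.
Proof.
rewrite /Z (bigD1 e0) //= eqxx mul1r big1 ?addr0 // => e /negbTE ->.
by rewrite mul0r.
Qed.

Lemma Z_star x s : exists c mu, star_like (Z (signed_star x s)) c mu.
Proof.
apply: deg2_star (Zsym0 _) _ => z /Zsurj[y Ey].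
by rewrite -(cmt_ext (z := Z y) (h := Z (signed_star x s))).
Qed.

Lemma cm_translate (h : vert -> vert -> F) : sym0 h ->
  (forall z, sym0 z -> cm (sqr2 (fun i j => z i j + h i j)) = cm (sqr2 z)) ->
  forall i j, h i j = 0.
Proof.
move=> hs H; apply: cmt_const => // z zs.
have E m : (cmt z h).[m%:R] = cm (sqr2 z).
  elim: m => [|m IH]; rewrite cmt_horner.
    by apply: cm_ext => i j; rewrite /sqr2 mul0r addr0.
  rewrite -IH cmt_horner -[RHS]H; first by apply: cm_ext => i j; rewrite /sqr2 -natr1; ring.
  case: zs hs => [z1 z2] [h1 h2]; split=> [i j|i]; first by rewrite z1 h1.
  by rewrite z2 h2 mulr0 addr0.
have -> : cmt z h = (cm (sqr2 z))%:P by apply: poly_nat_ext => m; rewrite E hornerC.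
exact: size_polyC_leq1.
Qed.

(** Linear relations between the columns involve zero columns only. Translation of the source by
    [kap] does not change [Z]; conjugated by the sign change at [e] it becomes translation of the
    target by [- 2 kap e V e]. The latter preserves the determinant, so [cm_translate] makes it
    trivial. *)
Lemma Z_ker kap : (forall i j, Z kap i j = 0) -> forall e i j, kap e * V e i j = 0.
Proof.
move=> K e i j; pose s e' := e' == e.
suff /(_ i j)/eqP : forall i j, - 2 * (kap e * V e i j) = 0.
  by rewrite mulf_eq0 oppr_eq0 pnatr_eq0 /= => /eqP.
apply: cm_translate => [|z /Zsurj[y Ey]].
  by case: (Vs e) => V1 V2; split=> [a b|a]; rewrite ?V2 ?mulr0 // V1.
have Zf u a b : Z (flip s u) a b = Z u a b - 2 * (u e * V e a b).
  have := Zdelta e a b => <-.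
  rewrite -[RHS]mul1r mulrBr !mul1r.
  have -> : Z u a b - 2 * (u e * Z (fun e' => (e' == e)%:R) a b) =
    1 * Z u a b + (- 2 * u e) * Z (fun e' => (e' == e)%:R) a b by ring.
  rewrite -ZD; apply: eq_bigr => e' _; rewrite /flip /s; congr (_ * _).
  by have [->|_] := eqVneq e' e; rewrite ?expr1 ?expr0 ?mulr1 ?mulr0; ring.
pose u e' := flip s y e' * 1 + 1 * kap e'.
have E1 : cm (sqr2 z) = cm (sqr2 (Z y)) by apply: cm_ext => a b; rewrite /sqr2 Ey.
pose y' := flip s y.
pose y1 e' := 1 * y' e' + 1 * kap e'.
have Fy1 a b : Z (flip s y1) a b = Z y a b - 2 * (kap e * V e a b).
  rewrite Zf /y1 ZD K !mul1r addr0 /y' Zf /flip /s eqxx expr1; ring.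
rewrite E1.
transitivity (cm (sqr2 (Z (flip s y1)))).
  by apply: cm_ext => a b; rewrite /sqr2 Fy1 Ey; ring.
rewrite Zeven -[RHS](Zeven s).
by apply: cm_ext => a b; rewrite /sqr2 /y1 ZD K !mul1r addr0.
Qed.

Definition unitz (a b i j : vert) : F :=
  (((i == a) && (j == b)) || ((i == b) && (j == a)))%:R.

Lemma unitz_sym0 a b : a != b -> sym0 (unitz a b).
Proof.
move=> ab; split=> [i j|i]; rewrite /unitz.
  by rewrite orbC andbC [X in _ || X]andbC.
by rewrite [X in _ || X]andbC orbb; case: eqP => [->|_] //=; rewrite (negbTE ab).
Qed.

(* The reflection of the target fixing [Z y] for [y e = 0] and reversing      *)
(* [V e] preserves the determinant; evaluating it on configurations in which  *)
(* two vertices coincide forces [V e] onto a coordinate axis.                 *)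
Lemma star_reflection e c l l' :
  (forall i j, i != c -> j != c -> V e i j = 0) ->
  V e c l != 0 -> V e c l' != 0 -> l = l'.
Proof.
move=> star Vl Vl'; apply/eqP/negPn/negP => ll'.
have [V1 V2] := Vs e.
have neqc j : V e c j != 0 -> j != c by apply: contraNneq => ->; rewrite V2.
have ex j : exists y, j != c -> forall a b, Z y a b = unitz c j a b.
  have [->|jc] := eqVneq j c; first by exists (fun _ => 0).
  have [|y Hy] := Zsurj (@unitz_sym0 c j _); first by rewrite eq_sym.
  by exists y.
have [yy Hyy] := fin_all_exists ex.
(* An axis [c j] other than [c m] has a preimage without coordinate [e]. Otherwise a multiple of
   [yy j] could be used to make coordinate [e] vanish in a configuration where [m] and [q]
   coincide. *)
have claim m : V e c m != 0 -> forall j, j != c -> j != m -> yy j e = 0.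
  move=> Vm j jc jm; apply/eqP/negPn/negP => a0; have mc := neqc _ Vm.
  have [|q] := @exists_notin _ [:: c; m; j]; first by rewrite card_ord.
  rewrite !inE !negb_or => /and3P[qc qm qj].
  have [|z0 [z0s [kap kap0 E]]] := @cm_coincide F k.+1 c m q.
    by rewrite /= !inE negb_or andbT ![c == _]eq_sym mc qc eq_sym qm.
  pose z1 a b := if (a == c) || (b == c) then unitz c m a b else z0 a b.
  have z1s : sym0 z1.
    have c'm : c != m by rewrite eq_sym.
    have [u1 u2] := unitz_sym0 c'm.
    case: z0s => z01 z02; split=> [a b|a]; rewrite /z1.
      by rewrite orbC u1 z01.
    by rewrite u2 z02 if_same.
  have [y1 Ey1] := Zsurj z1s.
  pose r := - (y1 e / yy j e).
  pose y e' := 1 * y1 e' + r * yy j e'.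
  have ye : y e = 0 by rewrite /y /r mul1r mulNr divfK // subrr.
  have G t : cm (sqr2 (Z (fun e' => 1 * y e' + t * (e' == e)%:R))) =
    kap * ((1 + t * V e c m) ^+ 2 - (t * V e c q) ^+ 2) ^+ 2.
    rewrite (E _ (Zsym0 _)).
      rewrite !ZD !Zdelta !Ey1 !Hyy // /z1 /unitz !eqxx /=.
      rewrite (negbTE qm) (negbTE qc) (negbTE qj) [m == j]eq_sym (negbTE jm) (negbTE mc).
      by rewrite !andbF /=; ring.
    move=> a b ac bc; rewrite !ZD Zdelta star // !Ey1 Hyy // /z1 (negbTE ac) (negbTE bc) /=.
    by rewrite /unitz (negbTE ac) (negbTE bc) /= ?andbF mulr0n; ring.
  have Gsym t : cm (sqr2 (Z (fun e' => 1 * y e' + t * (e' == e)%:R))) =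
    cm (sqr2 (Z (fun e' => 1 * y e' + (- t) * (e' == e)%:R))).
    rewrite -(Zeven (fun e' => e' == e)); apply: cm_ext => a b.
    rewrite /sqr2; congr (_ ^+ 2); apply: eq_bigr => e' _; congr (_ * _).
    rewrite /flip; have [->|_] := eqVneq e' e; first by rewrite ye /= mulr1n expr1; ring.
    by rewrite /= mulr0n expr0; ring.
  have odd0 t : t * V e c m * (1 + t ^+ 2 * (V e c m ^+ 2 - V e c q ^+ 2)) = 0.
    have := Gsym t; rewrite !G => /(mulfI kap0) E'; apply/eqP.
    rewrite -(mulrI_eq0 _ (lregP (_ : 8 != 0 :> F))) ?pnatr_eq0 //; apply/eqP.
    by move/eqP: E'; rewrite -subr_eq0 => /eqP <-; ring.
  (* The odd part in [t] vanishes, so [1 + t^2 D = 0] for the same [D] at [t = 1] and [t = 2], which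
     is absurd. *)
  have := odd0 1; have := odd0 2.
  move=> /eqP; rewrite !mulf_eq0 pnatr_eq0 (negbTE Vm) /= => /eqP E2.
  move=> /eqP; rewrite !mulf_eq0 oner_eq0 (negbTE Vm) /= => /eqP E1.
  lra.
(* A preimage of [V e] with zero coordinate at [e]: each [j] differs from [l] or from [l'], so the
   claim covers all terms. Its difference with the unit vector at [e] contradicts [Z_ker]. *)
pose b e' : F := \sum_(j | j != c) V e c j * yy j e'.
have be : b e = 0.
  apply: big1 => j jc; have [->|nz] := eqVneq (V e c j) 0; first by rewrite mul0r.
  have [Ej|jl] := eqVneq j l; last by rewrite (claim l Vl) // mulr0.
  by rewrite (claim l' Vl') ?mulr0 // Ej.
have Zb i j : Z b i j = V e i j.
  rewrite /Z /b; under eq_bigr do rewrite mulr_suml.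
  rewrite exchange_big /=.
  have -> : V e i j = \sum_(q | q != c) V e c q * unitz c q i j.
    rewrite /unitz.
    have [->|ic] := eqVneq i c.
      have [->|jc] := eqVneq j c.
        by rewrite V2 big1 // => q qc; rewrite andbC /= [c == q]eq_sym (negbTE qc) mulr0.
      rewrite (bigD1 j) //= eqxx mulr1 big1 ?addr0 // => q /andP[qc qj].
      by rewrite [j == q]eq_sym (negbTE qj) /= andbF mulr0.
    have [->|jc] := eqVneq j c.
      rewrite (bigD1 i) //= eqxx mulr1 V1 big1 ?addr0 // => q /andP[qc qj].
      by rewrite [i == q]eq_sym (negbTE qj) mulr0.
    by rewrite star // big1 // => q qc; rewrite andbF mulr0.
  apply: eq_bigr => q qc; rewrite -Hyy // /Z mulr_sumr.
  by apply: eq_bigr => e' _; rewrite mulrA.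
have K i j : Z (fun e' => 1 * (e' == e)%:R + (- 1) * b e') i j = 0.
  by rewrite ZD Zdelta Zb; ring.
have := Z_ker K e c l; rewrite eqxx be mulr1 mulr0 addr0 mul1r => /eqP.
by rewrite (negbTE Vl).
Qed.


Definition star_sum x := Z (signed_star x (fun _ => false)).

Lemma star_sumE x i j : star_sum x i j = \sum_(e | inc x e) V e i j.
Proof.
rewrite /star_sum /Z [RHS]big_mkcond /=; apply: eq_bigr => e _.
by rewrite /signed_star; case: ifP; rewrite ?expr0 ?mul1r ?mul0r.
Qed.

Lemma star_sum_ge0 x j : 0 <= star_sum x ord0 j.
Proof. by rewrite star_sumE sumr_ge0. Qed.

Lemma star_sum_eq0 x j : star_sum x ord0 j = 0 -> forall e, inc x e -> V e ord0 j = 0.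
Proof. by rewrite star_sumE => /psumr_eq0P H e xe; apply: H. Qed.

(** Nonnegativity forces every column at [x] to vanish in row 0 outside [c]. The image of any signed
    star at [x] is then either zero or centred at [c], and half the difference of two images whose
    signs differ only at [e] is [V e]. *)
Lemma confined x c : c != ord0 -> (forall j, j != c -> star_sum x ord0 j = 0) ->
  forall e, inc x e -> forall i j, i != c -> j != c -> V e i j = 0.
Proof.
move=> c0 A0.
have H s i j : i != c -> j != c -> Z (signed_star x s) i j = 0.
  have Z0 b : b != c -> Z (signed_star x s) ord0 b = 0.
    move=> bc; apply: big1 => e _; rewrite /signed_star; case: ifP => [xe|_].
      by rewrite (star_sum_eq0 (A0 b bc) xe) mulr0.
    by rewrite mul0r.
  have [c' [mu [S1 S2]]] := Z_star x s; move=> ic jc.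
  have [Zs Z00] := Zsym0 (signed_star x s).
  have [mu0|mu0] := eqVneq mu 0.
    have [ic'|ic'] := eqVneq i c'; last have [jc'|jc'] := eqVneq j c'.
    - have [ji|ji] := eqVneq j i; first by rewrite ji Z00.
      by apply/eqP; rewrite -sqrf_eq0 ic' S2 ?mu0 // -ic'.
    - have [ji|ji] := eqVneq i j; first by rewrite ji Z00.
      by apply/eqP; rewrite -sqrf_eq0 Zs jc' S2 ?mu0 // -jc'.
    - exact: S1.
  have c'c : c' = c.
    have [c'0|c'0] := eqVneq c' ord0.
      have [|q] := @exists_notin _ [:: ord0; c]; first by rewrite card_ord.
      rewrite !inE negb_or => /andP[q0 qc]; case/eqP: mu0.
      by rewrite -(S2 q) c'0 // Z0 // expr0n.
    apply/eqP/negPn/negP => cc; case/eqP: mu0; rewrite -(S2 ord0) 1?eq_sym //.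
    by rewrite Zs Z0 // expr0n.
  by apply: S1; rewrite c'c.
move=> e xe i j ic jc.
have -> : V e i j = (star_sum x i j - Z (signed_star x (fun e' => e' == e)) i j) / 2.
  rewrite /star_sum /Z -sumrB (bigD1 e) //= big1 => [|e' /negbTE ee'].
    by rewrite /signed_star xe eqxx expr0 expr1; field.
  by rewrite /signed_star ee' subrr.
by rewrite /star_sum !H // subrr mul0r.
Qed.

Definition isolated x := forall e, inc x e -> forall i j, V e i j = 0.

Definition centered x c mu := [/\ c != ord0, mu != 0 & star_like (star_sum x) c mu].

Definition based x mu := mu != 0 /\ star_like (star_sum x) ord0 mu.

(** If the unsigned star of [x] has zero image, [confined] with a fourth vertex as centre kills
    every entry of every column at [x]. *)
Lemma vertex_cases x :
  [\/ isolated x, exists c mu, centered x c mu | exists mu, based x mu].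
Proof.
have [c [mu S]] := Z_star x (fun _ => false); have [S1 S2] := S.
have [mu0|mu0] := eqVneq mu 0; last first.
  have [c0|c0] := eqVneq c ord0; last by apply: Or32; exists c, mu.
  by apply: Or33; exists mu; split=> //; rewrite -c0.
apply: Or31 => e xe i j.
have [Zs Z00] := Zsym0 (signed_star x (fun _ => false)).
have A0 b : star_sum x ord0 b = 0.
  have [c0|c0] := eqVneq ord0 c.
    have [<-|b0] := eqVneq ord0 b; first exact: Z00.
    by apply/eqP; rewrite -sqrf_eq0 {1}c0 S2 ?mu0 // -c0 eq_sym.
  have [->|bc] := eqVneq b c; last exact: S1.
  by apply/eqP; rewrite -sqrf_eq0 /star_sum Zs S2 ?mu0.
have [|q] := @exists_notin _ [:: ord0; i; j]; first by rewrite card_ord.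
rewrite !inE !negb_or => /and3P[q0 qi qj].
by apply: (@confined x q) => //; rewrite eq_sym.
Qed.

Lemma centered_star x c mu e : centered x c mu -> inc x e ->
  forall i j, i != c -> j != c -> V e i j = 0.
Proof.
by case=> c0 _ [S1 _] xe; apply: (@confined x c) => // j jc; apply: S1; rewrite // eq_sym.
Qed.

Definition axis e c l m := forall i j, V e i j = m * unitz c l i j.

Lemma V_dep e e' a b : a != 0 -> (forall i j, a * V e i j = b * V e' i j) ->
  e != e' -> forall i j, V e i j = 0.
Proof.
move=> a0 H ee' i j.
have := @Z_ker (fun q => a * (q == e)%:R + (- b) * (q == e')%:R) _ e i j.
rewrite eqxx (negbTE ee') mulr1 mulr0 addr0 => K; apply/eqP; rewrite -(mulrI_eq0 _ (lregP a0)).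
by apply/eqP/K => u v; rewrite ZD !Zdelta H; ring.
Qed.

(** By [star_reflection] each nonzero column at [x] lies on one axis, and by [V_dep] two different
    edges cannot share an axis. So the entry of the star sum on the axis [c l] comes from a single
    edge. *)
Lemma centered_axis x c mu l : centered x c mu -> l != c ->
  exists e m, [/\ inc x e, m ^+ 2 = mu, m != 0 & axis e c l m].
Proof.
move=> C lc; have [c0 mu0 [S1 S2]] := C.
have Al := S2 l lc.
have ax e : inc x e -> V e c l != 0 -> axis e c l (V e c l).
  move=> xe nz i j; have st := centered_star C xe.
  have [V1 V2] := Vs e; rewrite /unitz.
  have st' q : q != l -> V e c q = 0.
    move=> ql; apply/eqP; apply: contraNT ql => nz'.
    by rewrite (star_reflection st nz nz').
  have [->|ic] := eqVneq i c.
    rewrite [c == l]eq_sym (negbTE lc) /= orbF.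
    by have [->|jl] := eqVneq j l; rewrite ?mulr1 // st' // mulr0.
  have [->|jc] := eqVneq j c; last by rewrite /= andbF mulr0 st.
  by rewrite andbT /= V1; have [->|il] := eqVneq i l; rewrite ?mulr1 // st' // mulr0.
have [e xe nz] : exists2 e, inc x e & V e c l != 0.
  case: (pickP (fun e => inc x e && (V e c l != 0))) => [e /andP[]|H]; first by exists e.
  case/eqP: mu0; rewrite -Al star_sumE big1 ?expr0n // => e xe.
  by have := H e; rewrite xe => /negbFE/eqP.
exists e, (V e c l); split=> //; last exact: ax.
rewrite -Al star_sumE (bigD1 e) //= big1 ?addr0 // => e' /andP[xe' ee'].
have [//|nz'] := eqVneq (V e' c l) 0.
apply: (@V_dep e' e (V e c l) (V e' c l)) => // i j.
by rewrite (ax _ xe nz i j) (ax _ xe' nz' i j); ring.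
Qed.

Lemma axis_support e c l m i j : axis e c l m -> V e i j != 0 ->
  (i = c /\ j = l) \/ (i = l /\ j = c).
Proof.
move=> ax; rewrite ax /unitz.
case: (boolP ((i == c) && (j == l))) => [/andP[/eqP-> /eqP->] _|_]; first by left.
case: (boolP ((i == l) && (j == c))) => [/andP[/eqP-> /eqP->] _|_]; first by right.
by rewrite /= mulr0 eqxx.
Qed.

Lemma axis_neq0 e c l m : axis e c l m -> m != 0 -> V e c l != 0.
Proof. by move=> ax m0; rewrite ax /unitz !eqxx mulr1. Qed.

(** Two vertices with the same centre share the edge of every axis [c l]. There are at least two
    such axes but only one edge joins [x] to [x']. *)
Lemma centered_inj x x' c mu mu' : centered x c mu -> centered x' c mu' -> x = x'.
Proof.
move=> C C'; apply/eqP/negPn/negP => xx'.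
have key l : l != c -> exists e m, [/\ m != 0, axis e c l m, inc x e & inc x' e].
  move=> lc; have [e [m [xe _ m0 ax]]] := centered_axis C lc.
  have [e' [m' [xe' _ m0' ax']]] := centered_axis C' lc.
  exists e, m; split=> //.
  suff -> : e = e' by [].
  apply/eqP/negPn/negP => ee'.
  have := axis_neq0 ax m0; rewrite (@V_dep e e' m' m) ?eqxx // => i j.
  by rewrite ax ax'; ring.
have [|l] := @exists_notin _ [:: c]; first by rewrite card_ord.
rewrite inE => lc; have [|l'] := @exists_notin _ [:: c; l]; first by rewrite card_ord.
rewrite !inE negb_or => /andP[l'c l'l].
have [e [m [m0 ax xe xe']]] := key l lc; have [e' [m' [m0' ax' ye ye']]] := key l' l'c.
have E := edge_inc_inj xx' xe xe' ye ye'; subst e'.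
have [[_ El]|[Ec _]] := axis_support ax (axis_neq0 ax' m0').
  by rewrite El eqxx in l'l.
by rewrite Ec eqxx in lc.
Qed.

Lemma centered_center x c c' mu mu' : centered x c mu -> centered x c' mu' -> c = c'.
Proof.
move=> [c0 m0 [S1 S2]] [c0' m0' [S1' S2']]; apply/eqP/negPn/negP => cc'.
have [|q] := @exists_notin _ [:: c; c']; first by rewrite card_ord.
rewrite !inE negb_or => /andP[qc qc']; case/eqP: m0.
by rewrite -(S2 q qc) S1' ?expr0n.
Qed.

Lemma centered_based x c mu mu' : centered x c mu -> based x mu' -> False.
Proof.
move=> [c0 m0 [S1 S2]] [m0' [S1' S2']].
have [|q] := @exists_notin _ [:: c; ord0]; first by rewrite card_ord.
rewrite !inE negb_or => /andP[qc q0]; case/eqP: m0.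
by rewrite -(S2 q qc) S1' ?expr0n.
Qed.

(** The star sums are nonnegative at vertex 0, so having constant squares makes their entries there
    constant. Two such sums are proportional, and [Z_ker] applies to the relation between them. *)
Lemma based_isolated x x' mu mu' : x != x' -> based x mu -> based x' mu' ->
  forall e, inc x e -> ~~ inc x' e -> forall i j, V e i j = 0.
Proof.
move=> xx' [m0 [S1 S2]] [m0' [S1' S2']] e xe xe'.
have [|q] := @exists_notin _ [:: (ord0 : vert)]; first by rewrite card_ord.
rewrite inE => q0; pose a := star_sum x ord0 q; pose b := star_sum x' ord0 q.
have Ea j : j != ord0 -> star_sum x ord0 j = a.
  by move=> j0; apply/eqP; rewrite -(@eqrXn2 _ 2) ?star_sum_ge0 // !S2.
have Eb j : j != ord0 -> star_sum x' ord0 j = b.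
  by move=> j0; apply/eqP; rewrite -(@eqrXn2 _ 2) ?star_sum_ge0 // !S2'.
have b0 : b != 0 by rewrite -sqrf_eq0 /b S2'.
have [Zs Z0] := Zsym0 (signed_star x (fun _ => false)).
have [Zs' Z0'] := Zsym0 (signed_star x' (fun _ => false)).
have K i j : Z (fun e => b * signed_star x (fun _ => false) e +
     (- a) * signed_star x' (fun _ => false) e) i j = 0.
  rewrite ZD -/(star_sum x i j) -/(star_sum x' i j).
  have [->|i0] := eqVneq i ord0; last have [->|j0] := eqVneq j ord0.
  - have [->|j0] := eqVneq j ord0; first by rewrite /star_sum Z0 Z0'; ring.
    by rewrite Ea // Eb //; ring.
  - by rewrite /star_sum Zs Zs' -/(star_sum x _ _) -/(star_sum x' _ _) Ea // Eb //; ring.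
  - by rewrite S1 // S1' //; ring.
move=> i j; have := Z_ker K e i j; rewrite /signed_star xe (negbTE xe') expr0 mulr1 mulr0 addr0.
by move/eqP; rewrite mulf_eq0 (negbTE b0) /= => /eqP.
Qed.

(** The other end [y] also sees the nonzero column of [e]. It is not isolated, and a centre of [y]
    away from 0 must be [c] or [l]; the former is taken by [x]. *)
Lemma edge_cases x c mu e m l : centered x c mu -> inc x e -> l != c -> m != 0 ->
  axis e c l m -> exists y, [/\ y != x, inc y e &
    (exists mu', based y mu') \/ (exists mu', centered y l mu')].
Proof.
move=> C xe lc m0 ax; have nz := axis_neq0 ax m0.
have [y yx ye] : exists2 y, y != x & inc y e.
  have [u [v [uv ue ve]]] := inc_ends e.
  have [ux|ux] := eqVneq u x; last by exists u.
  by exists v; rewrite // -ux eq_sym.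
exists y; split=> //; have [I|[c' [mu' C']]|B] := vertex_cases y; last by left.
  by rewrite I ?eqxx in nz.
right; exists mu'; have [E|c'c] := eqVneq c' c.
  by subst c'; rewrite (centered_inj C C') eqxx in yx.
have [<-//|c'l] := eqVneq c' l.
by rewrite (centered_star C' ye) ?eqxx // eq_sym in nz.
Qed.

(* A hub-less vertex [y] adjacent to a vertex centered at [l] meets it along  *)
(* the edge [l, 0], so a target vertex that is not a center is isolated.      *)
Lemma centered_surj c : c != ord0 -> exists x mu, centered x c mu.
Proof.
move=> c0; have [//|NC] := pselect (exists x mu, centered x c mu).
have [|l] := @exists_notin _ [:: ord0; c]; first by rewrite card_ord.
rewrite !inE negb_or => /andP[l0 lc].
have cl : c != l by rewrite eq_sym.
have [e nz] : exists e, V e c l != 0.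
  have [y Ey] := Zsurj (unitz_sym0 cl).
  case: (pickP (fun e => V e c l != 0)) => [e He|H]; first by exists e.
  have := Ey c l; rewrite /Z big1 => [/eqP|e _].
    by rewrite /unitz !eqxx /= eq_sym oner_eq0.
  by have := H e => /negbFE/eqP ->; rewrite mulr0.
have main x y mu mu' : x != y -> inc x e -> inc y e -> centered x l mu ->
    based y mu' -> exists x mu, centered x c mu.
  move=> xy xe ye C B; have l0' : ord0 != l by rewrite eq_sym.
  have [e' [m [xe' _ m0 ax]]] := centered_axis C l0'.
  have [y' [y'x ye' Cy']] := edge_cases C xe' l0' m0 ax.
  have nz' := axis_neq0 ax m0.
  case: Cy' => [[mu2 B']|[mu2 [/eqP//]]].
  have [E|y'y] := eqVneq y' y.
    subst y'; have Ee := edge_inc_inj xy xe ye xe' ye'; subst e'.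
    have [[E _]|[E _]] := axis_support ax nz; first by rewrite E eqxx in lc.
    by rewrite E eqxx in c0.
  rewrite (based_isolated y'y B' B ye') ?eqxx // in nz'.
  apply/negP => yi; have xy' : x != y' by rewrite eq_sym.
  have := inc_two xy' xe' ye' yi.
  by rewrite [y == x]eq_sym (negbTE xy) [y == y']eq_sym (negbTE y'y).
have [x [y [xy xe ye]]] := inc_ends e.
have cases z : inc z e -> (exists mu, centered z l mu) \/ (exists mu, based z mu).
  move=> ze; have [I|[c' [mu C]]|B] := vertex_cases z; last by right.
    by rewrite I ?eqxx in nz.
  left; exists mu; have [E|c'l] := eqVneq c' l; first by rewrite -E.
  have [E|c'c] := eqVneq c' c; first by case: NC; exists z, mu; rewrite -E.
  by rewrite (centered_star C ze) ?eqxx // eq_sym in nz.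
have yx : y != x by rewrite eq_sym.
case: (cases x xe) => [[mu C]|[mu B]]; case: (cases y ye) => [[mu' C']|[mu' B']].
- by rewrite (centered_inj C C') eqxx in xy.
- exact: main xy xe ye C B'.
- exact: main yx ye xe C' B.
have [_ [S1 _]] := B; case/eqP: nz; rewrite -(S1 c l c0 l0) star_sumE.
rewrite (bigD1 e) //= big1 ?addr0 // => e' /andP[xe' ee'].
apply: (based_isolated xy B B' xe'); apply/negP => ye'.
by rewrite (edge_inc_inj xy xe ye xe' ye') eqxx in ee'.
Qed.

(** [T] sends a nonzero target vertex to the source vertex centred there, and vertex 0 to the unique
    based vertex. *)
Lemma embedding : exists (T : vert -> 'I_n) (mu : F),
  [/\ injective T, 0 < mu &
    forall e i j, V e i j = mu * ((i != j) && inc (T i) e && inc (T j) e)%:R].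
Proof.
have ex c : exists x, c != ord0 -> exists mu, centered x c mu.
  have [->|c0] := eqVneq c ord0.
    have [|x _] := @centered_surj (inord 1); last by exists x.
    by apply/eqP => /(congr1 val); rewrite /= inordK.
  by have [x Hx] := centered_surj c0; exists x.
have [X HX] := fin_all_exists ex.
have HX0 c : c != ord0 -> exists y e m, [/\ y != X c, inc (X c) e, inc y e, m != 0 &
    axis e c ord0 m] /\ exists mu', based y mu'.
  move=> c0; have [mu C] := HX c c0; have c0' : ord0 != c by rewrite eq_sym.
  have [e [m [xe _ m0 ax]]] := centered_axis C c0'.
  have [y [yx ye]] := edge_cases C xe c0' m0 ax.
  by case=> [B|[mu' [/eqP//]]]; exists y, e, m; split.
pose one : vert := inord 1.
have one0 : one != ord0 by apply/eqP => /(congr1 val); rewrite /= inordK.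
have [y [e1 [m1 [[yx1 xe1 ye1 m10 ax1] [muy By]]]]] := HX0 one one0.
have yX c : c != ord0 -> y != X c.
  by move=> c0; apply/eqP => E; have [mu C] := HX c c0; rewrite -E in C;
     apply: centered_based C By.
have uniq_base y' mu' : based y' mu' -> y' = y.
  move=> B'; apply/eqP/negPn/negP => y'y.
  have yy' : y != y' by rewrite eq_sym.
  have := axis_neq0 ax1 m10; rewrite (based_isolated yy' By B' ye1) ?eqxx //.
  apply/negP => y'e; have := inc_two yx1 ye1 xe1 y'e.
  rewrite (negbTE y'y) /= => /eqP E; have [mu C] := HX one one0.
  by rewrite -E in C; apply: centered_based C B'.
have HX1 c : c != ord0 -> exists e m, [/\ inc (X c) e, inc y e, m != 0 & axis e c ord0 m].
  move=> c0; have [y' [e [m [[_ xe ye m0 ax] [mu' B]]]]] := HX0 c c0.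
  by exists e, m; rewrite -(uniq_base y' mu' B).
pose T c := if c == ord0 then y else X c.
have T0 : T ord0 = y by rewrite /T eqxx.
have TX c : c != ord0 -> T c = X c by rewrite /T => /negbTE ->.
have injT : injective T.
  move=> c c'; rewrite /T; case: (eqVneq c ord0) => [->|c0]; case: (eqVneq c' ord0) => [->|c0'] //.
  - by move=> E; case/eqP: (yX c' c0').
  - by move=> E; case/eqP: (yX c c0).
  - move=> E; have [mu C] := HX c c0; have [mu' C'] := HX c' c0'.
    by rewrite -E in C'; apply: centered_center C C'.
(* The entry is positive by [Vpos] when [l] is vertex 0. Otherwise the axis [c l] misses row 0, and
   [Vpos2] applies. *)
have axes c l mu : c != ord0 -> centered (X c) c mu -> l != c -> exists e m,
    [/\ inc (T c) e, inc (T l) e, 0 < m, m ^+ 2 = mu & axis e c l m].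
  move=> c0 C lc; have [e [m [xe m2 m0 ax]]] := centered_axis C lc.
  have [y' [y'x ye' Cy']] := edge_cases C xe lc m0 ax.
  have mE : V e c l = m by rewrite ax /unitz !eqxx mulr1.
  have [V1 _] := Vs e.
  have [l0|l0] := eqVneq l ord0.
    subst l; exists e, m; split=> //; first by rewrite TX.
      case: Cy' => [[mu' B]|[mu' [/eqP//]]].
      by rewrite T0 -(uniq_base _ _ B).
    by rewrite lt0r m0 -mE V1 Vpos.
  have Ty' : T l = y'.
    rewrite TX //; case: Cy' => [[mu' B]|[mu' C']]; last first.
      by have [mu2 C2] := HX l l0; rewrite (centered_inj C2 C').
    have E := uniq_base _ _ B; subst y'.
    have [e' [m' [xe' ye2 m0' ax']]] := HX1 c c0.
    have Ee := edge_inc_inj y'x ye' xe ye2 xe'; subst e'.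
    have [[_ El]|[Ec _]] := axis_support ax' (axis_neq0 ax m0).
      by rewrite El eqxx in l0.
    by rewrite Ec eqxx in c0.
  exists e, m; split=> //; first by rewrite TX.
    by rewrite Ty'.
  rewrite lt0r m0 -mE Vpos2 // ax /unitz.
    by rewrite ![ord0 == _]eq_sym (negbTE c0) (negbTE l0) mulr0.
  by rewrite ![ord0 == _]eq_sym (negbTE c0) (negbTE l0) mulr0.
have [mu C1] := HX one one0.
(* The edge on the axis from [c] to [one] belongs to both stars, so its entry squares to both
   constants. *)
have Cmu c mu' : c != ord0 -> centered (X c) c mu' -> mu' = mu.
  move=> c0 C; have [E|c1] := eqVneq c one.
    subst c; have [_ _ [_ S]] := C; have [_ _ [_ S1]] := C1.
    by rewrite -(S ord0) 1?eq_sym // -(S1 ord0) 1?eq_sym.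
  have [|e [m [xe le m0 m2 ax]]] := axes c one mu' c0 C; first by rewrite eq_sym.
  have [e' [m' [xe' le' m0' m2' ax']]] := axes one c mu one0 C1 c1.
  have neqT : T c != T one by apply: contraNneq c1 => /injT ->.
  have E := edge_inc_inj neqT xe le le' xe'; subst e'.
  have := ax c one; rewrite ax' /unitz !eqxx /= orbT !mulr1 => Em.
  by rewrite -m2 -m2' Em.
have m1E : exists2 m, 0 < m & forall c l, c != l -> exists e,
    [/\ inc (T c) e, inc (T l) e & axis e c l m].
  have [|e [m [_ _ m0 m2 _]]] := axes one ord0 mu one0 C1; first by rewrite eq_sym.
  exists m => //.
  have main c l : c != ord0 -> l != c -> exists e, [/\ inc (T c) e, inc (T l) e & axis e c l m].
    move=> c0 lc; have [mu' C] := HX c c0.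
    have [e' [m' [xe le m0' m2' ax]]] := axes c l mu' c0 C lc.
    exists e'; split=> //; suff -> : m = m' by [].
    by apply/eqP; rewrite -(@eqrXn2 _ 2) ?ltW // m2 m2' (Cmu c mu').
  move=> c l cl; have [c0|c0] := eqVneq c ord0; last by apply: main; rewrite // eq_sym.
  have l0 : l != ord0 by rewrite -c0 eq_sym.
  have [e' [le ce ax]] := main l c l0 cl; exists e'; split=> // i j.
  by rewrite ax /unitz orbC.
have [m m0 H] := m1E.
have outside u e : (forall c, T c != u) -> inc u e -> forall i j, V e i j = 0.
  move=> Tu ue i j; have [I|[c [mu' C]]|[mu' B]] := vertex_cases u; first exact: I.
    have [c0 _ _] := C; have [mu2 C2] := HX c c0.
    by have := Tu c; rewrite TX // (centered_inj C2 C) eqxx.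
  by have := Tu ord0; rewrite T0 (uniq_base _ _ B) eqxx.
exists T, m; split=> // e i j.
have [V1 V2] := Vs e.
have [->|ij] := eqVneq i j; first by rewrite V2 mulr0.
have [e' [ie' je' ax']] := H i j ij.
have neqT : T i != T j by apply: contraNneq ij => /injT ->.
have [ie|ie] := boolP (inc (T i) e); have [je|je] := boolP (inc (T j) e); rewrite /= ?mulr1 ?mulr0.
- by rewrite (edge_inc_inj neqT ie je ie' je') ax' /unitz !eqxx mulr1.
all: apply/eqP; apply/negPn/negP => nz.
all: have [u [v [uv ue ve]]] := inc_ends e.
all: have inT w : inc w e -> exists c, T c = w by
  move=> we; case: (pickP (fun c => T c == w)) => [c /eqP|Hw]; [exists c|
   case/eqP: nz; apply: (@outside w) => // c; rewrite Hw].
all: have [c Ec] := inT u ue; have [l El] := inT v ve; subst u v.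
all: have cl : c != l by apply: contraNneq uv => ->.
all: have [e2 [ce le ax]] := H c l cl; have E := edge_inc_inj uv ue ve ce le; subst e2.
all: by have [[E1 E2]|[E1 E2]] := axis_support ax nz; move: ie je; rewrite E1 E2 ?ce ?le.
Qed.

End Combinatorics.

(** * Generic configurations and changes of sign of the edge lengths *)

Section SquareRoots.
Variable K : numFieldType.

Definition subfield (P : K -> Prop) :=
  [/\ P 1, forall x y, P x -> P y -> P (x - y), forall x y, P x -> P y -> P (x * y)
    & forall x, P x -> P x^-1].

Section Subfield.
Variable P : K -> Prop.
Hypothesis HP : subfield P.

Lemma sf1 : P 1. Proof. by case: HP. Qed.
Lemma sfB x y : P x -> P y -> P (x - y). Proof. by case: HP => _ H _ _; apply: H. Qed.
Lemma sfM x y : P x -> P y -> P (x * y). Proof. by case: HP => _ _ H _; apply: H. Qed.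
Lemma sfV x : P x -> P x^-1. Proof. by case: HP => _ _ _ H; apply: H. Qed.
Lemma sf0 : P 0. Proof. by rewrite -(subrr 1); apply: sfB sf1 sf1. Qed.
Lemma sfN x : P x -> P (- x). Proof. by rewrite -sub0r; apply: sfB sf0. Qed.
Lemma sfD x y : P x -> P y -> P (x + y).
Proof. by move=> Px Py; rewrite -[y]opprK; apply: sfB Px (sfN Py). Qed.
Lemma sfX x m : P x -> P (x ^+ m).
Proof. by move=> Px; elim: m => [|m IH]; rewrite ?expr0 ?exprS; [exact: sf1|exact: sfM]. Qed.
Lemma sf_prod (I : Type) (r : seq I) (Q : pred I) (G : I -> K) :
  (forall i, Q i -> P (G i)) -> P (\prod_(i <- r | Q i) G i).
Proof. by move=> H; apply: (big_ind P) => //; [exact: sf1|exact: sfM]. Qed.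
Lemma sf_nat m : P m%:R.
Proof. by elim: m => [|m IH]; [exact: sf0|rewrite -natr1; apply: sfD IH sf1]. Qed.
Lemma sf_ratr q : P (ratr q).
Proof.
have sfz z : P z%:~R.
  by case: z => m; [|rewrite NegzE mulrNz; apply: sfN]; apply: sf_nat.
by rewrite /ratr; apply: sfM => //; apply: sfV.
Qed.
End Subfield.

Variables (P : K -> Prop) (I : finType).
Hypothesis HP : subfield P.

(** The field obtained from [P] by adjoining the square roots [l e] for [e] in [s], one quadratic
    step at a time. *)
Fixpoint adjoin (l : I -> K) (s : seq I) (x : K) : Prop :=
  if s is e :: s' then
    exists u v, [/\ adjoin l s' u, adjoin l s' v & x = u + v * l e]
  else P x.

Section Adjoin.
Variable l : I -> K.
Hypothesis l2 : forall e, P (l e ^+ 2).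

Lemma adjoin_base s x : P x -> adjoin l s x.
Proof.
move=> Px; elim: s => [|e s IH] //=; exists x, 0; split=> //; last by rewrite mul0r addr0.
elim: s {IH} => [|e' s IH] /=; first exact: (sf0 HP).
by exists 0, 0; split=> //; rewrite mul0r addr0.
Qed.

Lemma adjoin_cons e s x : adjoin l s x -> adjoin l (e :: s) x.
Proof.
by move=> H; exists x, 0; split; [|apply/adjoin_base/(sf0 HP)|rewrite mul0r addr0].
Qed.

Lemma adjoin_subfield s : subfield (adjoin l s).
Proof.
elim: s => [|e s IH]; first exact: HP.
have m2 : adjoin l s (l e ^+ 2) by apply: adjoin_base.
split.
- exact/adjoin_cons/(sf1 IH).
- move=> x y [u [v [Hu Hv ->]]] [u' [v' [Hu' Hv' ->]]].
  exists (u - u'), (v - v'); split; [exact: sfB|exact: sfB|ring].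
- move=> x y [u [v [Hu Hv ->]]] [u' [v' [Hu' Hv' ->]]].
  exists (u * u' + v * v' * l e ^+ 2), (u * v' + v * u'); split; last ring.
    by apply: (sfD IH); [exact: (sfM IH) | apply: (sfM IH) => //; exact: (sfM IH)].
  by apply: (sfD IH); exact: (sfM IH).
- move=> x [u [v [Hu Hv ->]]].
  (* When the norm vanishes and [v] is nonzero, [l e] is [u / v] or its opposite and already lies in
     the smaller field. *)
  have [nz|z] := eqVneq (u ^+ 2 - v ^+ 2 * l e ^+ 2) 0; last first.
    exists (u / (u ^+ 2 - v ^+ 2 * l e ^+ 2)), (- v / (u ^+ 2 - v ^+ 2 * l e ^+ 2)).
    have Hd : adjoin l s (u ^+ 2 - v ^+ 2 * l e ^+ 2)^-1.
      apply/(sfV IH)/(sfB IH); first exact: sfX.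
      by apply: (sfM IH) => //; exact: sfX.
    split; [exact: sfM|by apply: (sfM IH) => //; apply: (sfN IH)|].
    have E : u ^+ 2 - v ^+ 2 * l e ^+ 2 = (u + v * l e) * (u - v * l e) by ring.
    have : (u + v * l e) * (u - v * l e) != 0 by rewrite -E.
    by rewrite mulf_eq0 negb_or => /andP[n1 n2]; rewrite E; field; rewrite n1 n2.
  apply: adjoin_cons; apply: (sfV IH).
  have [->|v0] := eqVneq v 0; first by rewrite mul0r addr0.
  have : (l e - u / v) * (l e + u / v) = 0.
    have -> : (l e - u / v) * (l e + u / v) = - (u ^+ 2 - v ^+ 2 * l e ^+ 2) / v ^+ 2.
      by field.
    by rewrite nz oppr0 mul0r.
  move=> /eqP; rewrite mulf_eq0 subr_eq0 addr_eq0 => /orP[/eqP ->|/eqP ->].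
    by apply: (sfD IH) => //; do !apply: (sfM IH) => //; apply: (sfV IH).
  apply: (sfD IH) => //; apply: (sfM IH) => //; apply: (sfN IH).
  by apply: (sfM IH) => //; apply: (sfV IH).
Qed.

Lemma adjoin_gen s e : e \in s -> adjoin l s (l e).
Proof.
elim: s => // e' s IH; rewrite inE; case: (eqVneq e e') => [-> _|_ /= /IH].
  have S := adjoin_subfield s; exists 0, 1; split; [exact: sf0|exact: sf1|ring].
exact: adjoin_cons.
Qed.

Hypothesis indep : forall T : {set I}, T != set0 -> ~ P (\prod_(e in T) l e).

(** Kummer theory for square roots. If the product over [T] is [u + v l e], squaring expresses
    [2 u v l e] in the smaller field. So either [l e] lies there, or one of [u], [v] is zero and the
    product over [T] or over [T] with [e] added lies there. *)
Lemma adjoin_indep s (T : {set I}) : uniq s -> T != set0 ->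
  (forall e, e \in T -> e \notin s) -> ~ adjoin l s (\prod_(e in T) l e).
Proof.
elim: s T => [|e s IH] T; first by move=> _ T0 _; apply: indep.
move=> /= /andP[es us] T0 dis [u [v [Hu Hv E]]].
have S := adjoin_subfield s.
have le : ~ adjoin l s (l e).
  move=> H; apply: (IH [set e]%SET us); first by rewrite -card_gt0 cards1.
    by move=> x; rewrite inE => /eqP ->.
  by rewrite big_set1.
have sq : adjoin l s ((\prod_(e in T) l e) ^+ 2).
  by apply: adjoin_base; rewrite -prodrXl; apply: sf_prod.
have disT x : x \in T -> x \notin s by move/dis; rewrite inE negb_or => /andP[].
have eT : e \notin T by apply/negP => /dis; rewrite inE eqxx.
have m2 : adjoin l s (l e ^+ 2) by apply: adjoin_base.
have [u0|u0] := eqVneq u 0; last have [v0|v0] := eqVneq v 0.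
- apply: (IH (e |: T)%SET us).
  + by apply/set0Pn; exists e; rewrite !inE eqxx.
  + by move=> x; rewrite !inE => /orP[/eqP ->|/disT].
  rewrite big_setU1 //= E u0 add0r mulrCA -expr2; exact: (sfM S).
- by apply: (IH T us) => //; rewrite E v0 mul0r addr0.
- apply: le.
  have -> : l e = ((\prod_(e in T) l e) ^+ 2 - u ^+ 2 - v ^+ 2 * l e ^+ 2) / (2 * u * v).
    by rewrite E; field; rewrite u0 v0.
  apply: (sfM S).
    apply: (sfB S); first by apply: (sfB S) => //; apply: (sfX S).
    by apply: (sfM S) => //; apply: (sfX S).
  by apply/(sfV S); do !apply: (sfM S) => //; apply: sf_nat.
Qed.

End Adjoin.

Definition flip1 (e : I) (l : I -> K) (i : I) := if i == e then - l i else l i.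

End SquareRoots.

Lemma map_meval (S : comNzRingType) (phi : {rmorphism rat -> S}) N
    (f : {mpoly rat[N]}) (y : 'I_N -> S) :
  (map_mpoly phi f).@[y] =
  \sum_(m <- msupp f) phi f@_m * \prod_(i < N) y i ^+ m i.
Proof.
rewrite raddf_sum /=; apply: eq_bigr => m _.
rewrite mevalM mevalC /mmap1 rmorph_prod; congr (_ * _); apply: eq_bigr => i _.
by rewrite rmorphXn /= mevalXU.
Qed.

(** Over the field generated by the other roots, the values before and after the flip are
    [u + v l e] and [u - v l e]. As [l e] is not in that field, a zero value forces [u = v = 0]. *)
Lemma flip1_root (K : numFieldType) (P : K -> Prop) N (l : 'I_N -> K)
    (f : {mpoly rat[N]}) e :
  subfield P -> (forall e, P (l e ^+ 2)) ->
  (forall T : {set 'I_N}, T != set0 -> ~ P (\prod_(e in T) l e)) ->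
  (map_mpoly ratr f).@[l] = 0 -> (map_mpoly ratr f).@[flip1 e l] = 0.
Proof.
move=> HP l2 ind; pose s := [seq i <- enum 'I_N | i != e].
have S := adjoin_subfield HP l2 s.
have le : ~ adjoin P l s (l e).
  have := @adjoin_indep _ _ _ HP _ l2 ind s [set e]%SET.
  rewrite big_set1; apply; first by rewrite filter_uniq ?enum_uniq.
    by rewrite -card_gt0 cards1.
  by move=> x; rewrite inE mem_filter => /eqP ->; rewrite eqxx.
suff [u [v [Hu Hv -> ->]]] : exists u v, [/\ adjoin P l s u, adjoin P l s v,
    (map_mpoly ratr f).@[l] = u + v * l e & (map_mpoly ratr f).@[flip1 e l] = u - v * l e].
  have [->|v0 E] := eqVneq v 0; first by rewrite !mul0r addr0 subr0.
  case: le; have -> : l e = - u / v.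
    by apply: (mulfI v0); rewrite mulrCA mulfV // mulr1; apply/eqP; rewrite -addr_eq0 addrC E.
  by apply: (sfM S); [apply: (sfN S)|apply: (sfV S)].
rewrite !map_meval; elim: (msupp f) => [|m r [u [v [Hu Hv E1 E2]]]].
  by exists 0, 0; rewrite !big_nil; split; rewrite ?mul0r ?addr0 ?subr0 //; exact: sf0.
rewrite !big_cons E1 E2.
pose A := ratr f@_m * \prod_(i < N | i != e) l i ^+ m i.
have HA : adjoin P l s A.
  apply: (sfM S); first exact: (sf_ratr S).
  apply: (sf_prod S) => i ie; apply: (sfX S); apply: (adjoin_gen HP l2).
  by rewrite mem_filter ie mem_enum.
have -> : ratr f@_m * \prod_(i < N) l i ^+ m i = A * l e ^+ m e.
  by rewrite (bigD1 e) //= /A; ring.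
have -> : ratr f@_m * \prod_(i < N) flip1 e l i ^+ m i = A * (- l e) ^+ m e.
  rewrite (bigD1 e) //= /flip1 eqxx mulrCA mulrC; congr (_ * _ * _).
  by apply: eq_bigr => i /negbTE ->.
have H2 : adjoin P l s ((l e ^+ 2) ^+ (m e)./2) by apply: (sfX S); apply: adjoin_base.
have Em : l e ^+ m e = l e ^+ odd (m e) * (l e ^+ 2) ^+ (m e)./2.
  by rewrite -exprM -exprD mulnC muln2 odd_double_half.
case: (boolP (odd (m e))) => om.
  exists u, (v + A * (l e ^+ 2) ^+ (m e)./2); split=> //.
  - by apply: (sfD S) => //; exact: (sfM S).
  - by rewrite Em om expr1; ring.
  - by rewrite exprNn -signr_odd om Em om !expr1; ring.
exists (u + A * (l e ^+ 2) ^+ (m e)./2), v; split=> //.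
- by apply: (sfD S) => //; exact: (sfM S).
- by rewrite Em (negbTE om) expr0; ring.
- by rewrite exprNn -signr_odd (negbTE om) Em (negbTE om) !expr0; ring.
Qed.

(** Descent on the order of vanishing at 0, which is odd on one side and even on the other. *)
Lemma square_not_Xsquare (K : fieldType) (a b h : {poly K}) :
  h.[0] != 0 -> b ^+ 2 * ('X * h) = a ^+ 2 -> b = 0.
Proof.
move=> h0; have [k] := ubnP (size b); elim: k a b => // k IH a b szb E.
have factor (p : {poly K}) : p.[0] = 0 -> exists q, p = 'X * q.
  move/eqP; rewrite -/(root p 0) => /factor_theorem[q ->].
  by exists q; rewrite subr0 mulrC.
have [a1 Ea] : exists q, a = 'X * q.
  apply: factor; apply/eqP; rewrite -sqrf_eq0 -horner_exp -E.
  by rewrite !hornerM hornerX mul0r mulr0.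
have E1 : b ^+ 2 * h = 'X * a1 ^+ 2.
  apply: (mulfI (negbT (polyX_eq0 K))); rewrite Ea in E.
  by rewrite mulrCA E; ring.
have [b1 Eb] : exists q, b = 'X * q.
  apply: factor; apply/eqP.
  have : b.[0] ^+ 2 * h.[0] == 0 by rewrite -horner_exp -hornerM E1 hornerM hornerX mul0r.
  by rewrite mulf_eq0 (negbTE h0) orbF sqrf_eq0.
have [b0|b0] := eqVneq b1 0; first by rewrite Eb b0 mulr0.
rewrite Eb (IH a1 b1) ?mulr0 //.
  by move: szb; rewrite Eb mulrC size_mulX // ltnS.
by apply: (mulfI (negbT (polyX_eq0 K))); rewrite -E1 Eb; ring.
Qed.

Definition sqdist_mpoly n d (e : 'I_('C(n, 2))) : {mpoly rat[n * d]} :=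
  \sum_(a < d) ('X_(mxvec_index (edge e).1 a) - 'X_(mxvec_index (edge e).2 a)) ^+ 2.

Lemma sqdist_mpolyE (S : comNzRingType) (phi : {rmorphism rat -> S}) n d e
    (y : 'I_(n * d) -> S) :
  (map_mpoly phi (sqdist_mpoly d e)).@[y] =
  \sum_(a < d) (y (mxvec_index (edge e).1 a) - y (mxvec_index (edge e).2 a)) ^+ 2.
Proof.
rewrite /sqdist_mpoly (rmorph_sum (map_mpoly phi)) (rmorph_sum (meval y)).
apply: eq_bigr => a _; rewrite (rmorphXn (map_mpoly phi)) (rmorphXn (meval y)).
have X k : (map_mpoly phi 'X_k).@[y] = y k by rewrite map_mpolyX mevalXU.
rewrite (rmorphB (map_mpoly phi)) (rmorphB (meval y)).
by congr ((_ - _) ^+ 2); apply: X.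
Qed.

Lemma sqdist_mpoly_mxvec (S : comNzRingType) (phi : {rmorphism rat -> S}) n d e
    (q : 'M[S]_(n, d)) :
  (map_mpoly phi (sqdist_mpoly d e)).@[fun k => mxvec q 0 k] = sqdist q e 0.
Proof. by rewrite sqdist_mpolyE mxE; apply: eq_bigr => a _; rewrite !mxvecE. Qed.

(** * Multiplicative independence of the edge lengths of a generic configuration *)

Section Generic.
Variables (R : realType) (d n : nat) (p : 'M[R]_(n, d.+2)).
Hypothesis gp : generic_config p.
Local Notation C := R[i].
Local Notation N := 'C(n, 2).
Local Notation ev f := ((map_mpoly ratr f).@[fun k => mxvec p 0 k]).

Definition config_field (x : R) := exists a b : {mpoly rat[n * d.+2]},
  ev b != 0 /\ x = ev a / ev b.

Lemma ev_rmorph : exists phi : {rmorphism {mpoly rat[n * d.+2]} -> R},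
  forall f, phi f = ev f.
Proof.
pose v (k : 'I_(n * d.+2)) := mxvec p 0 k.
by exists (meval v \o map_mpoly ratr : {rmorphism {mpoly rat[n * d.+2]} -> R}).
Qed.

Lemma config_subfield : subfield config_field.
Proof.
have [phi E] := ev_rmorph; rewrite /config_field.
have frac x : (exists a b, phi b != 0 /\ x = phi a / phi b) -> config_field x.
  by move=> [a [b [b0 ->]]]; exists a, b; rewrite -!E.
have cf x : config_field x -> exists a b, phi b != 0 /\ x = phi a / phi b.
  by move=> [a [b [b0 ->]]]; exists a, b; rewrite !E.
split.
- by apply: frac; exists 1, 1; rewrite !rmorph1 oner_eq0 divr1.
- move=> x y /cf[a [b [b0 ->]]] /cf[a' [b' [b0' ->]]]; apply: frac.
  exists (a * b' - a' * b), (b * b'); rewrite !(rmorphM, rmorphB) mulf_neq0 //.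
  move: (phi a) (phi a') (phi b) (phi b') b0 b0' => u u' w w' w0 w0'.
  by split=> //; field; rewrite w0 w0'.
- move=> x y /cf[a [b [b0 ->]]] /cf[a' [b' [b0' ->]]]; apply: frac.
  exists (a * a'), (b * b'); rewrite !rmorphM mulf_neq0 //.
  move: (phi a) (phi a') (phi b) (phi b') b0 b0' => u u' w w' w0 w0'.
  by split=> //; field; rewrite w0 w0'.
- move=> x /cf[a [b [b0 ->]]]; apply: frac; have [a0|a0] := eqVneq (phi a) 0.
    by exists 0, 1; rewrite rmorph0 rmorph1 oner_eq0 a0 !mul0r invr0.
  by exists b, a; rewrite invf_div.
Qed.

Lemma sqdist_in e : config_field (sqdist p e 0).
Proof.
exists (sqdist_mpoly d.+2 e), 1; rewrite !rmorph1 oner_eq0 divr1; split=> //.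
by rewrite sqdist_mpoly_mxvec.
Qed.

Lemma generic_coord i j : i != j -> p i 0 - p j 0 != 0.
Proof.
move=> ij; apply/eqP => E.
have : ('X_(mxvec_index i 0) - 'X_(mxvec_index j 0) : {mpoly rat[n * d.+2]}) = 0.
  by apply: gp; rewrite !rmorphB /= !map_mpolyX !mevalXU !mxvecE.
move=> /(congr1 (fun f : {mpoly rat[n * d.+2]} => f@_U_(mxvec_index i 0))).
rewrite mcoeffB !mcoeffXU mcoeff0 eqxx.
have /negbTE -> : mxvec_index j 0 != mxvec_index i 0 :> 'I_(n * d.+2).
  apply/eqP => /cast_ord_inj/enum_rank_inj [] /eqP.
  by rewrite eq_sym (negbTE ij).
by move/eqP; rewrite subr0 oner_eq0.
Qed.

(* The edge [(i, j)] is the only one of length zero.  On the line joining     *)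
(* this configuration to another one, its squared length has a simple root,   *)
(* so that no product of squared lengths involving it is a square.            *)
Definition isotropic (i j : 'I_n) : 'M[C]_(n, d.+2) := \matrix_(k, a)
  if k == i then 0 else
  if k == j then (if a == 0 :> nat then 1 else if a == 1 :> nat then 'i else 0)
  else if a == 0 :> nat then (k + 3)%:R else 0.

Lemma isotropic_sqdist i j (u v : 'I_n) : i != j -> u != v ->
  (\sum_a (isotropic i j u a - isotropic i j v a) ^+ 2 == 0) =
  ((u == i) && (v == j)) || ((u == j) && (v == i)).
Proof.
move=> ij uv; rewrite !big_ord_recl big1 => [|a _]; last first.
  by rewrite !mxE /=; do !case: ifP => //; rewrite subrr expr0n.
rewrite !mxE /= addr0.
have i2 : 'i ^+ 2 = -1 :> C := sqrCi _.
(* The squared distance from [j] to a further point [k] is [(k + 2)^2 - 1], which factors as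
   [(k + 1) (k + 3)]; the offset 3 in [isotropic] keeps it nonzero. *)
have far (m : nat) : ((m + 2)%:R ^+ 2 - 1 == 0 :> C) = false.
  have -> : (m + 2)%:R ^+ 2 - 1 = ((m + 1) * (m + 3))%:R :> C by rewrite natrM !natrD; ring.
  by rewrite pnatr_eq0 muln_eq0 !addn_eq0 !andbF.
have [ui|ui] := eqVneq u i; have [vi|vi] := eqVneq v i.
- by rewrite ui vi eqxx in uv.
- rewrite ui (negbTE ij) /= orbF; have [vj|vj] := eqVneq v j.
    by rewrite !sub0r !sqrrN i2 expr1n subrr eqxx.
  by rewrite subrr expr0n addr0 sub0r sqrrN expf_eq0 /= pnatr_eq0 addn_eq0 andbF.
- rewrite vi [i == j](negbTE ij) andbT /=; have [uj|uj] := eqVneq u j.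
    by rewrite !subr0 i2 expr1n subrr eqxx.
  by rewrite !subr0 expr0n addr0 expf_eq0 /= pnatr_eq0 addn_eq0 andbF.
have [uj|uj] := eqVneq u j; have [vj|vj] := eqVneq v j.
- by rewrite uj vj eqxx in uv.
- rewrite /= subr0 i2 -(far v); congr (_ == 0); rewrite !natrD; ring.
- rewrite /= sub0r sqrrN i2 -(far u); congr (_ == 0); rewrite !natrD; ring.
rewrite subrr expr0n addr0 sqrf_eq0 subr_eq0 eqr_nat eqn_add2r andbF.
by apply/negbTE; apply: contraNneq uv => /val_inj ->.
Qed.

Lemma sqdist_prod_not_square (T : {set 'I_N}) (a b : {mpoly rat[n * d.+2]}) :
  T != set0 -> ev b != 0 -> b ^+ 2 * \prod_(e in T) sqdist_mpoly d.+2 e != a ^+ 2.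
Proof.
move=> /set0Pn[e0 e0T] b0; apply/eqP => Eab.
pose i := (edge e0).1; pose j := (edge e0).2.
have ij : i != j by rewrite neq_ltn edge_lt.
pose q0 := isotropic i j; pose pc := mx_to_complex p.
pose line k : {poly C} := (mxvec q0 0 k)%:P + (mxvec (pc - q0) 0 k)%:P * 'X.
pose phi : {rmorphism rat -> {poly C}} := (polyC \o ratr : rat -> {poly C}).
pose on_line f := (map_mpoly phi f).@[line].
have on_lineE f t : (on_line f).[t] = (map_mpoly ratr f).@[fun k => mxvec (q0 + t *: (pc - q0)) 0 k].
  rewrite /on_line !map_meval horner_sum; apply: eq_bigr => m _.
  rewrite hornerM hornerC horner_prod; congr (_ * _); apply: eq_bigr => k _.
  rewrite horner_exp; congr (_ ^+ _); case/mxvec_indexP: k => u v.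
  rewrite /line !mxvecE !hornerE ![(_ + _ : 'M__) _ _]mxE ![(_ *: _ : 'M__) _ _]mxE.
  by rewrite ![(_ + _ : 'M__) _ _]mxE mulrC.
have [psi psiE] : exists psi : {rmorphism {mpoly rat[n * d.+2]} -> {poly C}},
    forall g, psi g = on_line g.
  by exists (meval line \o map_mpoly phi : {rmorphism {mpoly rat[n * d.+2]} -> {poly C}}).
have Eline : on_line b ^+ 2 * \prod_(e in T) on_line (sqdist_mpoly d.+2 e) = on_line a ^+ 2.
  rewrite -(eq_bigr _ (fun e _ => psiE (sqdist_mpoly d.+2 e))) -!psiE.
  by rewrite -rmorph_prod -!rmorphXn -rmorphM Eab.
have bline : on_line b != 0.
  apply/eqP => E; case/eqP: b0; apply: (@complexI R); rewrite rmorph0.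
  have := on_lineE b 1; rewrite E horner0 scale1r addrC subrK => ->.
  rewrite !map_meval rmorph_sum; apply: eq_bigr => m _ /=.
  rewrite rmorphM rmorph_prod /= fmorph_rat; congr (_ * _).
  by apply: eq_bigr => k _; rewrite rmorphXn /= /pc /mx_to_complex -map_mxvec mxE.
pose D0 e a := q0 (edge e).1 a - q0 (edge e).2 a.
pose Dp a := pc i a - pc j a.
have lineE e : on_line (sqdist_mpoly d.+2 e) = \sum_a
    ((D0 e a)%:P + (pc (edge e).1 a - pc (edge e).2 a - D0 e a)%:P * 'X) ^+ 2.
  rewrite /on_line sqdist_mpolyE; apply: eq_bigr => a' _; rewrite /line !mxvecE.
  rewrite ![(_ + _ : 'M__) _ _]mxE ![(- _ : 'M__) _ _]mxE /D0 !polyCB; ring.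
have at0 e : e != e0 -> (on_line (sqdist_mpoly d.+2 e)).[0] != 0.
  move=> ee0; rewrite lineE horner_sum.
  have -> : \sum_a (((D0 e a)%:P + (pc (edge e).1 a - pc (edge e).2 a - D0 e a)%:P * 'X) ^+ 2).[0]
     = \sum_a (q0 (edge e).1 a - q0 (edge e).2 a) ^+ 2.
    by apply: eq_bigr => a' _; rewrite horner_exp !hornerE.
  rewrite isotropic_sqdist //; last by rewrite neq_ltn edge_lt.
  apply: contra ee0 => H; apply/eqP; apply: (@edge_inc_inj _ i j) => //; rewrite /inc.
  - by case/orP: H => /andP[/eqP -> /eqP ->]; rewrite eqxx ?orbT.
  - by case/orP: H => /andP[/eqP -> /eqP ->]; rewrite eqxx ?orbT.
  - by rewrite eqxx.
  - by rewrite eqxx orbT.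
have S0 : \sum_a D0 e0 a ^+ 2 = 0.
  by apply/eqP; rewrite isotropic_sqdist // !eqxx.
pose H : {poly C} := \sum_a ((2 * D0 e0 a * (Dp a - D0 e0 a))%:P + ((Dp a - D0 e0 a) ^+ 2)%:P * 'X).
have EH : on_line (sqdist_mpoly d.+2 e0) = 'X * H.
  rewrite lineE /H mulr_sumr; apply/eqP; rewrite -subr_eq0 -sumrB.
  rewrite (eq_bigr (fun a => (D0 e0 a ^+ 2)%:P)) => [|a' _].
    by rewrite -rmorph_sum /= S0.
  by rewrite /Dp; ring.
(* Up to sign and a factor 2 the derivative at the root is [x + 'i y] with [x], [y] real coordinate
   differences. Multiplying by the conjugate gives [x^2 + y^2], which is nonzero since [x] is. *)
have H0 : H.[0] != 0.
  have -> : H.[0] = 2 * (\sum_a D0 e0 a * Dp a - \sum_a D0 e0 a ^+ 2).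
    rewrite /H horner_sum -sumrB mulr_sumr; apply: eq_bigr => a' _.
    by rewrite !hornerE; ring.
  rewrite S0 subr0 mulf_neq0 ?pnatr_eq0 // !big_ord_recl big1 => [|a' _]; last first.
    by rewrite /D0 !mxE /= eqxx eq_sym (negbTE ij) eqxx /= subrr mul0r.
  rewrite /D0 !mxE /= !eqxx [_ == i]eq_sym (negbTE ij) /= !sub0r addr0.
  set x := p i 0 - p j 0; set y := p i (lift ord0 ord0) - p j (lift ord0 ord0).
  have -> : Dp ord0 = real_complex R x by rewrite /Dp /pc !mxE -rmorphB.
  have -> : Dp (lift ord0 ord0) = real_complex R y by rewrite /Dp /pc !mxE -rmorphB.
  have i2 : 'i ^+ 2 = -1 :> C := sqrCi _.
  apply/eqP => E; case/eqP: (generic_coord ij); rewrite -/x.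
  have : real_complex R (x ^+ 2 + y ^+ 2) = 0.
    transitivity (- (- 1 * real_complex R x + - 'i * real_complex R y) *
      (real_complex R x - 'i * real_complex R y) + ('i ^+ 2 + 1) * real_complex R y ^+ 2).
      by rewrite rmorphD !rmorphXn /=; ring.
    by rewrite E i2 oppr0 mul0r add0r addNr mul0r.
  move=> /(@complexI R _ 0)/eqP; rewrite paddr_eq0 ?sqr_ge0 // !sqrf_eq0.
  by case/andP => /eqP.
have key (bt at_ : {poly C}) mt : bt ^+ 2 * \prod_(e in T) mt e = at_ ^+ 2 ->
    (forall e, e != e0 -> (mt e).[0] != 0) -> mt e0 = 'X * H -> bt = 0.
  move=> E mt0 mtH.
  apply: (@square_not_Xsquare _ at_ _ (H * \prod_(e in T | e != e0) mt e)).
    by rewrite hornerM mulf_neq0 // horner_prod; apply/prodf_neq0 => e /andP[_]; apply: mt0.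
  rewrite -E [X in _ = _ * X](bigD1 e0) //= mtH; congr (_ * _); exact: mulrA.
case/eqP: bline; exact: (key _ _ (fun e => on_line (sqdist_mpoly d.+2 e)) Eline at0 EH).
Qed.

(** An equality with a quotient [a / b] would square to a polynomial identity by genericity, which
    [sqdist_prod_not_square] excludes. *)
Lemma sqrt_indep (T : {set 'I_N}) (l : 'I_N -> R) :
  (forall e, l e ^+ 2 = sqdist p e 0) -> T != set0 ->
  ~ config_field (\prod_(e in T) l e).
Proof.
move=> l2 T0 [a [b [b0 E]]].
have /eqP[] := sqdist_prod_not_square a T0 b0.
apply/eqP; rewrite -subr_eq0; apply/eqP; apply: gp.
have [phi phiE] := ev_rmorph.
rewrite -phiE rmorphB rmorphM !rmorphXn rmorph_prod.
rewrite (eq_bigr (fun e => l e ^+ 2)) => [|e _].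
  rewrite prodrXl E; rewrite -!phiE in b0 *.
  by move: (phi a) (phi b) b0 => x y y0; field.
by rewrite phiE l2 -(sqdist_mpoly_mxvec (ratr : {rmorphism rat -> R})).
Qed.

Lemma generic_flip (f : {mpoly rat[N]}) (l : 'I_N -> R) e :
  (forall e, l e ^+ 2 = sqdist p e 0) ->
  (map_mpoly ratr f).@[l] = 0 -> (map_mpoly ratr f).@[flip1 e l] = 0.
Proof.
move=> l2; apply: (@flip1_root _ config_field); first exact: config_subfield.
  by move=> e'; rewrite l2; apply: sqdist_in.
by move=> T T0; apply: sqrt_indep.
Qed.

End Generic.

(** * Evenness of the pulled back determinant *)

(** Orthogonality of the characters of the group of sign changes: weighting by the character of [T]
    and summing over [A] isolates [c T]. *)
Lemma sign_characters (K : numFieldType) (I : finType) (c : {set I} -> K) :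
  (forall A : {set I}, \sum_(S : {set I}) (\prod_(i in A) (-1) ^+ (i \in S)) * c S = 0) ->
  forall S, c S = 0.
Proof.
move=> H T.
have : \sum_(A : {set I}) (\prod_(i in A) (-1) ^+ (i \in T)) *
   \sum_(S : {set I}) (\prod_(i in A) (-1) ^+ (i \in S)) * c S = 0 :> K.
  by rewrite big1 // => A _; rewrite H mulr0.
have -> : \sum_(A : {set I}) (\prod_(i in A) (-1) ^+ (i \in T)) *
   \sum_(S : {set I}) (\prod_(i in A) (-1) ^+ (i \in S)) * c S =
   \sum_(S : {set I}) c S * \prod_i (1 + (-1) ^+ (i \in T) * (-1) ^+ (i \in S)).
  under eq_bigr do rewrite mulr_sumr.
  rewrite exchange_big /=; apply: eq_bigr => S _.
  under [in RHS]eq_bigr do rewrite addrC.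
  rewrite bigA_distr mulr_sumr; apply: eq_bigr => A _.
  rewrite mulrA mulrC -big_split /= [X in _ = _ * X](_ : _ = \prod_(i in A) ((-1) ^+ (i \in T) * (-1) ^+ (i \in S))) //.
  by rewrite (big_mkcond (mem A)).
rewrite (bigD1 T) //= [X in _ + X]big1 ?addr0 => [|S ST].
  move/eqP; rewrite mulf_eq0 => /orP[/eqP //|].
  rewrite prodf_seq_eq0 => /hasP[i _].
  by rewrite -signr_addb addbb expr0 /= -mulr2n pnatr_eq0.
suff [i Hi] : exists i, (i \in S) != (i \in T).
  rewrite (bigD1 i) //= -signr_addb.
  have -> : (i \in T) (+) (i \in S) by move: Hi; case: (i \in S); case: (i \in T).
  by rewrite expr1 subrr mul0r mulr0.
apply/existsP; rewrite -negb_forall; apply: contra ST => /forallP E.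
by apply/eqP/setP => i; apply/eqP.
Qed.

Section Parity.
Variables (K : numFieldType) (N : nat) (f : {mpoly rat[N]}).

Definition odd_part (m : 'X_{1..N}) : {set 'I_N} := [set i | odd (m i)].

(** The factor of the monomial of [S] in the grouping of [f] by parity of exponents, as a function
    of the squares of the variables. *)
Definition parity_coef (S : {set 'I_N}) (v : 'I_N -> K) : K :=
  \sum_(m <- msupp f | odd_part m == S) ratr f@_m * \prod_i v i ^+ (m i)./2.

Lemma parity_decomposition (y : 'I_N -> K) : (map_mpoly ratr f).@[y] =
  \sum_(S : {set 'I_N}) parity_coef S (fun i => y i ^+ 2) * \prod_(i in S) y i.
Proof.
rewrite map_meval (partition_big odd_part predT) //=; apply: eq_bigr => S _.
rewrite mulr_suml; apply: eq_bigr => m /eqP <-.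
rewrite -[RHS]mulrA; congr (ratr _ * _); rewrite [X in _ * X]big_mkcond -big_split /=.
apply: eq_bigr => i _; rewrite inE -exprM mul2n -{1}[m i]odd_double_half exprD mulrC.
by case: (odd _); rewrite ?expr1 ?expr0.
Qed.

Lemma parity_vanish (y : 'I_N -> K) :
  (forall s : 'I_N -> bool, (map_mpoly ratr f).@[fun i => (-1) ^+ s i * y i] = 0) ->
  forall S : {set 'I_N}, (\prod_(i in S) y i) * parity_coef S (fun i => y i ^+ 2) = 0.
Proof.
move=> H; apply: sign_characters => A.
apply: etrans (H (fun i => i \in A)); rewrite parity_decomposition.
apply: eq_bigr => S _; rewrite mulrA mulrC; congr (_ * _).
  rewrite /parity_coef; apply: eq_bigr => m _; congr (ratr _ * _); apply: eq_bigr => i _.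
  by rewrite [(_ * y i) ^+ 2]exprMn sqrr_sign mul1r.
rewrite [in RHS]big_split /=; congr (_ * _).
rewrite [LHS]big_mkcond [RHS]big_mkcond /=; apply: eq_bigr => i _.
by case: (i \in A); case: (i \in S); rewrite ?expr0 ?expr1.
Qed.

Lemma deg_lt_parity_coef S D :
  (forall m, m \in msupp f -> odd_part m == S -> (\sum_i (m i)./2 <= D)%N) ->
  deg_lt D.+1 (fun v : 'cV[K]_N => parity_coef S (fun i => v i 0)).
Proof.
move=> H; rewrite /parity_coef.
apply: (@deg_lt_ext _ _ _ (fun v : 'cV[K]_N => \sum_(m <- msupp f | (m \in msupp f) && (odd_part m == S))
   ratr f@_m * \prod_i v i 0 ^+ (m i)./2)) => [v|].
  by rewrite [RHS]big_seq_cond.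
apply: deg_lt_sum => m /andP[mf mS].
apply: (@deg_lt_leq _ _ (\sum_i (m i)./2).+1); first exact: H.
apply: (@deg_ltM _ _ 0 (\sum_i (m i)./2)); first exact: deg_lt_cst.
apply: deg_lt_prod => i; apply: deg_ltX => a.
apply: (@deg_lt_ext _ _ 1 (fun _ => a i 0)); last exact: deg_lt_cst.
by move=> v; rewrite /fdiff !mxE; ring.
Qed.

End Parity.

Section Distances.
Variables (C : numClosedFieldType) (n : nat).
Local Notation N := 'C(n, 2).

Definition line_config (x : 'I_n -> C) : 'cV[C]_N :=
  \col_e (x (edge e).1 - x (edge e).2) ^+ 2.

Definition collinear (v : 'cV[C]_N) := exists x, v = line_config x.

Lemma collinear0 : collinear 0.
Proof. by exists (fun _ => 0); apply/matrixP => e j; rewrite !mxE subrr expr0n. Qed.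

Lemma collinear_sum d v : sum_of collinear d v -> exists q : 'M[C]_(n, d), v = sqdist q.
Proof.
move=> [x [/fin_all_exists[xi Hx] ->]]; exists (\matrix_(i, a) xi a i).
apply/matrixP => e j; rewrite summxE !mxE; apply: eq_bigr => a _.
by rewrite Hx !mxE.
Qed.

(** A multiple [c] of a coordinate vector, for the edge [i j], is a sum of three collinear vectors.
    With [b^2 = c / 2], move [i] alone by [b], then [j] alone by [b], then both by ['i b]: the
    contributions to the edges leaving [i] or [j] cancel. *)
Lemma collinear_gen (W : zmodType) (f : 'cV[C]_N -> W) :
  (forall v x, collinear x -> f (v + x) = f v) -> forall v, f v = f 0.
Proof.
move=> H.
have He c e v : f (v + c *: delta_mx e 0) = f v.
  pose i := (edge e).1; pose j := (edge e).2.
  have ij : i != j by rewrite neq_ltn edge_lt.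
  pose b := sqrtC (c / 2); pose b' := 'i * b.
  have b2 : b ^+ 2 = c / 2 by rewrite sqrtCK.
  have b'2 : b' ^+ 2 = - (c / 2) by rewrite exprMn b2 sqrCi mulN1r.
  have z2 : 0 ^+ 2 = 0 :> C by rewrite expr0n.
  pose x1 k := if k == i then b else 0.
  pose x2 k := if k == j then b else 0.
  pose x3 k := if (k == i) || (k == j) then b' else 0.
  have -> : c *: delta_mx e 0 = line_config x1 + line_config x2 + line_config x3.
    apply/matrixP => e' z; rewrite ord1 !mxE eqxx andbT /x1 /x2 /x3.
    have ed : (e' == e) = (((edge e').1 == i) && ((edge e').2 == j)).
      apply/eqP/andP => [->|[/eqP E1 /eqP E2]]; first by rewrite !eqxx.
      by apply: edge_inj; rewrite [LHS]surjective_pairing E1 E2 -surjective_pairing.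
    have lt' := edge_lt e'; have lt := edge_lt e; rewrite -/i -/j in lt.
    rewrite ed; have [E1|E1] := eqVneq (edge e').1 i; have [E2|E2] := eqVneq (edge e').2 j.
    - have [E3|_] := eqVneq (edge e').1 j; first by move: ij; rewrite -E1 -E3 eqxx.
      have [E4|_] := eqVneq (edge e').2 i; first by move: ij; rewrite -E2 -E4 eqxx.
      by rewrite /= subrr subr0 sub0r sqrrN b2 z2 addr0 mulr1; field.
    - have [E4|_] := eqVneq (edge e').2 i; first by move: lt'; rewrite E1 E4 ltnn.
      have [E3|_] := eqVneq (edge e').1 j; first by move: ij; rewrite -E1 -E3 eqxx.
      by rewrite /= !subr0 z2 b2 b'2 mulr0; ring.
    - have [E3|_] := eqVneq (edge e').1 j; first by move: lt'; rewrite E2 E3 ltnn.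
      have [E4|_] := eqVneq (edge e').2 i; first by move: ij; rewrite -E2 -E4 eqxx.
      by rewrite /= !sub0r !sqrrN z2 b2 b'2 mulr0; ring.
    rewrite /= mulr0; have [E3|E3] := eqVneq (edge e').1 j; have [E4|E4] := eqVneq (edge e').2 i.
    - by move: lt'; rewrite E3 E4 => /(ltn_trans lt); rewrite ltnn.
    - by rewrite !subr0 z2 b2 b'2; ring.
    - by rewrite !sub0r !sqrrN z2 b2 b'2; ring.
    - by rewrite !subr0 z2 !addr0.
  by rewrite !addrA (H _ _ (ex_intro _ x3 erefl)) (H _ _ (ex_intro _ x2 erefl))
     (H _ _ (ex_intro _ x1 erefl)).
move=> v.
have -> : v = \sum_e v e 0 *: delta_mx e 0.
  by rewrite {1}[v]matrix_sum_delta; apply: eq_bigr => e _; rewrite big_ord1.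
elim/big_rec: _ => // e w _ IH; by rewrite addrC He.
Qed.

End Distances.

Definition pullback k N (V : 'I_N -> 'I_k -> 'I_k -> rat) : {mpoly rat[N]} :=
  cm (sqr2 (fun i j => \sum_e V e i j *: 'X_e)).

Lemma pullback_eval k N (V : 'I_N -> 'I_k -> 'I_k -> rat) (S : comNzRingType)
    (phi : {rmorphism rat -> S}) (y : 'I_N -> S) :
  (map_mpoly phi (pullback V)).@[y] =
  cm (sqr2 (fun i j => \sum_e phi (V e i j) * y e)).
Proof.
rewrite /pullback (cm_rmorph (map_mpoly phi)) (cm_rmorph (meval y)).
apply: cm_ext => i j; rewrite /sqr2 (rmorphXn (map_mpoly phi)) (rmorphXn (meval y)).
congr (_ ^+ 2); rewrite (rmorph_sum (map_mpoly phi)) (rmorph_sum (meval y)).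
apply: eq_bigr => e _.
have E : (map_mpoly phi (V e i j *: 'X_e)).@[y] = phi (V e i j) * y e.
  by rewrite map_mpolyZ map_mpolyX mevalZ mevalXU.
exact: E.
Qed.

Lemma homog_prod_sum N (R : comNzRingType) (I : Type) (r : seq I) (G : I -> {mpoly R[N]}) e :
  (forall i, G i \is (e i).-homog) -> \prod_(i <- r) G i \is (\sum_(i <- r) e i).-homog.
Proof.
move=> H; elim: r => [|i r IH]; first by rewrite !big_nil dhomog1.
by rewrite !big_cons; apply: dhomogM.
Qed.

(** A nonzero term of the determinant uses the border row and the border column in two different
    entries equal to 1, which leaves [k] entries of degree two. *)
Lemma pullback_homog k N (V : 'I_N -> 'I_k.+1 -> 'I_k.+1 -> rat) :
  pullback V \is (2 * k).-homog.
Proof.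
pose lin i j : {mpoly rat[N]} := \sum_e V e i j *: 'X_e.
have lin_h i j : lin i j \is 1.-homog.
  by apply: rpred_sum => e _; apply: dhomogZ; rewrite dhomogX; apply/eqP; exact: mdeg1.
rewrite /pullback /cm; apply: rpred_sum => s _.
set M := bordered _.
suff H : \prod_i M i (s i) \is (2 * k).-homog.
  by case: (odd_perm s); rewrite ?expr1 ?expr0 ?mulN1r ?mul1r ?dhomogN.
pose b : 'I_(k.+1 + 1) := rshift k.+1 0.
have ME i j : M i j = match split i, split j with
    inl u, inl v => lin u v ^+ 2 | inr _, inr _ => 0 | _, _ => 1 end by exact: borderedE.
have splitb i : split i = inr 0 :> 'I_k.+1 + 'I_1 -> i = b.
  by move=> E; rewrite -(splitK i) E.
have [sb|sb] := eqVneq (s b) b.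
  by rewrite (bigD1 b) //= sb ME split_rshift mul0r dhomog0.
pose e i := if (i == b) || (s i == b) then 0%N else 2.
have -> : (2 * k)%N = (\sum_i e i)%N.
  pose b' := (s^-1)%g b; have sb' : s b' = b by rewrite permKV.
  have bb' : b' != b by apply: contraNneq sb => E; rewrite -{1}E sb'.
  rewrite (bigD1 b) //= {1}/e eqxx add0n (bigD1 b') //= {1}/e sb' eqxx orbT add0n.
  rewrite (eq_bigr (fun _ => 2)) => [|i /andP[ib ib']]; last first.
    by rewrite /e (negbTE ib) -sb' (inj_eq perm_inj) (negbTE ib').
  rewrite sum_nat_const mulnC; congr (_ * _)%N.
  rewrite (_ : #|_| = #|~: [set b; b']%SET|); last first.
    by apply: eq_card => i; rewrite !inE negb_or.
  have := cardsC [set b; b']%SET; rewrite cards2 eq_sym bb' card_ord /=.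
  by move: #|_| => c; lia.
apply: homog_prod_sum => i; rewrite ME /e.
case Ei: (split i) => [u|u].
  have /negbTE -> : i != b by apply/eqP => E; move: Ei; rewrite E split_rshift.
  case Es: (split (s i)) => [v|v].
    have /negbTE -> : s i != b by apply/eqP => E; move: Es; rewrite E split_rshift.
    exact: (dhomogMn 2 (lin_h u v)).
  have -> : s i = b by apply: splitb; rewrite Es ord1.
  by rewrite eqxx orbT dhomog1.
have -> : i = b by apply: splitb; rewrite Ei ord1.
rewrite eqxx /=; case: split => _; first exact: dhomog1.
exact: dhomog0.
Qed.

Section Even.
Variables (C : numClosedFieldType) (d n : nat).
Local Notation N := 'C(n, 2).
Variable V : 'I_N -> 'I_d.+4 -> 'I_d.+4 -> rat.
Local Notation f := (pullback V).
Hypothesis f0 : forall (S : {set 'I_N}) (q : 'M[C]_(n, d.+2)),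
  parity_coef f S (fun e => sqdist q e 0) = 0.

Lemma half_degree m : m \in msupp f -> (2 * \sum_i (m i)./2 + #|odd_part m| = 2 * d.+3)%N.
Proof.
move=> mf; have : mdeg m = (2 * d.+3)%N := dhomog_mf (pullback_homog V) mf.
rewrite mdegE => <-; rewrite big_distrr /=.
rewrite -sum1_card [X in (_ + X)%N]big_mkcond -big_split /=; apply: eq_bigr => i _.
by rewrite inE mul2n -{3}[m i]odd_double_half addnC; case: odd.
Qed.

(** For nonempty [S] the degree in the squares is at most the dimension [d.+2], the number of
    collinear summands in a squared distance vector, so [deg_lt_vanish] applies. *)
Lemma parity_coef_vanish (S : {set 'I_N}) (v : 'I_N -> C) : S != set0 -> parity_coef f S v = 0.
Proof.
move=> S0; pose g (u : 'cV[C]_N) := parity_coef f S (fun i => u i 0).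
have -> : parity_coef f S v = g (\col_i v i).
  by apply: eq_bigr => m _; congr (_ * _); apply: eq_bigr => i _; rewrite mxE.
apply: (@deg_lt_vanish _ _ (@collinear C n) (@collinear0 C n) _ d.+2).
- exact: collinear_gen.
- apply: deg_lt_parity_coef => m /half_degree H /eqP mS.
  by have : (0 < #|S|)%N; [rewrite card_gt0|move: H; rewrite mS; lia].
- by move=> u /collinear_sum[q ->]; apply: f0.
Qed.

Lemma pullback_even_part (y : 'I_N -> C) :
  (map_mpoly ratr f).@[y] = parity_coef f set0 (fun i => y i ^+ 2).
Proof.
rewrite parity_decomposition (bigD1 set0) //= big_set0 mulr1 big1 ?addr0 // => S S0.
by rewrite parity_coef_vanish ?mul0r.
Qed.

Lemma pullback_flip (s : 'I_N -> bool) (y : 'I_N -> C) :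
  (map_mpoly ratr f).@[fun i => (-1) ^+ s i * y i] = (map_mpoly ratr f).@[y].
Proof.
rewrite !pullback_even_part; apply: eq_bigr => m _; congr (ratr _ * _).
by apply: eq_bigr => i _; rewrite [(_ * y i) ^+ 2]exprMn sqrr_sign mul1r.
Qed.

(* Lengthening all the edges at [x] by [m] is, up to signs, a translation of  *)
(* [x] away from the others, which changes the squared distances by those of  *)
(* a collinear configuration.                                                 *)
Lemma pullback_star (x : 'I_n) (s : 'I_N -> bool) (y : 'I_N -> C) :
  exists a b c : C, forall m : nat,
    (map_mpoly ratr f).@[fun e => y e + m%:R * signed_star x s e] =
    a + b *+ m + c *+ (m * m.-1).
Proof.
pose xi j : C := if j == x then 0 else \sum_(e | inc x e && inc j e) (-1) ^+ s e * y e.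
pose eta j : C := if j == x then 0 else 1.
pose g (u : 'cV[C]_N) := parity_coef f set0 (fun i => u i 0).
pose v : 'cV[C]_N := \col_e if inc x e then 0 else y e ^+ 2 - (xi (edge e).1 - xi (edge e).2) ^+ 2.
pose dl (z : 'I_n -> C) e := z (edge e).1 - z (edge e).2.
pose c : 'cV[C]_N := \col_e (2 * dl xi e * dl eta e + dl eta e ^+ 2).
(* The expansion of [(a + m b)^2] as [a^2 + m (2 a b + b^2) + m (m - 1) b^2], in the form expected
   by [quadratic_along]. *)
have line m : line_config xi + c *+ m + line_config eta *+ (m * m.-1) =
    line_config (fun j => xi j + eta j *+ m).
  apply/matrixP => e j; rewrite !mxE !mulmxnE ![(line_config _) _ _]mxE ![c _ _]mxE /dl.
  case: m => [|m]; first by rewrite /= !mulr0n !addr0.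
  have nz (z : C) : z *+ m.+1 = z * m%:R + z by rewrite mulrSr mulr_natr.
  have nz2 (z : C) : z *+ (m.+1 * m) = (z * m%:R + z) * m%:R.
    by rewrite mulrnA nz [RHS]mulr_natr.
  rewrite nz2 !nz.
  move: (xi _) (xi _) (eta _) (eta _) (m%:R : C) => x1 x2 y1 y2 t; ring.
have Q := @quadratic_along _ _ (@collinear C n) (@collinear0 C n) (@collinear_gen C n _)
  d.+1 g (line_config xi) c (line_config eta).
exists (g (v + line_config xi)), (g (v + line_config xi + c) - g (v + line_config xi)).
exists (g (v + line_config eta) - g v) => m.
rewrite pullback_even_part -Q; last first.
- by exists eta.
- by move=> m'; rewrite line; exists (fun j => xi j + eta j *+ m').
- by move=> u /collinear_sum[q ->]; apply: f0.
- apply: deg_lt_parity_coef => m' /half_degree H /eqP mS.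
  by move: H; rewrite mS cards0; lia.
have -> : v + line_config xi + c *+ m + line_config eta *+ (m * m.-1) =
    v + line_config (fun j => xi j + eta j *+ m) by rewrite -line !addrA.
apply: eq_bigr => m' _; congr (ratr _ * _); apply: eq_bigr => e _; congr (_ ^+ _).
have xiE j : inc x e -> inc j e -> j != x -> xi j = (-1) ^+ s e * y e.
  move=> xe je jx; rewrite /xi (negbTE jx) (bigD1 e) ?xe //= big1 ?addr0 // => e' /andP[/andP[xe' je'] ee'].
  by rewrite (edge_inc_inj _ xe je xe' je') ?eqxx // eq_sym in ee'.
have sgn z : (y e + z * (-1) ^+ s e) ^+ 2 = ((-1) ^+ s e * y e + z) ^+ 2.
  by case: (s e); rewrite ?expr0 ?expr1; ring.
rewrite !mxE /signed_star; case: ifP => xe; last first.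
  have [n1 n2] : (edge e).1 != x /\ (edge e).2 != x.
    by move: xe; rewrite /inc ![x == _]eq_sym => /negbT; rewrite negb_or => /andP.
  by rewrite /eta (negbTE n1) (negbTE n2); ring.
have lt12 : (edge e).1 != (edge e).2 by rewrite neq_ltn edge_lt.
have inc1 : inc (edge e).1 e by rewrite /inc eqxx.
have inc2 : inc (edge e).2 e by rewrite /inc eqxx orbT.
rewrite sgn add0r /eta; case/orP: (xe) => /eqP E.
  have n2 : (edge e).2 != x by rewrite E eq_sym.
  by rewrite -E eqxx (negbTE n2) (xiE _ xe inc2 n2) /xi eqxx mul0rn; ring.
have n1 : (edge e).1 != x by rewrite E.
by rewrite -E eqxx (negbTE n1) (xiE _ xe inc1 n1) /xi eqxx mul0rn; ring.
Qed.

End Even.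

(** * Congruence *)

Section Congruence.
Variables (R : rcfType) (m d : nat).

(** [U] is a product of Householder reflections, matching one row at a time. The reflection
    exchanging [x] and [y] fixes the rows already matched, since these have equal inner products
    with [x] and [y]. *)
Lemma gram_congruent (X Y : 'M[R]_(m, d)) : X *m X^T = Y *m Y^T ->
  exists2 U : 'M[R]_d, U *m U^T = 1%:M & X *m U = Y.
Proof.
move=> XY.
have dot k (A B : 'M[R]_(k, d)) i j : (A *m B^T) i j = \sum_a A i a * B j a.
  by rewrite mxE; apply: eq_bigr => a _; rewrite mxE.
suff H k : exists2 U : 'M[R]_d, U *m U^T = 1%:M &
    forall i : 'I_m, (i < k)%N -> row i (X *m U) = row i Y.
  have [U U1 HU] := H m; exists U => //.
  by apply/row_matrixP => i; apply: HU.
elim: k => [|k [U U1 HU]]; first by exists 1%:M => [|i //]; rewrite trmx1 mulmx1.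
have [km|mk] := ltnP k m; last first.
  by exists U => // i _; apply: HU; apply: leq_trans (ltn_ord i) mk.
pose i0 := Ordinal km; pose x := row i0 (X *m U); pose y := row i0 Y.
have XUY : (X *m U) *m (X *m U)^T = Y *m Y^T.
  by rewrite trmx_mul mulmxA -[X *m U *m U^T]mulmxA U1 mulmx1.
have [xy|xy] := eqVneq x y.
  exists U => // i; rewrite ltnS leq_eqVlt => /orP[/eqP ik|]; last exact: HU.
  by have -> : i = i0 by apply: val_inj.
pose a := x - y; pose q := (a *m a^T) 0 0.
have q0 : q != 0.
  rewrite /q dot psumr_neq0 => [|b _]; last by rewrite -expr2 sqr_ge0.
  apply/hasP; move: xy; rewrite -subr_eq0 -/a => /eqP a0.
  have [/existsP[b ab]|/existsPn N] := boolP [exists b, a 0 b != 0].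
    by exists b; rewrite ?mem_index_enum // -expr2 exprn_even_gt0.
  by case: a0; apply/rowP => b; rewrite [RHS]mxE; apply/eqP; rewrite -[_ == _]negbK (N b).
have aa : a *m a^T = q%:M by rewrite [LHS]mx11_scalar.
pose P := a^T *m a; pose c := 2 / q; pose H := 1%:M - c *: P.
have PT : P^T = P by rewrite /P trmx_mul trmxK.
have PP : P *m P = q *: P.
  by rewrite /P mulmxA -[_ *m a *m a^T]mulmxA aa mul_mx_scalar scalemxAl.
have HH : H *m H^T = 1%:M.
  have -> : H^T = H by rewrite /H linearB linearZ /= trmx1 PT.
  rewrite /H mulmxBl mul1mx mulmxBr mulmx1 -scalemxAl -scalemxAr PP.
  by apply/matrixP => u v; move: (P) => P'; rewrite !mxE /c; field.
have HV (z : 'rV[R]_d) : z *m H = z - (c * (z *m a^T) 0 0) *: a.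
  rewrite /H mulmxBr mulmx1 -scalemxAr /P mulmxA.
  by rewrite {1}[z *m a^T]mx11_scalar mul_scalar_mx scalerA.
have sub_dot (z : 'rV[R]_d) : (z *m a^T) 0 0 = (z *m x^T) 0 0 - (z *m y^T) 0 0.
  by rewrite /a linearB /= mulmxBr mxE [X in _ + X]mxE.
have rowdot (A B : 'M[R]_(m, d)) i j : (row i A *m (row j B)^T) 0 0 = (A *m B^T) i j.
  by rewrite !dot; apply: eq_bigr => b _; rewrite !mxE.
have sym (u v : 'rV[R]_d) : (u *m v^T) 0 0 = (v *m u^T) 0 0.
  by rewrite !dot; apply: eq_bigr => b _; rewrite mulrC.
have xx : (x *m x^T) 0 0 = (y *m y^T) 0 0 by rewrite !rowdot XUY.
have qE : q = 2 * ((x *m x^T) 0 0 - (x *m y^T) 0 0).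
  by rewrite /q sub_dot [(a *m x^T) 0 0]sym [(a *m y^T) 0 0]sym !sub_dot (sym y x) -xx; ring.
exists (U *m H) => [|i].
  by rewrite trmx_mul mulmxA -[U *m H *m H^T]mulmxA HH mulmx1.
rewrite ltnS leq_eqVlt mulmxA row_mul => /orP[/eqP ik|ik].
  have -> : i = i0 by apply: val_inj.
  rewrite -/x HV sub_dot.
  have -> : c * ((x *m x^T) 0 0 - (x *m y^T) 0 0) = 1.
    by apply: (mulfI q0); rewrite mulrA /c [q * _]mulrC divfK // mulr1 -qE.
  by rewrite scale1r /a opprB addrC subrK.
rewrite HU // HV sub_dot.
have -> : (row i Y *m x^T) 0 0 = (row i Y *m y^T) 0 0.
  by rewrite -{1}(HU i ik) !rowdot XUY.
by rewrite subrr mulr0 scale0r subr0.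
Qed.

End Congruence.

(** Polarization recovers the Gram matrices of the configurations, translated so that point 0 is the
    origin, from the squared distances. *)
Lemma similar_edge_lengths (R : realType) d m (p q : 'M[R]_(m.+1, d)) (c : R) : 0 < c ->
  edge_lengths q = c *: edge_lengths p -> similar_configs p q.
Proof.
move=> c0 E.
have sqE (r : 'M[R]_(m.+1, d)) e : sqdist r e 0 = edge_lengths r e 0 ^+ 2.
  by rewrite [edge_lengths r e 0]mxE sqr_sqrtr // mxE sumr_ge0 // => a _; rewrite sqr_ge0.
pose D (r : 'M[R]_(m.+1, d)) i j := \sum_a (r i a - r j a) ^+ 2.
have Dsym r i j : D r i j = D r j i.
  by apply: eq_bigr => a _; rewrite -sqrrN opprB.
have DE i j : D q i j = c ^+ 2 * D p i j.
  have [->|ij] := eqVneq i j.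
    by rewrite /D !big1 ?mulr0 // => a _; rewrite subrr expr0n.
  have [e /andP[ie je]] := edge_ex ij.
  have De r : D r i j = sqdist r e 0.
    rewrite mxE; case/orP: ie => /eqP Ei; case/orP: je => /eqP Ej; rewrite -?Ei -?Ej //.
    - by move: ij; rewrite Ei Ej eqxx.
    - by move: ij; rewrite Ei Ej eqxx.
  by rewrite !De !sqE E mxE exprMn.
pose X := \matrix_(i < m.+1, a < d) (c * (p i a - p ord0 a)).
pose Y := \matrix_(i < m.+1, a < d) (q i a - q ord0 a).
have [|U U1 XY] := @gram_congruent R _ _ X Y.
  apply/matrixP => i j; rewrite !mxE.
  have pol (r : 'M[R]_(m.+1, d)) : \sum_a (r i a - r ord0 a) * (r j a - r ord0 a) =
      (D r i ord0 + D r j ord0 - D r i j) / 2.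
    by rewrite /D -big_split -sumrB mulr_suml; apply: eq_bigr => a _ /=; field.
  under eq_bigr do rewrite !mxE; under [in RHS]eq_bigr do rewrite !mxE.
  rewrite pol !DE -!mulrDr -!mulrBr -mulrA -pol mulr_sumr.
  by apply: eq_bigr => a _; ring.
exists c, U, (row ord0 q - c *: (row ord0 p *m U)); split=> // i.
have -> : row i q = row i Y + row ord0 q by apply/rowP => a; rewrite !mxE subrK.
rewrite -XY row_mul.
have -> : row i X = c *: (row i p - row ord0 p) by apply/rowP => a; rewrite !mxE.
by rewrite -scalemxAl mulmxBl scalerBr addrAC -addrA.
Qed.

Lemma full_rank_indep (F : numFieldType) m (v : 'I_m -> F) : rational_rank v = m ->
  forall c : 'I_m -> rat, \sum_i ratr (c i) * v i = 0 -> forall i, c i = 0.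
Proof.
rewrite /rational_rank => rk.
have P0 : `[< lin_indep_rat v finset.set0 >].
  by apply/asboolP => c _ i; rewrite inE.
have [A /asboolP indA EA] : {A : {set 'I_m} | `[< lin_indep_rat v A >]
    & \max_(A : {set 'I_m} | `[< lin_indep_rat v A >]) #|A| = #|A|}.
  by apply: eq_bigmax_cond; apply/card_gt0P; exists finset.set0.
have AT : A = [set: 'I_m]%SET.
  by apply/eqP; rewrite eqEcard finset.subsetT cardsT card_ord -{1}rk EA leqnn.
move=> c Hc i; apply: (indA c); last by rewrite AT inE.
by rewrite AT; apply: etrans _ Hc; apply: eq_bigl => j; rewrite inE.
Qed.

(** * Canonical matrices *)

Section UnitRow.
Variable n : nat.

Lemma unit_rowE (S : nzRingType) (phi : {rmorphism rat -> S}) (i j : 'I_n) e :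
  phi (unit_row i j 0 e) = ((i != j) && inc i e && inc j e)%:R.
Proof.
rewrite mxE rmorph_nat; congr (_%:R); rewrite /inc.
have := edge_lt e; case: (edge e) => a b /=; rewrite !xpair_eqE => ab.
have ba : ((a == b) = false) * ((b == a) = false).
  by rewrite [b == a]eq_sym; split; apply/eqP => E; rewrite E ltnn in ab.
rewrite ![a == _]eq_sym ![b == _]eq_sym.
have [->|ia] := eqVneq i a; have [->|ja] := eqVneq j a; rewrite ?eqxx ?ba //=.
- by rewrite orbF.
- by rewrite (negbTE ia) /= ?andbT.
have [//|ij] := eqVneq i j; have [ib|//] := eqVneq i b.
by rewrite -ib eq_sym (negbTE ij).
Qed.

Lemma unit_row_sym (i j : 'I_n) : unit_row i j = unit_row j i.
Proof. by apply/rowP => e; rewrite !mxE orbC. Qed.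

Lemma unit_row_diag (i : 'I_n) : unit_row i i = 0.
Proof. by apply/rowP => e; have := unit_rowE idfun i i e => /= ->; rewrite eqxx mxE. Qed.

Lemma unit_row_edge (i j : 'I_n) : i != j -> exists2 e, inc i e && inc j e &
  forall e', unit_row i j 0 e' = (e' == e)%:R.
Proof.
move=> ij; have [e /andP[ie je]] := edge_ex ij; exists e; first by rewrite ie.
move=> e'; have := unit_rowE idfun i j e' => /= ->; rewrite ij /=; congr (_%:R).
have [->|ee'] := eqVneq e' e; first by rewrite ie je.
congr nat_of_bool; apply/negbTE/negP => /andP[ie' je']; move/eqP: ee'; apply.
exact: (edge_inc_inj ij ie' je' ie je).
Qed.

End UnitRow.

Lemma mem_rows m n (A : 'M[rat]_(m, n)) v : v \in rows A -> exists r, row r A = v.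
Proof. by case/mapP => r _ ->; exists r. Qed.

Section CanonicalRows.
Variables (d : nat) (N : 'M[rat]_('C(d.+2, 2))).
Hypothesis hN : is_N1 N \/ is_N2 N.

Lemma ping_row (j : 'I_d.+2) : j != ord0 ->
  exists r a, 0 < a /\ row r N = a *: unit_row ord0 j.
Proof.
move=> j0; have j0' : (0 < j)%N by rewrite lt0n; apply: contraNneq j0 => E; apply/eqP/val_inj.
case: hN => [[/perm_mem pN _]|[/perm_mem p1 /perm_mem p2]].
  have [|r Hr] := @mem_rows _ _ N (ping ord0 j).
    rewrite pN mem_cat; apply/orP; left; apply/mapP; exists j => //.
    by rewrite mem_filter j0' mem_enum.
  by exists r, 2.
have [jm|jm] := eqVneq j ord_max.
  have [|r Hr] := @mem_rows _ _ N (ping ord0 j).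
    by apply: (@mem_drop 'C(d.+1, 2)); rewrite p2 jm inE eqxx.
  by exists r, 2.
have [|r Hr] := @mem_rows _ _ N (unit_row ord0 j).
  apply: (@mem_take 'C(d.+1, 2)); rewrite p1; apply/mapP; exists (ord0, j) => //.
  rewrite mem_filter mem_enum !inE /= j0' andbT ltn_neqAle -ltnS ltn_ord andbT.
  by apply: contraNneq jm => E; apply/eqP/val_inj.
by exists r, 1; rewrite scale1r.
Qed.

Lemma triangle_row (i j : 'I_d.+2) : i != ord0 -> j != ord0 -> i != j ->
  exists r, row r N = unit_row i j \/
            row r N = unit_row ord0 i + unit_row i j + unit_row ord0 j.
Proof.
wlog ltij : i j / (i < j)%N.
  move=> W i0 j0 ij; case: (ltngtP i j) => [lt|lt|/val_inj E]; first exact: W.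
    have [|r [Hr|Hr]] := W _ _ lt j0 i0; first by rewrite eq_sym.
      by exists r; left; rewrite unit_row_sym.
    by exists r; right; rewrite Hr (unit_row_sym j i) addrC [_ + unit_row i j]addrC addrA.
  by rewrite E eqxx in ij.
move=> i0 j0 _.
have i0' : (0 < i)%N by rewrite lt0n; apply: contraNneq i0 => E; apply/eqP/val_inj.
case: hN => [[/perm_mem pN _]|[/perm_mem p1 /perm_mem p2]].
  have [|r Hr] := @mem_rows _ _ N (triangle ord0 i j); last by exists r; right.
  rewrite pN mem_cat; apply/orP; right; apply/mapP; exists (i, j) => //.
  by rewrite mem_filter mem_enum inE /= i0'.
have [jm|jm] := eqVneq j ord_max.
  have [|r Hr] := @mem_rows _ _ N (triangle ord0 i j); last by exists r; right.
  apply: (@mem_drop 'C(d.+1, 2)); rewrite p2 jm inE; apply/orP; right.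
  apply/mapP; exists i => //; rewrite mem_filter mem_enum i0' /= andbT.
  by rewrite jm in ltij.
have [|r Hr] := @mem_rows _ _ N (unit_row i j); last by exists r; left.
apply: (@mem_take 'C(d.+1, 2)); rewrite p1; apply/mapP; exists (i, j) => //.
rewrite mem_filter mem_enum !inE /= ltij andbT ltn_neqAle -ltnS ltn_ord andbT.
by apply: contraNneq jm => E; apply/eqP/val_inj.
Qed.

End CanonicalRows.

(** An affine dependency [c] of the points, completed by [- kap], where [kap] is the weighted sum of
    the squared norms, lies in the kernel of the bordered matrix. *)
Lemma cm_degenerate (F : fieldType) d (P : 'M[F]_(d.+2, d)) :
  cm (fun i j => \sum_a (P i a - P j a) ^+ 2) = 0.
Proof.
pose B := row_mx P (const_mx 1 : 'cV_d.+2).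
have : kermx B != 0.
  rewrite kermx_eq0 /row_free neq_ltn; apply/orP; left.
  by rewrite (leq_ltn_trans (rank_leq_col _)) // addn1.
case/rowV0Pn => c /sub_kermxP cB c0.
move: cB; rewrite /B mul_mx_row -[RHS]row_mx0 => /eq_row_mx[cP c1].
have cPa a : \sum_i c 0 i * P i a = 0 by move/rowP/(_ a): cP; rewrite !mxE.
have c1s : \sum_i c 0 i = 0.
  move/rowP/(_ 0): c1; rewrite !mxE => c1; apply: etrans _ c1.
  by apply: eq_bigr => i _; rewrite mxE mulr1.
pose kap := \sum_i c 0 i * \sum_a P i a ^+ 2.
apply/eqP/det0P; exists (row_mx c (- kap)%:M).
  apply: contra c0 => /eqP E; apply/eqP.
  by rewrite -(row_mxKl c (- kap)%:M) E linear0.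
rewrite /bordered mul_row_block mulmx0 addr0 c1.
rewrite (_ : c *m _ + _ = 0) ?row_mx0 //; apply/rowP => j; rewrite !mxE.
rewrite big_ord1 !mxE eqxx mulr1n mulr1.
rewrite (eq_bigr (fun i => c 0 i * (\sum_a P i a ^+ 2) + c 0 i * (\sum_a P j a ^+ 2)
   - 2 * \sum_a c 0 i * P i a * P j a)) => [|i _]; last first.
  rewrite mxE; have -> : \sum_a (P i a - P j a) ^+ 2 =
    \sum_a P i a ^+ 2 + \sum_a P j a ^+ 2 - 2 * \sum_a P i a * P j a.
    rewrite mulr_sumr -sumrN -!big_split /=; apply: eq_bigr => a _; ring.
  have -> : \sum_a c 0 i * P i a * P j a = c 0 i * \sum_a P i a * P j a.
    by rewrite mulr_sumr; apply: eq_bigr => a _; rewrite mulrA.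
  ring.
rewrite !big_split /= -/kap -mulr_suml c1s mul0r addr0 sumrN -mulr_sumr exchange_big /=.
rewrite [X in 2 * X]big1 => [|a _]; last by rewrite -mulr_suml cPa mul0r.
by rewrite mulr0 oppr0 addr0 subrr.
Qed.

(** * Reconstruction *)

(** Genericity speaks of rational polynomials, so the parity coefficient is realized as one, with
    squared distances in coordinates or squares of variables substituted for [G]. *)
Definition parity_mpoly N k (f : {mpoly rat[N]}) (S : {set 'I_N})
    (G : 'I_N -> {mpoly rat[k]}) : {mpoly rat[k]} :=
  \sum_(m <- msupp f | odd_part m == S) f@_m *: \prod_i G i ^+ (m i)./2.

Lemma parity_mpoly_eval (K : numFieldType) N k (f : {mpoly rat[N]}) (S : {set 'I_N})
    (G : 'I_N -> {mpoly rat[k]}) (y : 'I_k -> K) :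
  (map_mpoly ratr (parity_mpoly f S G)).@[y] =
  parity_coef f S (fun i => (map_mpoly ratr (G i)).@[y]).
Proof.
rewrite /parity_mpoly (rmorph_sum (map_mpoly ratr)) (rmorph_sum (meval y)).
apply: eq_bigr => m _.
have E P : (map_mpoly ratr (f@_m *: P)).@[y] = ratr f@_m * (map_mpoly ratr P).@[y] :> K.
  by rewrite map_mpolyZ mevalZ.
apply: etrans (E _) _; congr (_ * _).
rewrite (rmorph_prod (map_mpoly ratr)) (rmorph_prod (meval y)); apply: eq_bigr => i _.
by rewrite (rmorphXn (map_mpoly ratr)) (rmorphXn (meval y)).
Qed.

Lemma eval_real_complex (R : realType) N (f : {mpoly rat[N]}) (y : 'I_N -> R) :
  (map_mpoly ratr f).@[fun i => real_complex R (y i)] =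
  real_complex R (map_mpoly ratr f).@[y].
Proof.
rewrite !map_meval rmorph_sum; apply: eq_bigr => m _.
rewrite rmorphM fmorph_rat rmorph_prod; congr (_ * _).
by apply: eq_bigr => i _; rewrite rmorphXn.
Qed.

Section Vanishing.
Variables (R : realType) (d n : nat) (p : 'M[R]_(n, d.+2)).
Local Notation N := 'C(n, 2).
Variable f : {mpoly rat[N]}.
Local Notation l := (fun e => edge_lengths p e 0).

Lemma edge_lengths2 e : edge_lengths p e 0 ^+ 2 = sqdist p e 0.
Proof. by rewrite [edge_lengths p e 0]mxE sqr_sqrtr // mxE; apply: sumr_ge0 => a _; apply: sqr_ge0. Qed.

Section GenericConfig.
Hypothesis gp : generic_config p.

Lemma generic_signs (s : 'I_N -> bool) : (map_mpoly ratr f).@[l] = 0 ->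
  (map_mpoly ratr f).@[fun e => (-1) ^+ s e * l e] = 0.
Proof.
move=> fl.
pose g (r : seq 'I_N) e := (-1) ^+ ((e \in r) && s e) * l e.
suff H r : uniq r -> (map_mpoly ratr f).@[g r] = 0.
  by rewrite -(H _ (enum_uniq 'I_N)); apply: meval_eq => e; rewrite /g mem_enum.
elim: r => [|e r IH] /=; first by move=> _; rewrite -fl; apply: meval_eq => e; rewrite /g mul1r.
case/andP=> er /IH fr.
have g2 e' : g r e' ^+ 2 = sqdist p e' 0 by rewrite exprMn sqrr_sign mul1r edge_lengths2.
have [se|se] := boolP (s e).
  rewrite -(generic_flip gp e g2 fr); apply: meval_eq => e'.
  rewrite /flip1 /g inE; case: eqVneq => // ->.
  by rewrite se (negbTE er) /= expr0 expr1 mulN1r mul1r.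
rewrite -fr; apply: meval_eq => e'; rewrite /g inE.
by case: eqVneq => // ->; rewrite (negbTE se) !andbF.
Qed.

Lemma generic_length_neq0 e : edge_lengths p e 0 != 0.
Proof.
rewrite -sqrf_eq0 edge_lengths2 mxE gt_eqF // (bigD1 0) //= ltr_wpDr //.
  by apply: sumr_ge0 => a _; apply: sqr_ge0.
by rewrite exprn_even_gt0 //= generic_coord // neq_ltn edge_lt.
Qed.

(** All sign changes of the lengths are zeros of [f], so the parity coefficient vanishes at the
    squared lengths. By genericity it is then the zero polynomial in the coordinates. *)
Lemma generic_config_parity (S : {set 'I_N}) (q : 'M[R[i]]_(n, d.+2)) :
  (map_mpoly ratr f).@[l] = 0 -> parity_coef f S (fun e => sqdist q e 0) = 0.
Proof.
move=> fl.
have /eqP := parity_vanish (fun s => generic_signs s fl) S.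
rewrite mulf_eq0 => /orP[|/eqP pc0].
  by case/prodf_eq0 => e _; rewrite (negbTE (generic_length_neq0 e)).
have Z : parity_mpoly f S (@sqdist_mpoly n d.+2) = 0.
  apply: gp; rewrite parity_mpoly_eval -[RHS]pc0; apply: eq_bigr => m _.
  by congr (_ * _); apply: eq_bigr => e _; rewrite sqdist_mpoly_mxvec edge_lengths2.
have E := parity_mpoly_eval f S (@sqdist_mpoly n d.+2) (fun k => mxvec q 0 k).
rewrite Z !rmorph0 in E; rewrite [RHS]E; apply: eq_bigr => m _.
by congr (_ * _); apply: eq_bigr => e _; rewrite sqdist_mpoly_mxvec.
Qed.

End GenericConfig.

Section GenericLengths.
Hypothesis gl : generic_in_L d.+2 (mx_to_complex (edge_lengths p)).
Local Notation lc := (fun e => mx_to_complex (edge_lengths p) e 0).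

Lemma L_set_sqrt (q : 'M[R[i]]_(n, d.+2)) (y : 'I_N -> R[i]) :
  (forall e, y e ^+ 2 = sqdist q e 0) -> @L_set R d.+2 n (\col_e y e).
Proof.
by move=> y2; exists q => //; apply/matrixP => e j; rewrite ord1 -y2 !mxE.
Qed.

(** Here the sign changes are immediate, since [L_set] is closed under them. Genericity is used
    again to carry the vanishing of the parity coefficient to all of [L_set]. *)
Lemma generic_in_L_parity (S : {set 'I_N}) (q : 'M[R[i]]_(n, d.+2)) :
  (map_mpoly ratr f).@[lc] = 0 -> parity_coef f S (fun e => sqdist q e 0) = 0.
Proof.
move=> fl; have [[p' _ Ep'] gen] := gl.
have l2 e : lc e ^+ 2 = sqdist p' e 0 by rewrite Ep' [RHS]mxE.
have gen' (g : {mpoly rat[N]}) (q' : 'M[R[i]]_(n, d.+2)) (y : 'I_N -> R[i]) : (map_mpoly ratr g).@[lc] = 0 ->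
    (forall e, y e ^+ 2 = sqdist q' e 0) -> (map_mpoly ratr g).@[y] = 0.
  move=> gl0 y2; rewrite -(gen g gl0 _ (L_set_sqrt y2)).
  by apply: meval_eq => e; rewrite mxE.
(* A vanishing coordinate would vanish on all of [L_set], but the points [q0] on a line are
   distinct. *)
have ln0 e : lc e != 0.
  apply/eqP => le0.
  pose q0 : 'M[R[i]]_(n, d.+2) := \matrix_(k, a) (if a == 0 then k%:R else 0).
  pose y e := sqrtC (sqdist q0 e 0).
  have y2 e' : y e' ^+ 2 = sqdist q0 e' 0 by apply: sqrtCK.
  have /eqP : y e = 0.
    have := gen' 'X_e q0 y; rewrite !map_mpolyX !mevalXU; exact.
  apply/negP; rewrite -sqrf_eq0 y2 mxE (bigD1 0) //= big1 ?addr0 => [|a a0].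
    by rewrite !mxE eqxx sqrf_eq0 subr_eq0 eqr_nat neq_ltn edge_lt.
  by rewrite !mxE (negbTE a0) subrr expr0n.
have /eqP : (\prod_(i in S) lc i) * parity_coef f S (fun i => lc i ^+ 2) = 0.
  apply: parity_vanish => s; apply: (gen' f p') => // e.
  by rewrite exprMn sqrr_sign mul1r.
rewrite mulf_eq0 => /orP[|/eqP pc0].
  by case/prodf_eq0 => e _; rewrite (negbTE (ln0 e)).
pose G e : {mpoly rat[N]} := 'X_e ^+ 2.
have GE (y : 'I_N -> R[i]) e : (map_mpoly ratr (G e)).@[y] = y e ^+ 2.
  by rewrite /G (rmorphXn (map_mpoly ratr)) (rmorphXn (meval y)) /= map_mpolyX mevalXU.
pose y e := sqrtC (sqdist q e 0).
have y2 e' : y e' ^+ 2 = sqdist q e' 0 by apply: sqrtCK.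
have EG (x : 'I_N -> R[i]) : (map_mpoly ratr (parity_mpoly f S G)).@[x] =
    parity_coef f S (fun e => x e ^+ 2).
  rewrite parity_mpoly_eval; apply: eq_bigr => m _; congr (_ * _).
  by apply: eq_bigr => e _; rewrite GE.
have : (map_mpoly ratr (parity_mpoly f S G)).@[y] = 0.
  apply: (gen' (parity_mpoly f S G) q y _ y2); rewrite (EG lc); exact: pc0.
rewrite (EG y) => <-; apply: eq_bigr => m _; congr (_ * _).
by apply: eq_bigr => e _; rewrite y2.
Qed.

End GenericLengths.

Lemma parity_coef0 (S : {set 'I_N}) (q : 'M[R[i]]_(n, d.+2)) :
  generic_config p \/ generic_in_L d.+2 (mx_to_complex (edge_lengths p)) ->
  (map_mpoly ratr f).@[fun e => mx_to_complex (edge_lengths p) e 0] = 0 ->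
  parity_coef f S (fun e => sqdist q e 0) = 0.
Proof.
case=> [gp|gl] fl; last exact: generic_in_L_parity.
apply: generic_config_parity => //; apply/(fmorph_inj (real_complex R)).
apply: etrans (esym (eval_real_complex _ _)) _; rewrite rmorph0 -fl.
by apply: meval_eq => e; rewrite [RHS]mxE.
Qed.

End Vanishing.

(** A rational relation between the rows of [A] would be one between the entries of [w]. *)
Lemma indep_row_free (K : numFieldType) m k (A : 'M[rat]_(m, k)) (x : 'cV[K]_k)
    (w : 'cV[K]_m) :
  w = map_mx ratr A *m x ->
  (forall c : 'I_m -> rat, \sum_i ratr (c i) * w i 0 = 0 -> forall i, c i = 0) ->
  row_free A.
Proof.
move=> Ew ind; rewrite -kermx_eq0; apply/negPn/negP => /rowV0Pn[c /sub_kermxP cA /negP].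
apply; apply/eqP/rowP => i; rewrite mxE; apply: (ind (c 0)).
have : (map_mx ratr c *m w) 0 0 = 0.
  by rewrite Ew mulmxA -map_mxM cA map_mx0 mul0mx mxE.
by rewrite mxE => E; rewrite -[RHS]E; apply: eq_bigr => j _; rewrite mxE.
Qed.

Lemma unit_row_sum (S : comNzRingType) (phi : {rmorphism rat -> S}) n (i j : 'I_n) :
  i != j -> exists2 e, inc i e && inc j e &
  forall x : 'I_('C(n, 2)) -> S, \sum_e' phi (unit_row i j 0 e') * x e' = x e.
Proof.
move=> ij; have [e ije E] := unit_row_edge ij; exists e => // x.
rewrite (bigD1 e) //= E eqxx rmorph1 mul1r big1 ?addr0 // => e' ee'.
by rewrite E (negbTE ee') rmorph0 mul0r.
Qed.

Lemma inc_both n (i j : 'I_n) e : i != j -> inc i e && inc j e ->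
  edge e = (i, j) \/ edge e = (j, i).
Proof.
rewrite /inc; case: (edge e) => a b /= ij /andP[/orP[]/eqP Ei /orP[]/eqP Ej]; subst.
- by rewrite eqxx in ij.
- by left.
- by right.
- by rewrite eqxx in ij.
Qed.

Lemma unit_row_self n (r e : 'I_('C(n, 2))) :
  unit_row (edge r).1 (edge r).2 0 e = (e == r)%:R.
Proof.
have lt := edge_lt r; rewrite mxE -surjective_pairing (inj_eq (@edge_inj n)).
case: (eqVneq e r) => //= _; case: eqP => // E; have := edge_lt e.
by rewrite E /= ltnNge ltnW.
Qed.

Lemma sqdist_inc (S : comNzRingType) d n (q : 'M[S]_(n, d)) (i j : 'I_n) e : i != j ->
  inc i e && inc j e -> sqdist q e 0 = \sum_a (q i a - q j a) ^+ 2.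
Proof.
move=> ij /(inc_both ij)[] E; rewrite mxE E //.
by apply: eq_bigr => a _; rewrite -sqrrN opprB.
Qed.

Lemma pullback_rat (K : numFieldType) n k (V : 'I_('C(n, 2)) -> 'I_k.+4 -> 'I_k.+4 -> rat)
    (y : 'I_('C(n, 2)) -> rat) :
  (map_mpoly ratr (pullback V)).@[fun e => ratr (y e)] = ratr (cm (sqr2 (Z V y))) :> K.
Proof.
rewrite pullback_eval cm_rmorph; apply: cm_ext => i j.
rewrite /sqr2 rmorphXn rmorph_sum; congr (_ ^+ 2).
by apply: eq_bigr => e _; rewrite rmorphM mulrC.
Qed.

(** The constants lie in the larger field [K], but they are determined by the rational values of [P]
    at 0, 1 and 2; agreement at all natural numbers then identifies [P]. *)
Lemma quadratic_size (P : {poly rat}) (K : numFieldType) (a b c : K) :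
  (forall m : nat, ratr P.[m%:R] = a + b *+ m + c *+ (m * m.-1)) -> (size P <= 3)%N.
Proof.
move=> H; pose g m : rat := P.[m%:R]; pose c' := (g 2%N - 2 * g 1%N + g 0%N) / 2.
have a0 : a = ratr (g 0%N) by rewrite /g H !mulr0n !addr0.
have b0 : b = ratr (g 1%N) - ratr (g 0%N).
  by rewrite /g !H !mulr0n !addr0 mulr1n addrAC subrr add0r.
have c0 : c = ratr c'.
  rewrite /c' fmorph_div rmorphD rmorphB rmorphM !rmorph_nat /= /g !H.
  by rewrite !muln0 !mulr0n !mulr1n muln1; field.
clearbody c'; have -> : P = (g 0%N)%:P + (g 1%N - g 0%N) *: 'X + c' *: ('X * ('X - 1)).
  apply: poly_nat_ext => m; apply: (fmorph_inj (ratr : rat -> K)) => /=.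
  rewrite H a0 b0 c0.
  have -> : ((g 0%N)%:P + (g 1%N - g 0%N) *: 'X + c' *: ('X * ('X - 1))).[m%:R] =
    g 0%N + (g 1%N - g 0%N) * m%:R + c' * (m%:R * (m%:R - 1)) by rewrite !hornerE.
  rewrite !(rmorphB, rmorphD, rmorphM, rmorph_nat, rmorph1) /=.
  move: (ratr (g 0%N)) (ratr (g 1%N)) (ratr c' : K) => u v t.
  case: m => [|m]; first by rewrite !mulr0n mul0r !mulr0.
  rewrite /= -(mulr_natr (v - u)) -(mulr_natr t) natrM.
  by rewrite -[m.+1]addn1 natrD; ring.
rewrite -polyC1 (leq_trans (size_polyD _ _)) // geq_max; apply/andP; split.
  rewrite (leq_trans (size_polyD _ _)) // geq_max; apply/andP; split.
    by rewrite (leq_trans (size_polyC_leq1 _)).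
  by rewrite (leq_trans (size_scale_leq _ _)) // size_polyX.
rewrite (leq_trans (size_scale_leq _ _)) // mulrC size_mulX ?polyXsubC_eq0 //.
by rewrite size_XsubC.
Qed.

Section Reconstruction.
Variables (R : realType) (d n : nat).
Local Notation D := ('C(d.+4, 2)).
Local Notation C := R[i].
Variables (N : 'M[rat]_D) (p : 'M[R]_(n, d.+2)) (x : 'cV[C]_D) (E Gam : 'M[rat]_(D, 'C(n, 2))).
Hypothesis hN : is_N1 N \/ is_N2 N.
Hypothesis hp : generic_config p \/ generic_in_L d.+2 (mx_to_complex (edge_lengths p)).
Hypothesis Lx : L_set d.+2 x.
Hypothesis NE : N *m E = Gam.
Hypothesis Gam0 : forall r e, 0 <= Gam r e.
Hypothesis xE : x = map_mx ratr E *m mx_to_complex (edge_lengths p).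
Variable E' : 'M[rat]_('C(n, 2), D).
Hypothesis EE' : E *m E' = 1%:M.

Definition column e (i j : 'I_d.+4) : rat := (unit_row i j *m E) 0 e.

Lemma column_sym0 e : sym0 (column e).
Proof.
split=> [i j|i]; rewrite /column; first by rewrite unit_row_sym.
by rewrite unit_row_diag mul0mx mxE.
Qed.

Lemma column_surj z : sym0 z -> exists y, forall i j, Z column y i j = z i j.
Proof.
case=> zs z0; pose zc : 'cV_D := \col_r z (edge r).1 (edge r).2.
exists (fun e => (E' *m zc) e 0) => i j.
transitivity ((unit_row i j *m zc) 0 0).
  rewrite -[in RHS](mul1mx zc) -EE' -(mulmxA E) (mulmxA (unit_row i j)) [RHS]mxE.
  by apply: eq_bigr => e _; rewrite mulrC.
have [->|ij] := eqVneq i j; first by rewrite unit_row_diag mul0mx mxE z0.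
have [e ije S] := unit_row_sum idfun ij.
rewrite mxE; apply: etrans (S (fun e => zc e 0)) _; rewrite mxE.
by have [->|->] := inc_both ij ije.
Qed.

(** At the lengths of [p] the map [E] gives [x], whose squares are the squared distances of [d.+4]
    points in dimension [d.+2], so [cm_degenerate] applies. *)
Lemma pullback_lengths :
  (map_mpoly ratr (pullback column)).@[fun e => mx_to_complex (edge_lengths p) e 0] = 0.
Proof.
have [P _ EP] := Lx.
rewrite pullback_eval; apply: etrans (cm_degenerate P); apply: cm_ext => i j.
rewrite /sqr2.
have -> : \sum_e ratr (column e i j) * mx_to_complex (edge_lengths p) e 0 =
    \sum_r ratr (unit_row i j 0 r) * x r 0.
  transitivity ((map_mx ratr (unit_row i j *m E) *m mx_to_complex (edge_lengths p)) 0 0).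
    by rewrite [RHS]mxE; apply: eq_bigr => e _; congr (_ * _); rewrite [RHS]mxE.
  rewrite map_mxM -mulmxA -xE [LHS]mxE.
  by apply: eq_bigr => e _; congr (_ * _); rewrite [LHS]mxE.
have [->|ij] := eqVneq i j.
  rewrite unit_row_diag big1 ?expr0n => [|r _]; last by rewrite mxE rmorph0 mul0r.
  by rewrite big1 // => a _; rewrite subrr expr0n.
have [r ijr S] := unit_row_sum (ratr : {rmorphism rat -> C}) ij.
by rewrite (S (fun r => x r 0)) -(sqdist_inc P ij ijr) EP mxE.
Qed.

Lemma column_parity (S : {set 'I_('C(n, 2))}) (q : 'M[C]_(n, d.+2)) :
  parity_coef (pullback column) S (fun e => sqdist q e 0) = 0.
Proof. exact: parity_coef0 hp pullback_lengths. Qed.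

Lemma column_even s y : cm (sqr2 (Z column (flip s y))) = cm (sqr2 (Z column y)).
Proof.
apply: (fmorph_inj (ratr : rat -> C)) => /=; rewrite -!pullback_rat.
rewrite -[RHS](pullback_flip column_parity s); apply: meval_eq => e.
by rewrite rmorphM rmorph_sign.
Qed.

Lemma column_star (v : 'I_n) s y : (size (cmt (Z column y) (Z column (signed_star v s))) <= 3)%N.
Proof.
have [a [b [c H]]] := pullback_star column_parity v s (fun e => ratr (y e)).
apply: (@quadratic_size _ C a b c) => m; rewrite -H cmt_horner.
transitivity (ratr (cm (sqr2 (Z column (fun e => 1 * y e + m%:R * signed_star v s e)))) : C).
  congr (ratr _); apply: cm_ext => i j; rewrite /sqr2; congr (_ ^+ 2).
  by rewrite ZD mul1r.
rewrite -pullback_rat; apply: meval_eq => e.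
rewrite mul1r rmorphD rmorphM rmorph_nat /signed_star; case: ifP => _; last by rewrite rmorph0.
by rewrite rmorph_sign.
Qed.

Lemma row_column r : row r N *m E = row r Gam.
Proof. by rewrite -row_mul NE. Qed.

Lemma column_pos e j : 0 <= column e ord0 j.
Proof.
have [->|j0] := eqVneq j ord0; first by rewrite /column unit_row_diag mul0mx mxE.
have [r [a [a0 Er]]] := ping_row hN j0.
have := Gam0 r e; have := congr1 (fun A : 'rV_('C(n, 2)) => A 0 e) (row_column r).
by rewrite /= Er -scalemxAl [LHS]mxE [RHS]mxE => <-; rewrite pmulr_rge0.
Qed.

Lemma column_pos2 e i j : column e ord0 i = 0 -> column e ord0 j = 0 -> 0 <= column e i j.
Proof.
have [V1 V2] := column_sym0 e.
have [->|i0] := eqVneq i ord0; first by move=> _ ->.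
have [->|j0] := eqVneq j ord0; first by rewrite V1 => ->.
have [->|ij] := eqVneq i j; first by rewrite V2.
move=> Vi Vj; have [r Er] := triangle_row hN i0 j0 ij.
have := Gam0 r e; have := congr1 (fun A : 'rV_('C(n, 2)) => A 0 e) (row_column r).
rewrite /= [RHS]mxE => <-; case: Er => -> //.
have addE (A B : 'rV[rat]_('C(n, 2))) : (A + B) 0 e = A 0 e + B 0 e by rewrite mxE.
rewrite !mulmxDl !addE.
by rewrite /column in Vi Vj *; rewrite Vi Vj add0r addr0.
Qed.

Lemma reconstruction : exists T : 'I_d.+4 -> 'I_n, exists2 mu : R, 0 < mu &
  injective T /\ x = mx_to_complex (mu *: edge_lengths (rowsub T p)).
Proof.
have [T [mu [injT mu0 H]]] := embedding column_sym0 column_surj column_even column_star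
  column_pos column_pos2.
exists T, (ratr mu); first by rewrite ltr0q.
split=> //; apply/matrixP => r k; rewrite ord1 xE {k}.
have rr : (edge r).1 != (edge r).2 by rewrite neq_ltn edge_lt.
have TT : T (edge r).1 != T (edge r).2 by rewrite (inj_eq injT).
have [e ije S] := unit_row_sum (ratr : {rmorphism rat -> C}) TT.
have Ee e' : E r e' = mu * unit_row (T (edge r).1) (T (edge r).2) 0 e'.
  have := H e' (edge r).1 (edge r).2.
  have := unit_rowE idfun (T (edge r).1) (T (edge r).2) e' => /= ->; rewrite TT rr /= => <-.
  rewrite /column mxE (bigD1 r) //= big1 ?addr0 => [|r' rr'].
    by rewrite unit_row_self eqxx mul1r.
  by rewrite unit_row_self (negbTE rr') mul0r.
rewrite mxE; transitivity (ratr mu * mx_to_complex (edge_lengths p) e 0 : C).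
  rewrite -(S (fun e => mx_to_complex (edge_lengths p) e 0)) mulr_sumr.
  by apply: eq_bigr => e' _; rewrite [map_mx _ _ _ _]mxE Ee rmorphM -mulrA.
rewrite [in LHS]mxE [RHS]mxE -(fmorph_rat (real_complex R)) -rmorphM.
congr (real_complex R _); rewrite [RHS]mxE; congr (_ * _); rewrite ![edge_lengths _ _ _]mxE; congr (Num.sqrt _).
rewrite (sqdist_inc p TT ije) mxE.
by apply: eq_bigr => a _; rewrite !mxE.
Qed.

End Reconstruction.

Local Open Scope classical_set_scope.
Local Open Scope ring_scope.

Theorem theorem7 (R : realType) (d n : nat) (hd : (2 <= d)%N)
    (hn : (d.+2 <= n)%N)
    (N : 'M[rat]_('C(d.+2, 2))) (hN : is_N1 N \/ is_N2 N)
    (w : 'cV[R[i]]_('C(d.+2, 2)))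
    (hrank : rational_rank (fun r => w r 0) = 'C(d.+2, 2))
    (hw : [set map_mx ratr N *m x | x in @L_set R d d.+2] w)
    (p : 'M[R]_(n, d))
    (hp : generic_config p \/ generic_in_L d (mx_to_complex (edge_lengths p)))
    (gamma : 'I_('C(d.+2, 2)) -> 'rV[rat]_('C(n, 2)))
    (hgamma : forall r, nonneg_functional (gamma r))
    (hwp : forall r, w r 0 = real_complex R (measure_config (gamma r) p)) :
  exists T : 'I_d.+2 -> 'I_n,
    [/\ injective T,
        exists2 s : R, 0 < s &
          w = mx_to_complex (s *: (map_mx ratr N *m edge_lengths (rowsub T p)))
      & forall (q : 'M[R]_(d.+2, d)) (s : R), 0 < s ->
          w = mx_to_complex (s *: (map_mx ratr N *m edge_lengths q)) ->
          similar_configs (rowsub T p) q].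
Proof.
case: d hd hn N hN w hrank hw p hp gamma hgamma hwp => [|[|d]] // _ _ N hN w hrank.
case=> x Lx Nx p hp gamma hgamma hwp.
have ind := full_rank_indep hrank.
have Nu : N \in unitmx by rewrite -row_free_unit; apply: indep_row_free ind; rewrite -Nx.
pose Gam : 'M[rat]_('C(d.+4, 2), 'C(n, 2)) := \matrix_(r, k) gamma r 0 k.
pose lc := mx_to_complex (edge_lengths p).
have wG : w = map_mx ratr Gam *m lc.
  apply/matrixP => r k; rewrite ord1 hwp [RHS]mxE rmorph_sum; apply: eq_bigr => e _.
  by rewrite rmorphM fmorph_rat /lc /Gam; congr (_ * _); rewrite !mxE.
have /row_freeP[Gi GG] : row_free Gam by apply: indep_row_free ind; exact: wG.
pose E := invmx N *m Gam.
have NE : N *m E = Gam by rewrite mulKVmx.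
have EE' : E *m (Gi *m N) = 1%:M by rewrite -mulmxA (mulmxA Gam) GG mul1mx mulVmx.
have xE : x = map_mx ratr E *m lc.
  apply: (can_inj (mulKmx (_ : map_mx ratr N \in unitmx))); first by rewrite map_unitmx.
  by rewrite Nx mulmxA -map_mxM NE.
have Gam0 r e : 0 <= Gam r e by rewrite mxE; apply: hgamma.
have [T [mu mu0 [injT Ex]]] := reconstruction hN hp Lx NE Gam0 xE EE'.
have cN m (A : 'M[R]_('C(d.+4, 2), m)) :
    mx_to_complex (map_mx ratr N *m A) = map_mx ratr N *m mx_to_complex A.
  rewrite /mx_to_complex map_mxM; congr (_ *m _); apply/matrixP => i j.
  by rewrite !mxE; exact: fmorph_rat.
have Ew : w = mx_to_complex (mu *: (map_mx ratr N *m edge_lengths (rowsub T p))).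
  by rewrite scalemxAr cN -Ex Nx.
exists T; split=> //; first by exists mu.
move=> q s s0; rewrite Ew => /map_mx_inj.
(* Cancelling the invertible [N] leaves [s] times the lengths of [q] equal to [mu] times those of
   the subconfiguration, whence the ratio [mu / s]. *)
rewrite !scalemxAr => /(can_inj (mulKmx (_ : map_mx ratr N \in unitmx))) Eq.
apply: (@similar_edge_lengths _ _ _ _ _ (mu / s)); first exact: divr_gt0.
rewrite mulrC -scalerA Eq ?map_unitmx // scalerA mulVf ?scale1r //.
by rewrite gt_eqF.
Qed.
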